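(* Let $\theta$ be a non-constant inner function, let $g\in\mathcal{G}(H^\infty)$ with inverse $\tilde g=g^{-1}\in H^\infty$, and let $\phi=\overline{\theta}g$. Let $\{u_1,\dots,u_n\}$ and $\{v_1,\dots,v_n\}$ be orthonormal sets in $H^2$ and let $R_n:H^2\to H^2$, $R_n(h)=H_\phi(h)+\sum_{i=1}^n\langle h,u_i\rangle v_i$. Then $\ker R_n$ is an almost shift invariant subspace with defect at most $2n$, and the defect space is contained in $$F=\bigvee\Big\{\,H_{\breve{\theta}\breve{\tilde g}}(S^*v_i),\ T_{\tilde g}\Big(P_{\theta H^2}(gu_i)-\Big\langle \frac{P_{\theta H^2}(gu_i)}{\theta},1\Big\rangle\theta\Big)\ :\ i=1,2,\dots,n\,\Big\}.$$ That is, there is a subspace $F_0\subseteq F$ with $\dim F_0\le 2n$ such that $Sh\in\ker R_n+F_0$ for every $h\in\ker R_n$.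
   Context: $\mathbb{D}$ is the open unit disk and $\mathbb{T}$ the unit circle. $H^2$ is the Hardy space on $\mathbb{D}$, identified via boundary values with the closed subspace of $L^2(\mathbb{T})$ spanned by $\{z^k:k\ge 0\}$, where $z=e^{it}$ on $\mathbb{T}$. $H^\infty$ is the algebra of bounded holomorphic functions on $\mathbb{D}$, viewed inside $L^\infty(\mathbb{T})$. An inner function is an element of $H^\infty$ with unimodular boundary values a.e. on $\mathbb{T}$. $\mathcal{G}(H^\infty)=\{g\in H^\infty: g^{-1}\in H^\infty,\ |g|=\text{constant (a.e. on }\mathbb{T})\}$. $P:L^2(\mathbb{T})\to H^2$ is the orthogonal projection, and $P_{\mathcal M}$ is the orthogonal projection of $H^2$ onto a closed subspace $\mathcal M\subseteq H^2$. The flip operator $J:L^2(\mathbb{T})\to L^2(\mathbb{T})$ is $(Jf)(\xi)=f(\overline{\xi})$, and $\breve f=Jf$. For $\phi\in L^\infty(\mathbb{T})$ the Toeplitz operator $T_\phi:H^2\to H^2$ is $T_\phi(f)=P(\phi f)$ and the Hankel operator $H_\phi:H^2\to H^2$ is $H_\phi(f)=PJ(\phi f)$. $S$ is the shift $Sf(z)=zf(z)$ on $H^2$ and $S^*$ the backward shift $S^*f(z)=\frac{f(z)-f(0)}{z}$. $\bigvee$ denotes closed linear span in $H^2$. A closed subspace $M\subseteq H^2$ is almost shift invariant if $SM\subseteq M+F$ for some finite-dimensional subspace $F$ (a defect space); the smallest possible dimension of such an $F$ is called the defect of $M$. *)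

(* Defs.v *)
From HB Require Import structures.
From mathcomp Require Import all_boot all_order all_algebra.
From mathcomp Require Import complex.
From mathcomp Require Import all_classical all_reals all_analysis.
Set Implicit Arguments.
Unset Strict Implicit.
Unset Printing Implicit Defensive.
Import Order.TTheory GRing.Theory Num.Theory.
Import numFieldNormedType.Exports.
Local Open Scope classical_set_scope.
Local Open Scope ring_scope.
Local Open Scope complex_scope.

(* A function on the circle T is represented by a map C -> C of which only the
   values on the unit circle matter; it is pulled back to the real line by
   t |-> e^(it), and two functions are identified when they agree a.e. on T. *)

Lemma ltNpi_pi (R : realType) : - pi < pi :> R.
Proof. by rewrite gtrN // pi_gt0. Qed.

Section Circle.
Variable R : realType.
Local Notation C := (R[i]).
Implicit Types (f g gi h p phi theta : C -> C) (A M F : set (C -> C)).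

(* dt / 2pi on [-pi, pi], so that T has total mass 1 *)
Definition arc_measure : probability _ R := uniform_prob (ltNpi_pi R).

Definition expi (t : R) : C := cos t +i* sin t.

Definition aeq f h : Prop := {ae arc_measure, forall t, f (expi t) = h (expi t)}.

Definition Lp_circle (q : \bar R) : set (C -> C) :=
  [set f | (fun t => complex.Re (f (expi t))) \in Lfun arc_measure q /\
           (fun t => complex.Im (f (expi t))) \in Lfun arc_measure q].

Definition L2_circle := Lp_circle 2%:E.
Definition Linfty_circle := Lp_circle +oo%E.

Definition cintegral f : C :=
  (\int[arc_measure]_t complex.Re (f (expi t))) +i* (\int[arc_measure]_t complex.Im (f (expi t))).

Definition inner_L2 f h : C := cintegral (fun z => f z * (h z)^*).

Definition norm2 f : R := Num.sqrt (complex.Re (inner_L2 f f)).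

Definition closureL2 A : set (C -> C) :=
  [set f | L2_circle f /\ forall e : R, 0 < e -> exists2 p, A p & norm2 (f \- p) < e].

Definition lin_span A : set (C -> C) :=
  [set p | exists m (w : 'I_m -> C -> C) (c : 'I_m -> C),
    (forall i, A (w i)) /\ p = (fun z => \sum_(i < m) c i * w i z)].

Definition cspan A := closureL2 (lin_span A).

(* boundary functions; see disk_value for the extension to the disk *)
Definition H2 := cspan [set f | exists k : nat, f = (fun z => z ^+ k)].

(* any two candidates agree a.e. *)
Definition ortho_proj M f : C -> C :=
  xget (fun=> 0) [set p | M p /\ forall m, M m -> inner_L2 (f \- p) m = 0].

Definition holomorphic_disk (Phi : C -> C) : Prop :=
  forall w : C, `|w| < 1 -> derivable (Phi : C^o -> C^o) w 1.

Definition bounded_disk (Phi : C -> C) : Prop :=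
  exists B : C, forall w : C, `|w| < 1 -> `|Phi w| <= B.

Definition radial_boundary_value (Phi : C -> C) f : Prop :=
  {ae arc_measure, forall t,
    (fun r : R => Phi (r%:C * expi t) : C^o) @ 1^'- --> (f (expi t) : C^o)}.

Definition Hinfty : set (C -> C) :=
  [set f | Linfty_circle f /\ exists Phi : C -> C,
    [/\ holomorphic_disk Phi, bounded_disk Phi & radial_boundary_value Phi f]].

Definition inner_function theta : Prop :=
  Hinfty theta /\ {ae arc_measure, forall t, `|theta (expi t)| = 1}.

Definition nonconstant f : Prop := ~ exists c : C, aeq f (fun=> c).

(* the inverse is relational: pointwise (g z)^-1 would make g = 0 invertible,
   as 0^-1 = 0 *)
Definition inverse_in_Hinfty g gi : Prop := Hinfty gi /\ aeq (g \* gi) (fun=> 1).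

Definition GHinfty : set (C -> C) :=
  [set g | [/\ Hinfty g, exists gi, inverse_in_Hinfty g gi &
    exists c : C, {ae arc_measure, forall t, `|g (expi t)| = c}]].

Definition flipJ f : C -> C := fun z => f z^*.

Definition toeplitz phi f : C -> C := ortho_proj H2 (phi \* f).
Definition hankel phi f : C -> C := ortho_proj H2 (flipJ (phi \* f)).

(* value at w in the unit disk of the holomorphic function with boundary
   values f in H2, by the Cauchy formula *)
Definition disk_value f (w : C) : C :=
  cintegral (fun z => f z / (1 - w * z^*)).

Definition shift_op f : C -> C := fun z => z * f z.
Definition backward_shift f : C -> C := fun z => (f z - disk_value f 0) / z.

Definition mul_space theta M : set (C -> C) :=
  [set f | L2_circle f /\ exists2 h, M h & aeq f (theta \* h)].

Definition orthonormal_family n (u : 'I_n -> C -> C) : Prop :=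
  forall i j, inner_L2 (u i) (u j) = (i == j)%:R.

Definition hankel_perturbation phi n (u v : 'I_n -> C -> C) h : C -> C :=
  fun z => hankel phi h z + \sum_(i < n) inner_L2 h (u i) * v i z.

Definition op_ker (T : (C -> C) -> C -> C) : set (C -> C) :=
  [set h | H2 h /\ aeq (T h) (fun=> 0)].

(* closedness of M also makes it stable under a.e. equality *)
Definition closed_subspace M : Prop :=
  [/\ M `<=` H2, M (fun=> 0),
      forall (c : C) f h, M f -> M h -> M (fun z => c * f z + h z) &
      closureL2 M `<=` M].

Definition free_family d (w : 'I_d -> C -> C) : Prop :=
  forall c : 'I_d -> C, aeq (fun z => \sum_(i < d) c i * w i z) (fun=> 0) ->
  forall i, c i = 0.

Definition subspace_of_dim d F : Prop :=
  exists w : 'I_d -> C -> C,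
    [/\ forall i, H2 (w i), free_family w &
        F = [set f | H2 f /\ exists c : 'I_d -> C,
                     aeq f (fun z => \sum_(i < d) c i * w i z)]].

Definition defect_space M d F : Prop :=
  subspace_of_dim d F /\
  forall h, M h -> exists m f, [/\ M m, F f & aeq (shift_op h) (m \+ f)].

Definition almost_shift_invariant M : Prop :=
  closed_subspace M /\ exists d F, defect_space M d F.

Definition has_defect M d : Prop :=
  (exists F, defect_space M d F) /\
  forall e F, defect_space M e F -> (d <= e)%N.

End Circle.

(* Main.v *)
Require Import Defs.
From mathcomp Require Import all_boot all_order all_algebra.
From mathcomp Require Import complex ring lra.
From mathcomp Require Import all_classical all_reals all_analysis measurable_realfun.
Set Implicit Arguments.
Unset Strict Implicit.
Unset Printing Implicit Defensive.
Import Order.TTheory GRing.Theory Num.Theory.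
Import numFieldNormedType.Exports.
Local Open Scope classical_set_scope.
Local Open Scope ring_scope.
Local Open Scope complex_scope.

(** On the circle [conj g = |g|^2 gt] with [|g|] constant, so both [g] and its
    conjugate have boundary values in [H^2], and [g] is a constant [gamma <> 0] almost
    everywhere ([H2_conj_const]). The Hankel operator in question is therefore
    [gamma] times the one with symbol [conj theta], which is [f |-> P J(conj theta f)]. It
    annihilates [z theta H^2], and on the complement of [z theta H^2] the map
    [f |-> J(conj theta f)] takes values in [H^2] already
    ([inner_prehankel_shift_mul], [prehankel_model_H2]).

    Let [h] be in the kernel of the perturbed operator and split [z h = k + y], with
    [y] in [z theta H^2] and [k] orthogonal to it. Pairing [k] with the complement of
    [z theta H^2] amounts to pairing [J(conj theta h)] with [z H^2]; the kernel equation
    evaluates the latter and yields [k = - \sum <h, u_i> f1_i], where [f1_i] is the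
    Hankel generator built from the backward shift of [v_i]. As for [y], the Hankel
    operator kills it, so it is in the kernel as soon as it is orthogonal to all
    [u_i]. The Toeplitz generator [f2_i] is the projection of [u_i] onto
    [z theta H^2] ([toeplitz_defectP]); subtracting from [y] its projection on the
    span of the [f2_i] leaves an element of the kernel. So [z h] is in the kernel
    plus the span of the [2 n] generators ([shift_decomposition]), and
    Gram-Schmidt extracts a basis of that span.

    Two analytic facts carry this. Orthogonal projections exist because [L^2] of
    the circle is complete ([riesz_fischer], [projection_exists]). Boundary functions
    of bounded holomorphic functions belong to the closed span of the monomials
    ([Hinfty_H2]): Goursat's bisection on polar rectangles gives Cauchy's theorem
    for difference quotients ([goursat], [cauchy_dquot]), the geometric series then
    approximates every dilate [Phi (r z)] by polynomials ([poly_approx]), and the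
    dilates tend to the boundary function by dominated convergence.

    Functions are compared almost everywhere throughout, so equalities between
    elements of [L^2] are statements [aeq]; they are proved by testing against
    [H^2] ([H2_eq0]). *)

Local Notation Re := (@complex.Re _).
Local Notation Im := (@complex.Im _).
Local Notation normc := ComplexField.Normc.normc.

(** * Real and imaginary parts *)

Section ComplexParts.
Variable R : realType.
Local Notation "z ^*" := (Num.conj z) : complex_scope.
Implicit Types (x y z : R[i]) (a : R).

Lemma cReD x y : Re (x + y) = Re x + Re y. Proof. by case: x; case: y. Qed.
Lemma cImD x y : Im (x + y) = Im x + Im y. Proof. by case: x; case: y. Qed.
Lemma cReM x y : Re (x * y) = Re x * Re y - Im x * Im y.
Proof. by case: x; case: y. Qed.
Lemma cImM x y : Im (x * y) = Re x * Im y + Im x * Re y.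
Proof. by case: x; case: y. Qed.
Lemma cReJ x : Re x^* = Re x. Proof. by case: x. Qed.
Lemma cImJ x : Im x^* = - Im x. Proof. by case: x. Qed.

Lemma cReN x : Re (- x) = - Re x. Proof. by case: x. Qed.
Lemma cImN x : Im (- x) = - Im x. Proof. by case: x. Qed.

Lemma cRe_real a : Re a%:C = a. Proof. by []. Qed.

Definition cpartE :=
  (cReD, cImD, cReN, cImN, cReM, cImM, cReJ, cImJ).

Lemma complexP x y : Re x = Re y -> Im x = Im y -> x = y.
Proof. by case: x; case: y => /= ? ? ? ? -> ->. Qed.

Lemma normCE z : `|z| = (normc z)%:C. Proof. by case: z. Qed.

Lemma normc_ge0 z : 0 <= normc z. Proof. by case: z => a b; exact: sqrtr_ge0. Qed.

Lemma sqr_normcE z : normc z ^+ 2 = Re z ^+ 2 + Im z ^+ 2.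
Proof. by case: z => a b /=; rewrite sqr_sqrtr// addr_ge0 ?sqr_ge0. Qed.

Lemma Re_le_normc z : `|Re z| <= normc z.
Proof.
rewrite -(ler_pXn2r (n := 2))// ?nnegrE ?normc_ge0//.
by rewrite sqr_normcE real_normK ?num_real// lerDl sqr_ge0.
Qed.

Lemma Im_le_normc z : `|Im z| <= normc z.
Proof.
rewrite -(ler_pXn2r (n := 2))// ?nnegrE ?normc_ge0//.
by rewrite sqr_normcE real_normK ?num_real// lerDr sqr_ge0.
Qed.

Lemma normc_leD z : normc z <= `|Re z| + `|Im z|.
Proof.
rewrite -(ler_pXn2r (n := 2))// ?nnegrE ?normc_ge0// ?addr_ge0//.
rewrite sqr_normcE sqrrD !real_normK ?num_real//.
by rewrite -addrA lerD2l lerDr mulrn_wge0// mulr_ge0.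
Qed.

Lemma normcB x y : normc (x - y) = normc (y - x).
Proof. by rewrite -(@normcN R (x - y)) opprB. Qed.

Lemma normcX x n : normc (x ^+ n) = normc x ^+ n.
Proof.
by elim: n => [|n ih]; rewrite ?expr0 ?ComplexField.Normc.normc1//
  !exprS ComplexField.Normc.normcM ih.
Qed.

Lemma normc_real a : normc a%:C = `|a|.
Proof. by rewrite /= expr0n/= addr0 sqrtr_sqr. Qed.

Lemma mul_conjc z : z * z^* = (normc z ^+ 2)%:C.
Proof.
by apply: complexP; rewrite !cpartE /= ?sqr_normcE; ring.
Qed.

End ComplexParts.

(** * Integrals of complex-valued functions *)

Section ComplexIntegral.
Context d (T : measurableType d) (R : realType).
Context (m : {measure set T -> \bar R}) (D : set T).
Local Notation "z ^*" := (Num.conj z) : complex_scope.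
Hypothesis mD : measurable D.
Implicit Types (F G : T -> R[i]).

Definition cmeasurable F :=
  measurable_fun D (Re \o F) /\ measurable_fun D (Im \o F).

Definition cintegrable F :=
  m.-integrable D (EFin \o (Re \o F)) /\ m.-integrable D (EFin \o (Im \o F)).

Definition cint F : R[i] :=
  (\int[m]_(t in D) Re (F t)) +i* (\int[m]_(t in D) Im (F t)).

Lemma cmeasurableD F G :
  cmeasurable F -> cmeasurable G -> cmeasurable (fun t => F t + G t).
Proof.
move=> [F1 F2] [G1 G2]; split.
  rewrite [_ \o _](_ : _ = (Re \o F) \+ (Re \o G)); first exact: measurable_funD.
  by apply/funext => t /=; rewrite cpartE.
rewrite [_ \o _](_ : _ = (Im \o F) \+ (Im \o G)); first exact: measurable_funD.
by apply/funext => t /=; rewrite cpartE.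
Qed.

Lemma cmeasurableM F G :
  cmeasurable F -> cmeasurable G -> cmeasurable (fun t => F t * G t).
Proof.
move=> [F1 F2] [G1 G2]; split.
  rewrite [_ \o _](_ : _ =
    ((Re \o F) \* (Re \o G)) \- ((Im \o F) \* (Im \o G))).
    by apply: measurable_funB; exact: measurable_funM.
  by apply/funext => t /=; rewrite cpartE.
rewrite [_ \o _](_ : _ =
  ((Re \o F) \* (Im \o G)) \+ ((Im \o F) \* (Re \o G))).
  by apply: measurable_funD; exact: measurable_funM.
by apply/funext => t /=; rewrite cpartE.
Qed.

Lemma cmeasurableJ F : cmeasurable F -> cmeasurable (fun t => (F t)^*).
Proof.
move=> [F1 F2]; split.
  rewrite [_ \o _](_ : _ = Re \o F)//.
  by apply/funext => t /=; rewrite cpartE.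
rewrite [_ \o _](_ : _ = \- (Im \o F)).
  exact: (measurableT_comp _ F2).
by apply/funext => t /=; rewrite cpartE.
Qed.

Lemma cmeasurable_cst (c : R[i]) : cmeasurable (fun=> c).
Proof. by split; exact: measurable_cst. Qed.

Lemma cintegrable_meas F : cintegrable F -> cmeasurable F.
Proof.
by move=> [/integrableP[/measurable_EFinP F1 _] /integrableP[/measurable_EFinP F2 _]].
Qed.

Lemma cintegrableD F G :
  cintegrable F -> cintegrable G -> cintegrable (fun t => F t + G t).
Proof.
move=> [F1 F2] [G1 G2]; split.
  apply: eq_integrable (integrableD mD F1 G1) => // t _.
  by rewrite /= cpartE EFinD.
apply: eq_integrable (integrableD mD F2 G2) => // t _.
by rewrite /= cpartE EFinD.
Qed.

Lemma cintegrableZ (c : R[i]) F :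
  cintegrable F -> cintegrable (fun t => c * F t).
Proof.
move=> [F1 F2]; split.
  apply: eq_integrable (integrableB mD (integrableZl mD (Re c) F1)
    (integrableZl mD (Im c) F2)) => // t _.
  by rewrite /= cpartE EFinD EFinN !EFinM.
apply: eq_integrable (integrableD mD (integrableZl mD (Re c) F2)
    (integrableZl mD (Im c) F1)) => // t _.
by rewrite /= cpartE EFinD !EFinM.
Qed.

Lemma cintegrableN F : cintegrable F -> cintegrable (fun t => - F t).
Proof.
move=> /(cintegrableZ (-1)); under eq_fun do rewrite mulN1r.
by [].
Qed.

Lemma cintD F G : cintegrable F -> cintegrable G ->
  cint (fun t => F t + G t) = cint F + cint G.
Proof.
move=> [F1 F2] [G1 G2]; apply: complexP => /=.
  by under eq_Rintegral do rewrite cReD; rewrite RintegralD.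
by under eq_Rintegral do rewrite cImD; rewrite RintegralD.
Qed.

Lemma cintZ (c : R[i]) F : cintegrable F ->
  cint (fun t => c * F t) = c * cint F.
Proof.
move=> [F1 F2]; apply: complexP => /=.
  under eq_Rintegral do rewrite cReM.
  rewrite RintegralB// ?RintegralZl ?cReM//.
    by apply: eq_integrable (integrableZl mD (Re c) F1).
  by apply: eq_integrable (integrableZl mD (Im c) F2).
under eq_Rintegral do rewrite cImM.
rewrite RintegralD// ?RintegralZl ?cImM//.
  by apply: eq_integrable (integrableZl mD (Re c) F2).
by apply: eq_integrable (integrableZl mD (Im c) F1).
Qed.

Lemma cintB F G : cintegrable F -> cintegrable G ->
  cint (fun t => F t - G t) = cint F - cint G.
Proof.
move=> iF iG; rewrite cintD//; last exact: cintegrableN.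
congr (_ + _); rewrite -mulN1r -cintZ//.
by congr cint; apply/funext => t; rewrite mulN1r.
Qed.

Lemma cintJ F : cintegrable F -> cint (fun t => (F t)^*) = (cint F)^*.
Proof.
move=> [F1 F2]; apply: complexP => /=.
  by apply: eq_Rintegral => t _; rewrite cReJ.
under eq_Rintegral do rewrite cImJ -mulN1r.
by rewrite RintegralZl// mulN1r.
Qed.

Lemma cint_sum I (s : seq I) (F : I -> T -> R[i]) :
  (forall i, cintegrable (F i)) ->
  cintegrable (fun t => \sum_(i <- s) F i t) /\
  cint (fun t => \sum_(i <- s) F i t) = \sum_(i <- s) cint (F i).
Proof.
move=> iF; elim: s => [|i s [ih1 ih2]].
  under eq_fun do rewrite big_nil.
  rewrite big_nil; split.
    by split; apply: eq_integrable (integrable0 m D).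
  by apply: complexP => /=; rewrite /Rintegral integral0.
under eq_fun do rewrite big_cons.
split; first exact: cintegrableD.
by rewrite cintD// ih2 big_cons.
Qed.

Lemma eq_cint F G : (forall t, D t -> F t = G t) -> cint F = cint G.
Proof.
move=> FG; apply: complexP => /=; apply: eq_Rintegral => t /set_mem Dt;
  by rewrite FG.
Qed.

Lemma ae_eq_cint F G : cmeasurable F -> cmeasurable G ->
  {ae m, forall t, D t -> F t = G t} -> cint F = cint G.
Proof.
move=> [F1 F2] [G1 G2] FG; apply: complexP => /=; congr fine.
  apply: ae_eq_integral => //; [exact/measurable_EFinP|exact/measurable_EFinP|].
  by apply: filterS FG => t + Dt => /(_ Dt) ->.
apply: ae_eq_integral => //; [exact/measurable_EFinP|exact/measurable_EFinP|].
by apply: filterS FG => t + Dt => /(_ Dt) ->.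
Qed.

Lemma le_cintegrable F (g : T -> R) : cmeasurable F ->
  m.-integrable D (EFin \o g) -> (forall t, D t -> normc (F t) <= g t) ->
  cintegrable F.
Proof.
move=> [F1 F2] ig Fg; split.
  apply: le_integrable ig => //; first exact/measurable_EFinP.
  move=> t Dt /=; rewrite lee_fin.
  by rewrite (le_trans (Re_le_normc _))// (le_trans (Fg _ Dt))// ler_norm.
apply: le_integrable ig => //; first exact/measurable_EFinP.
move=> t Dt /=; rewrite lee_fin.
by rewrite (le_trans (Im_le_normc _))// (le_trans (Fg _ Dt))// ler_norm.
Qed.

Lemma cint_bound F (M L : R) : cintegrable F -> m D = L%:E ->
  (forall t, D t -> normc (F t) <= M) -> normc (cint F) <= 2 * (M * L).
Proof.
move=> [F1 F2] mDL FM.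
have iM : m.-integrable D (EFin \o (fun=> M)).
  apply/integrableP; split; first exact: measurable_cst.
  by rewrite /= integral_cst// mDL -EFinM ltry.
have cM : \int[m]_(t in D) M = M * L by rewrite Rintegral_cst// mDL.
apply: (le_trans (normc_leD _)); rewrite mulr2n mulrDl mul1r /=.
apply: lerD; (apply: le_trans (le_normr_Rintegral _ _) _ => //).
  rewrite -cM; apply: le_Rintegral => //; first exact: integrable_norm.
  by move=> t Dt; rewrite (le_trans (Re_le_normc _))// FM.
rewrite -cM; apply: le_Rintegral => //; first exact: integrable_norm.
by move=> t Dt; rewrite (le_trans (Im_le_normc _))// FM.
Qed.

End ComplexIntegral.

(** * Arc length on the circle and its L^2 space *)

Section ArcMeasure.
Variable R : realType.
Local Notation C := R[i].
Local Notation "z ^*" := (Num.conj z) : complex_scope.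
Local Notation mu := (arc_measure R).
Local Notation TR := (measurableTypeR R).
Implicit Types (f h k : C -> C) (F G : TR -> C) (t : TR).

Lemma aeS (P Q : TR -> Prop) : (forall t, P t -> Q t) ->
  {ae mu, forall t, P t} -> {ae mu, forall t, Q t}.
Proof. exact: (@filterS _ _ (ae_filter_ringOfSetsType mu)). Qed.

Lemma aeS2 (P Q S : TR -> Prop) : (forall t, P t -> Q t -> S t) ->
  {ae mu, forall t, P t} -> {ae mu, forall t, Q t} -> {ae mu, forall t, S t}.
Proof. exact: (@filterS2 _ _ (ae_filter_ringOfSetsType mu)). Qed.

Lemma aeT (P : TR -> Prop) : (forall t, P t) -> {ae mu, forall t, P t}.
Proof.
move=> aP; apply: (@aeS setT) => //.
exact: (@filterT _ _ (ae_filter_ringOfSetsType mu)).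
Qed.

Lemma measurable_opp : measurable_fun setT (-%R : TR -> TR).
Proof. exact: oppr_measurable. Qed.

Lemma uniform_pdfN t : uniform_pdf (- pi) pi (- t) = uniform_pdf (- pi) pi t :> R.
Proof.
rewrite /uniform_pdf; congr (if _ then _ else _).
by rewrite lerN2 lerNl andbC.
Qed.

(** The flip [z |-> conj z] becomes [t |-> - t]; invariance under it is what makes
    [flipJ] unitary. *)
Lemma arc_measureN (A : set TR) : measurable A ->
  pushforward mu (-%R : TR -> TR) A = mu A.
Proof.
move=> mA; rewrite /pushforward /arc_measure /= /uniform_prob.
have mf : measurable_fun setT (fun x : TR => (uniform_pdf (- pi) pi x)%:E).
  by apply/measurable_EFinP; exact: measurable_uniform_pdf.
transitivity (\int[pushforward lebesgue_measure (-%R : TR -> TR)]_(x in A)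
   (uniform_pdf (- pi) pi x)%:E)%E; last first.
  by apply: eq_measure_integral => B mB _; exact: lebesgue_measureN.
rewrite (ge0_integral_pushforward measurable_opp)//=.
- by apply: eq_integral => x _; rewrite uniform_pdfN.
- exact: measurable_funTS.
- by move=> x _; rewrite lee_fin uniform_pdf_ge0// ltNpi_pi.
Qed.

Lemma integral_arcN (f : TR -> \bar R) : mu.-integrable setT f ->
  mu.-integrable setT (fun t => f (- t)) /\
  (\int[mu]_t f (- t)%R = \int[mu]_t f t)%E.
Proof.
move=> intf.
have mf : measurable_fun setT f by case/integrableP: intf.
have intN : mu.-integrable setT (fun t => f (- t)).
  apply/integrableP; split; first exact: (measurableT_comp mf measurable_opp).
  case/integrableP : intf => _; apply: le_lt_trans.
  rewrite [leRHS](_ : _ = \int[pushforward mu (-%R : TR -> TR)]_x `|f x|)%E; last first.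
    by apply: eq_measure_integral => A mA _; exact/esym/arc_measureN.
  rewrite (ge0_integral_pushforward measurable_opp)//.
  exact: measurableT_comp.
split => //.
transitivity (\int[pushforward mu (-%R : TR -> TR)]_x f x)%E; last first.
  by apply: eq_measure_integral => A mA _; exact: arc_measureN.
by rewrite (integral_pushforward measurable_opp).
Qed.

Lemma cint_arcN F : cintegrable mu setT F ->
  cintegrable mu setT (fun t => F (- t)) /\
  cint mu setT (fun t => F (- t)) = cint mu setT F.
Proof.
move=> [/integral_arcN[F1 F1'] /integral_arcN[F2 F2']]; split; first by split.
by apply: complexP => /=; rewrite /Rintegral ?F1' ?F2'.
Qed.

Lemma ae_arcN (P : TR -> Prop) : {ae mu, forall t, P t} -> {ae mu, forall t, P (- t)}.
Proof.
move=> [N [mN N0 PN]]; exists ((-%R : TR -> TR) @^-1` N); split.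
- by rewrite -[X in measurable X]setTI; exact: measurable_opp.
- by have := arc_measureN mN; rewrite /pushforward N0.
- by move=> t /= /PN.
Qed.

Lemma expiN t : expi (- t) = (expi t)^*.
Proof. by rewrite /expi cosN sinN. Qed.

Lemma normc_expi t : normc (expi t) = 1.
Proof. by rewrite /= cos2Dsin2 sqrtr1. Qed.

Lemma expiD s t : expi (s + t) = expi s * expi t :> C.
Proof. by apply: complexP; rewrite cpartE /= ?cosD ?sinD//; ring. Qed.

Lemma expi0 : expi 0 = 1 :> C.
Proof. by rewrite /expi cos0 sin0. Qed.

Lemma expi_neq0 t : expi t != 0.
Proof.
apply: contra_eq_neq (normc_expi t) => ->.
by rewrite ComplexField.Normc.normc0 eq_sym oner_eq0.
Qed.

Lemma mul_expiJ t : expi t * (expi t)^* = 1.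
Proof. by rewrite mul_conjc normc_expi expr1n. Qed.

Lemma expiJE t : (expi t)^* = (expi t)^-1.
Proof. by rewrite -[RHS]mul1r -(mul_expiJ t) mulrC mulrA mulVf ?mul1r// expi_neq0. Qed.

Lemma cmeasurable_expi : cmeasurable setT (@expi R : TR -> C).
Proof.
split; apply: continuous_measurable_fun.
  exact: continuous_cos.
exact: continuous_sin.
Qed.

Definition circ f : TR -> C := fun t => f (expi t).

Definition cmeas f := cmeasurable setT (circ f).

Lemma cmeasD f h : cmeas f -> cmeas h -> cmeas (fun z => f z + h z).
Proof. exact: cmeasurableD. Qed.

Lemma cmeasM f h : cmeas f -> cmeas h -> cmeas (fun z => f z * h z).
Proof. exact: cmeasurableM. Qed.

Lemma cmeasJ f : cmeas f -> cmeas (fun z => (f z)^*).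
Proof. exact: cmeasurableJ. Qed.

Lemma cmeas_cst (c : C) : cmeas (fun=> c).
Proof. exact: cmeasurable_cst. Qed.

Lemma cmeas_id : cmeas id.
Proof. exact: cmeasurable_expi. Qed.

Lemma cmeas_flip f : cmeas f -> cmeas (flipJ f).
Proof.
move=> [f1 f2].
have E : circ (flipJ f) = fun t => circ f (- t).
  by apply/funext => t; rewrite /circ /flipJ expiN.
rewrite /cmeas E; split.
  exact: (measurableT_comp f1 measurable_opp).
exact: (measurableT_comp f2 measurable_opp).
Qed.

Lemma cmeasX f n : cmeas f -> cmeas (fun z => f z ^+ n).
Proof.
move=> mf; elim: n => [|n ih]; first exact: cmeas_cst.
by under [X in cmeas X]eq_fun do rewrite exprS; exact: cmeasM.
Qed.

Lemma measurable_sqr_normc f : cmeas f ->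
  measurable_fun setT (fun t : TR => normc (f (expi t)) ^+ 2).
Proof.
move=> [f1 f2]; under eq_fun do rewrite sqr_normcE.
by apply: measurable_funD; exact: measurable_funX.
Qed.

(** Pointwise [f^-1 = conj f / |f|^2]; the real inverse is measurable as the power
    function with exponent [-1], which also takes the value [0] at [0]. *)
Lemma cmeasV f : cmeas f -> cmeas (fun z => (f z)^-1).
Proof.
move=> mf; pose a z : C := ((normc (f z) ^+ 2) `^ (-1))%:C.
have ma : cmeas a.
  split; last exact: measurable_cst.
  apply: (measurableT_comp (measurable_powR (-1))).
  exact: measurable_sqr_normc.
have := cmeasM (cmeasJ mf) ma; congr cmeas; apply/funext => z.
rewrite /a powR_inv1 ?sqr_ge0//; have [->|f0] := eqVneq (f z) 0.
  by rewrite conjC0 mul0r invr0.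
apply: (mulfI f0); rewrite mulfV// mulrA mul_conjc -rmorphM/= mulfV//.
rewrite expf_neq0//; apply: contra_neq f0 => fz; exact: ComplexField.Normc.eq0_normc.
Qed.

Lemma ae_le_integrable (u g : TR -> R) : measurable_fun setT u ->
  mu.-integrable setT (EFin \o g) -> {ae mu, forall t, `|u t| <= g t} ->
  mu.-integrable setT (EFin \o u).
Proof.
move=> mf ig ug; apply/integrableP; split; first exact/measurable_EFinP.
have /integrableP[/measurable_EFinP mg gfin] := ig.
apply: le_lt_trans gfin; apply: ae_ge0_le_integral => //.
- by apply: measurableT_comp => //; exact/measurable_EFinP.
- by apply: measurableT_comp => //; exact/measurable_EFinP.
- by apply: aeS ug => t ut _ /=; rewrite lee_fin (le_trans ut)// ler_norm.
Qed.

Lemma Lfun2P (u : TR -> R) : u \in Lfun mu 2%:E <->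
  measurable_fun setT u /\ mu.-integrable setT (EFin \o (fun t => u t ^+ 2)).
Proof.
split=> [uL|[mf iu]].
  split; last exact: Lfun2_integrable_sqr.
  by move: uL; rewrite inE => /andP[]; rewrite inE.
rewrite inE; apply/andP; split; rewrite inE//=.
rewrite /finite_norm unlock poweR_lty//.
case/integrableP : iu => _; apply: le_lt_trans.
rewrite le_eqVlt; apply/orP; left; apply/eqP; apply: eq_integral => t _ /=.
by rewrite powR_mulrn// normrX.
Qed.

Lemma L2P f : L2_circle f <->
  cmeas f /\ mu.-integrable setT (EFin \o (fun t : TR => normc (f (expi t)) ^+ 2)).
Proof.
split=> [[/Lfun2P[m1 i1] /Lfun2P[m2 i2]]|[[m1 m2] i]].
  split; first by split.
  apply: eq_integrable (integrableD measurableT i1 i2) => // t _.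
  by rewrite /= sqr_normcE EFinD.
split; apply/Lfun2P; split=> //.
  apply: le_integrable i => //; first exact/measurable_EFinP/measurable_funX.
  move=> t _ /=; rewrite lee_fin !ger0_norm ?sqr_ge0// sqr_normcE.
  by rewrite lerDl sqr_ge0.
apply: le_integrable i => //; first exact/measurable_EFinP/measurable_funX.
move=> t _ /=; rewrite lee_fin !ger0_norm ?sqr_ge0// sqr_normcE.
by rewrite lerDr sqr_ge0.
Qed.

Lemma L2_meas f : L2_circle f -> cmeas f. Proof. by case/L2P. Qed.

Lemma aeq_refl f : aeq f f. Proof. exact: aeT. Qed.
Lemma aeq_sym f h : aeq f h -> aeq h f. Proof. by apply: aeS => t ->. Qed.
Lemma aeq_trans f h k : aeq f h -> aeq h k -> aeq f k.
Proof. by apply: aeS2 => t -> ->. Qed.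

Lemma aeq_flip f h : aeq f h -> aeq (flipJ f) (flipJ h).
Proof.
by move/ae_arcN; apply: aeS => t; rewrite expiN.
Qed.

Lemma L2_aeq f h : cmeas h -> aeq f h -> L2_circle f -> L2_circle h.
Proof.
move=> mh fh /L2P[mf sf]; apply/L2P; split => //.
apply: ae_le_integrable sf _; first exact: measurable_sqr_normc.
by apply: aeS fh => t <-; rewrite ger0_norm// sqr_ge0.
Qed.

Lemma L2_bounded f (B : R) : cmeas f -> {ae mu, forall t, normc (f (expi t)) <= B} ->
  L2_circle f.
Proof.
move=> mf fB; apply/L2P; split => //.
apply: (@ae_le_integrable _ (fun=> B ^+ 2)); first exact: measurable_sqr_normc.
  exact: finite_measure_integrable_cst.
apply: aeS fB => t fB; rewrite ger0_norm ?sqr_ge0//.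
by rewrite lerXn2r// nnegrE ?normc_ge0// (le_trans (normc_ge0 _) fB).
Qed.

Lemma L2_lin (c : C) f h : L2_circle f -> L2_circle h ->
  L2_circle (fun z => c * f z + h z).
Proof.
move=> /L2P[mf sf] /L2P[mh sh]; apply/L2P.
have m : cmeas (fun z => c * f z + h z).
  by apply: cmeasD => //; apply: cmeasM => //; exact: cmeas_cst.
split=> //.
apply: (@ae_le_integrable _ (fun t : TR => 2 * normc c ^+ 2 * normc (f (expi t)) ^+ 2
   + 2 * normc (h (expi t)) ^+ 2)).
- exact: (measurable_sqr_normc m).
- apply: eq_integrable (integrableD measurableT
    (integrableZl measurableT (2 * normc c ^+ 2) sf)
    (integrableZl measurableT 2 sh)) => //.
apply: aeT => t.
rewrite ger0_norm ?sqr_ge0//.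
have := @le_normcD R (c * f (expi t)) (h (expi t)).
rewrite ComplexField.Normc.normcM.
move: (normc_ge0 (c * f (expi t) + h (expi t))) (normc c) (normc (f _)) (normc (h _)).
move: (normc _) => x x0 a b y xy.
have : x ^+ 2 <= (a * b + y) ^+ 2.
  by rewrite lerXn2r// nnegrE// (le_trans x0 xy).
move=> /le_trans; apply.
rewrite -subr_ge0 [leRHS](_ : _ = (a * b - y) ^+ 2) ?sqr_ge0//.
by ring.
Qed.

Lemma L2_cst (c : C) : L2_circle (fun=> c).
Proof.
by apply: (@L2_bounded _ (normc c)); [exact: cmeas_cst|exact: aeT].
Qed.

Lemma L2Z (c : C) f : L2_circle f -> L2_circle (fun z => c * f z).
Proof.
move=> /(L2_lin c)/(_ (L2_cst 0)); congr L2_circle.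
by apply/funext => z; rewrite addr0.
Qed.

Lemma L2D f h : L2_circle f -> L2_circle h -> L2_circle (fun z => f z + h z).
Proof.
move=> Lf Lh; have := L2_lin 1 Lf Lh; congr L2_circle.
by apply/funext => z; rewrite mul1r.
Qed.

Lemma L2B f h : L2_circle f -> L2_circle h -> L2_circle (fun z => f z - h z).
Proof.
move=> Lf Lh; have := L2_lin (-1) Lh Lf; congr L2_circle.
by apply/funext => z; rewrite mulN1r addrC.
Qed.

Lemma L2_sum I (s : seq I) (F : I -> C -> C) : (forall i, L2_circle (F i)) ->
  L2_circle (fun z => \sum_(i <- s) F i z).
Proof.
move=> LF; elim: s => [|i s ih].
  by under [X in L2_circle X]eq_fun do rewrite big_nil; exact: L2_cst.
by under [X in L2_circle X]eq_fun do rewrite big_cons; exact: L2D.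
Qed.

(** Multiplication by such a function is a unitary of [L^2]; inner functions,
    their conjugates and flips, and monomials all act this way. *)
Definition unimodular f := cmeas f /\ {ae mu, forall t, normc (f (expi t)) = 1}.

Lemma unimodularJ f : unimodular f -> unimodular (fun z => (f z)^*).
Proof.
move=> [mf f1]; split; first exact: cmeasJ.
by apply: aeS f1 => t; case: (f _) => a b /=; rewrite sqrrN.
Qed.

Lemma unimodular_id : unimodular id.
Proof. by split; [exact: cmeas_id|apply: aeT => t; exact: normc_expi]. Qed.

Lemma unimodularX f n : unimodular f -> unimodular (fun z => f z ^+ n).
Proof.
move=> [mf f1]; split; first exact: cmeasX.
by apply: aeS f1 => t f1; rewrite normcX f1 expr1n.
Qed.

Lemma unimodular_mulJ f : unimodular f -> aeq (fun z => f z * (f z)^*) (fun=> 1).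
Proof.
by move=> [_]; apply: aeS => t f1; rewrite mul_conjc f1 expr1n.
Qed.

Lemma L2_unimodular f h : unimodular f -> L2_circle h ->
  L2_circle (fun z => f z * h z).
Proof.
move=> [mf f1] /L2P[mh sh]; apply/L2P; split; first exact: cmeasM.
apply: ae_le_integrable sh _; first exact: (measurable_sqr_normc (cmeasM mf mh)).
apply: aeS f1 => t f1.
by rewrite ComplexField.Normc.normcM f1 mul1r ger0_norm// sqr_ge0.
Qed.

Lemma unimodular_L2 f : unimodular f -> L2_circle f.
Proof. by move=> [mf f1]; apply: (L2_bounded mf); apply: aeS f1 => t ->. Qed.

Lemma L2_flip f : L2_circle f -> L2_circle (flipJ f).
Proof.
move=> /L2P[mf sf]; apply/L2P; split; first exact: cmeas_flip.
have [+ _] := integral_arcN sf; apply: eq_integrable => // t _.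
by rewrite /flipJ /= expiN.
Qed.

Lemma inner_integrable f h : L2_circle f -> L2_circle h ->
  cintegrable mu setT (fun t => f (expi t) * (h (expi t))^*).
Proof.
move=> /L2P[mf sf] /L2P[mh sh].
apply: (@le_cintegrable _ _ _ mu setT measurableT _ (fun t : TR => normc (f (expi t)) ^+ 2 + normc (h (expi t)) ^+ 2)).
- by apply: (@cmeasM f (fun z => (h z)^*)) => //; exact: cmeasJ.
- by apply: eq_integrable (integrableD measurableT sf sh) => // t _; rewrite /= EFinD.
move=> t _; rewrite ComplexField.Normc.normcM.
have -> : normc (h (expi t))^* = normc (h (expi t)).
  by case: (h _) => a b /=; rewrite sqrrN.
move: (normc (f _)) (normc (h _)) (normc_ge0 (f (expi t))) (normc_ge0 (h (expi t))) => a b a0 b0.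
have := sqr_ge0 (a - b); rewrite sqrrB => H.
have : 0 <= a * b by exact: mulr_ge0.
lra.
Qed.

Lemma inner_linl (c : C) f h k : L2_circle f -> L2_circle h -> L2_circle k ->
  inner_L2 (fun z => c * f z + h z) k = c * inner_L2 f k + inner_L2 h k.
Proof.
move=> Lf Lh Lk; rewrite /inner_L2 /cintegral -!/(cint mu setT _).
rewrite -cintZ//; last exact: inner_integrable.
rewrite -cintD//; last exact: inner_integrable.
  by apply: eq_cint => t _; rewrite mulrDl mulrA.
by apply: cintegrableZ => //; exact: inner_integrable.
Qed.

Lemma innerC f h : L2_circle f -> L2_circle h -> inner_L2 h f = (inner_L2 f h)^*.
Proof.
move=> Lf Lh; rewrite /inner_L2 /cintegral -!/(cint mu setT _).
rewrite -cintJ//; last exact: inner_integrable.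
by apply: eq_cint => t _; rewrite rmorphM/= conjCK mulrC.
Qed.

Lemma inner_aeq f f' h h' : L2_circle f -> L2_circle f' -> L2_circle h ->
  L2_circle h' -> aeq f f' -> aeq h h' -> inner_L2 f h = inner_L2 f' h'.
Proof.
move=> Lf Lf' Lh Lh' ff' hh'; rewrite /inner_L2 /cintegral -!/(cint mu setT _).
apply: ae_eq_cint => //.
- by apply/cintegrable_meas/inner_integrable.
- by apply/cintegrable_meas/inner_integrable.
by apply: aeS2 ff' hh' => t -> ->.
Qed.

Lemma inner_flip f h : L2_circle f -> L2_circle h ->
  inner_L2 (flipJ f) (flipJ h) = inner_L2 f h.
Proof.
move=> Lf Lh; rewrite /inner_L2 /cintegral -!/(cint mu setT _).
have [_ <-] := cint_arcN (inner_integrable Lf Lh).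
by apply: eq_cint => t _; rewrite /flipJ expiN.
Qed.

Lemma inner_mulJ (a : C -> C) f h :
  inner_L2 (fun z => a z * f z) h = inner_L2 f (fun z => (a z)^* * h z).
Proof.
rewrite /inner_L2 /cintegral -!/(cint mu setT _).
by apply: eq_cint => t _; rewrite rmorphM/= conjCK mulrA [f _ * _]mulrC.
Qed.

Lemma inner_self f : inner_L2 f f = (\int[mu]_t (normc (f (expi t)) ^+ 2))%:C.
Proof.
apply: complexP => /=; rewrite /inner_L2 /cintegral /=.
  by apply: eq_Rintegral => t _; rewrite mul_conjc.
under eq_Rintegral do rewrite mul_conjc /=.
by rewrite /Rintegral integral0.
Qed.

Lemma inner_ge0 f : 0 <= Re (inner_L2 f f).
Proof. by rewrite inner_self /=; apply: Rintegral_ge0 => t _; exact: sqr_ge0. Qed.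

Lemma inner_eq0 f : L2_circle f -> inner_L2 f f = 0 -> aeq f (fun=> 0).
Proof.
move=> /L2P[mf sf]; rewrite inner_self => -[] /eqP.
rewrite /Rintegral fine_eq0; last exact: integrable_fin_num.
move=> /eqP I0.
have /ae_eq_integral_abs : measurable_fun setT (EFin \o (fun t : TR => normc (f (expi t)) ^+ 2)).
  by apply/measurable_EFinP; exact: measurable_sqr_normc.
move=> /(_ mu measurableT)[+ _].
have -> : (\int[mu]_x `|(EFin \o (fun t : TR => normc (f (expi t)) ^+ 2)%R) x| = 0)%E.
  by rewrite -[RHS]I0; apply: eq_integral => t _ /=; rewrite ger0_norm ?sqr_ge0.
move=> /(_ erefl); apply: aeS => t /= /(_ I)[] /eqP.
rewrite sqrf_eq0 => /eqP; exact: ComplexField.Normc.eq0_normc.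
Qed.

End ArcMeasure.

(** * Inner product geometry modulo null sets *)

Section PreHilbert.
Variable R : realType.
Local Notation C := R[i].
Local Notation "z ^*" := (Num.conj z) : complex_scope.
Implicit Types (f h k : C -> C).

Lemma innerZl (c : C) f h : L2_circle f -> L2_circle h ->
  inner_L2 (fun z => c * f z) h = c * inner_L2 f h.
Proof.
move=> Lf Lh; have := inner_linl c Lf (L2_cst 0) Lh.
have -> : inner_L2 (fun=> 0) h = 0.
  transitivity (inner_L2 (fun=> -1 * (1 : C) + 1) h).
    by congr (inner_L2 _ h); apply/funext => z; rewrite mulN1r addNr.
  have := inner_linl (-1) (L2_cst 1) (L2_cst 1) Lh => /= ->.
  by rewrite mulN1r addNr.
by rewrite addr0 => <-; congr inner_L2; apply/funext => z; rewrite addr0.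
Qed.

Lemma inner0l h : L2_circle h -> inner_L2 (fun=> 0) h = 0.
Proof.
move=> Lh; transitivity (0 * inner_L2 (fun=> 0) h); last by rewrite mul0r.
rewrite -innerZl//; last exact: L2_cst.
by congr inner_L2; apply/funext => z; rewrite mul0r.
Qed.

Lemma innerDl f h k : L2_circle f -> L2_circle h -> L2_circle k ->
  inner_L2 (fun z => f z + h z) k = inner_L2 f k + inner_L2 h k.
Proof.
move=> Lf Lh Lk; have := inner_linl 1 Lf Lh Lk; rewrite mul1r => <-.
by congr inner_L2; apply/funext => z; rewrite mul1r.
Qed.

Lemma innerBl f h k : L2_circle f -> L2_circle h -> L2_circle k ->
  inner_L2 (fun z => f z - h z) k = inner_L2 f k - inner_L2 h k.
Proof.
move=> Lf Lh Lk; have := inner_linl (-1) Lh Lf Lk; rewrite mulN1r addrC => <-.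
by congr inner_L2; apply/funext => z; rewrite mulN1r addrC.
Qed.

Lemma innerZr (c : C) f h : L2_circle f -> L2_circle h ->
  inner_L2 h (fun z => c * f z) = c^* * inner_L2 h f.
Proof.
move=> Lf Lh; rewrite (innerC (L2Z c Lf) Lh) innerZl// rmorphM/=.
by rewrite -innerC.
Qed.

Lemma innerDr f h k : L2_circle f -> L2_circle h -> L2_circle k ->
  inner_L2 k (fun z => f z + h z) = inner_L2 k f + inner_L2 k h.
Proof.
move=> Lf Lh Lk; rewrite (innerC (L2D Lf Lh) Lk) innerDl// rmorphD/=.
by rewrite -!innerC.
Qed.

Lemma innerBr f h k : L2_circle f -> L2_circle h -> L2_circle k ->
  inner_L2 k (fun z => f z - h z) = inner_L2 k f - inner_L2 k h.
Proof.
move=> Lf Lh Lk; rewrite (innerC (L2B Lf Lh) Lk) innerBl// rmorphB/=.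
by rewrite -!innerC.
Qed.

Lemma inner_suml I (s : seq I) (F : I -> C -> C) k :
  (forall i, L2_circle (F i)) -> L2_circle k ->
  inner_L2 (fun z => \sum_(i <- s) F i z) k = \sum_(i <- s) inner_L2 (F i) k.
Proof.
move=> LF Lk; elim: s => [|i s ih].
  rewrite big_nil; transitivity (0 * inner_L2 (fun=> 0 : C) k); last by rewrite mul0r.
  rewrite -innerZl//; last exact: L2_cst.
  by congr inner_L2; apply/funext => z; rewrite big_nil mul0r.
rewrite big_cons -ih -innerDl//; last exact: L2_sum.
by congr inner_L2; apply/funext => z; rewrite big_cons.
Qed.

Lemma inner_sumr I (s : seq I) (F : I -> C -> C) k :
  (forall i, L2_circle (F i)) -> L2_circle k ->
  inner_L2 k (fun z => \sum_(i <- s) F i z) = \sum_(i <- s) inner_L2 k (F i).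
Proof.
move=> LF Lk; rewrite (innerC (L2_sum _ LF) Lk) inner_suml// rmorph_sum/=.
by apply: eq_bigr => i _; rewrite -innerC.
Qed.

Lemma inner_real f : inner_L2 f f = (Re (inner_L2 f f))%:C.
Proof. by rewrite inner_self. Qed.

Lemma norm2_ge0 f : 0 <= norm2 f. Proof. exact: sqrtr_ge0. Qed.

Lemma sqr_norm2 f : norm2 f ^+ 2 = Re (inner_L2 f f).
Proof. by rewrite sqr_sqrtr// inner_ge0. Qed.

Lemma inner_norm2 f : inner_L2 f f = (norm2 f ^+ 2)%:C.
Proof. by rewrite sqr_norm2 -inner_real. Qed.

Lemma norm2_eq0 f : L2_circle f -> norm2 f = 0 -> aeq f (fun=> 0).
Proof. by move=> Lf f0; apply: inner_eq0 => //; rewrite inner_norm2 f0 expr0n. Qed.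

Lemma sqr_norm2B f h (c : C) : L2_circle f -> L2_circle h ->
  Re (inner_L2 (fun z => f z - c * h z) (fun z => f z - c * h z)) =
  norm2 f ^+ 2 - 2 * Re (c^* * inner_L2 f h) + normc c ^+ 2 * norm2 h ^+ 2.
Proof.
move=> Lf Lh; have Lch := L2Z c Lh; have LB := L2B Lf Lch.
rewrite innerBl// !innerBr// !innerZl// !innerZr// !inner_norm2.
rewrite (innerC Lf Lh) mulrA mul_conjc.
by move: (inner_L2 f h) => [a b]; case: c {Lch LB} => c d /=; ring.
Qed.

(** [|f - t <f, h> h|^2 >= 0] for all real [t]; the minimum is at [t = 1 / |h|^2],
    and when [|h| = 0] a large [t] forces [<f, h> = 0]. *)
Lemma cauchy_schwarz f h : L2_circle f -> L2_circle h ->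
  normc (inner_L2 f h) <= norm2 f * norm2 h.
Proof.
move=> Lf Lh; set b := inner_L2 f h.
rewrite -(ler_pXn2r (n := 2))// ?nnegrE ?normc_ge0 ?mulr_ge0 ?norm2_ge0//.
rewrite exprMn; set F := norm2 f ^+ 2; set H := norm2 h ^+ 2.
have key (t : R) : 0 <= F - 2 * t * normc b ^+ 2 + t ^+ 2 * normc b ^+ 2 * H.
  have := inner_ge0 (fun z => f z - t%:C * b * h z).
  rewrite sqr_norm2B// -/b -/F -/H ComplexField.Normc.normcM normc_real.
  have -> : (t%:C * b)^* * b = (t * normc b ^+ 2)%:C.
    transitivity ((t%:C)^* * (b * b^*)); first by rewrite rmorphM/=; ring.
    by rewrite mul_conjc; apply: complexP; rewrite !cpartE /=; ring.
  by rewrite exprMn real_normK ?num_real//= mulrA.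
have [H0|H0] := eqVneq H 0.
  have [->|b0] := eqVneq (normc b ^+ 2) 0; first by rewrite H0 mulr0.
  have := key ((F + 1) / (2 * normc b ^+ 2)); rewrite H0 mulr0 addr0.
  rewrite [X in F - X](_ : _ = F + 1); first by lra.
  by field; apply: contraNneq b0 => ->; rewrite expr0n.
have Hgt : 0 < H by rewrite lt_neqAle eq_sym H0 /H sqr_ge0.
clearbody F H.
have := key H^-1.
rewrite [X in 0 <= X](_ : _ = F - normc b ^+ 2 / H); last by field.
by rewrite subr_ge0 ler_pdivrMr.
Qed.

Lemma norm2Z (c : C) f : L2_circle f -> norm2 (fun z => c * f z) = normc c * norm2 f.
Proof.
move=> Lf; apply/eqP; rewrite -(eqrXn2 (n := 2))// ?mulr_ge0 ?norm2_ge0 ?normc_ge0//.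
apply/eqP; rewrite sqr_norm2 innerZl// ?innerZr//; last exact: L2Z.
by rewrite mulrA mul_conjc exprMn inner_norm2 /=; rewrite mul0r subr0.
Qed.

Lemma norm2D f h : L2_circle f -> L2_circle h ->
  norm2 (fun z => f z + h z) <= norm2 f + norm2 h.
Proof.
move=> Lf Lh.
rewrite -(ler_pXn2r (n := 2))// ?nnegrE ?addr_ge0 ?norm2_ge0//.
rewrite sqr_norm2; have LD := L2D Lf Lh.
rewrite innerDl// !innerDr// !inner_norm2 (innerC Lf Lh).
have := cauchy_schwarz Lf Lh; move: (inner_L2 f h) => b.
rewrite !cReD cReJ !cRe_real.
have := Re_le_normc b; have := ler_norm (Re b).
rewrite sqrrD; lra.
Qed.

Lemma norm2_aeq f h : L2_circle f -> L2_circle h -> aeq f h -> norm2 f = norm2 h.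
Proof. by move=> Lf Lh fh; rewrite /norm2 (inner_aeq Lf Lh Lf Lh fh fh). Qed.

Lemma norm2_0 : norm2 (fun=> 0 : C) = 0.
Proof.
have := norm2Z 0 (L2_cst 0); rewrite ComplexField.Normc.normc0 [RHS]mul0r => <-.
by congr norm2; apply/funext => z; rewrite mul0r.
Qed.

Lemma norm2N f : L2_circle f -> norm2 (fun z => - f z) = norm2 f.
Proof.
move=> Lf; have := norm2Z (-1) Lf.
rewrite (@normcN R) ComplexField.Normc.normc1 mul1r => <-.
by congr norm2; apply/funext => z; rewrite mulN1r.
Qed.

Lemma norm2B f h : L2_circle f -> L2_circle h ->
  norm2 (fun z => f z - h z) = norm2 (fun z => h z - f z).
Proof.
move=> Lf Lh; rewrite -(norm2N (L2B Lf Lh)).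
by congr norm2; apply/funext => z; rewrite opprB.
Qed.

Lemma norm2_triangle f h k : L2_circle f -> L2_circle h -> L2_circle k ->
  norm2 (fun z => f z - k z) <= norm2 (fun z => f z - h z) + norm2 (fun z => h z - k z).
Proof.
move=> Lf Lh Lk; apply: le_trans (norm2D (L2B Lf Lh) (L2B Lh Lk)).
by rewrite le_eqVlt; apply/orP; left; apply/eqP; congr norm2; apply/funext => z; ring.
Qed.

Lemma inner_unimodular a f h : unimodular a -> L2_circle f -> L2_circle h ->
  inner_L2 (fun z => a z * f z) (fun z => a z * h z) = inner_L2 f h.
Proof.
move=> ua Lf Lh; rewrite inner_mulJ; apply: inner_aeq => //.
- by apply: L2_unimodular (unimodularJ ua) _; exact: L2_unimodular.
- exact: aeq_refl.
by apply: aeS (unimodular_mulJ ua) => t a1; rewrite mulrA [_^* * _]mulrC a1 mul1r.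
Qed.

Lemma norm2_unimodular a f : unimodular a -> L2_circle f ->
  norm2 (fun z => a z * f z) = norm2 f.
Proof. by move=> ua Lf; rewrite /norm2 inner_unimodular. Qed.

Lemma closure_orth (A : set (C -> C)) f k : L2_circle k ->
  (forall p, A p -> L2_circle p) ->
  (forall p, A p -> inner_L2 p k = 0) -> closureL2 A f -> inner_L2 f k = 0.
Proof.
move=> Lk AL Ak [Lf Af]; apply: ComplexField.Normc.eq0_normc; apply/eqP.
rewrite eq_le normc_ge0 andbT; apply/ler_addgt0Pr => e e0; rewrite add0r.
have k1 : 0 < norm2 k + 1 by rewrite ltr_wpDl// norm2_ge0.
have [p Ap pf] := Af _ (divr_gt0 e0 k1).
have := cauchy_schwarz (L2B Lf (AL _ Ap)) Lk.
rewrite innerBl ?(Ak _ Ap) ?subr0//; last exact: AL.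
move=> /le_trans; apply.
have := ltW pf; rewrite ler_pdivlMr//; apply: le_trans.
by rewrite ler_wpM2l ?norm2_ge0// lerDl.
Qed.

Lemma closureL2_idem (A : set (C -> C)) : (forall p, A p -> L2_circle p) ->
  closureL2 (closureL2 A) `<=` closureL2 A.
Proof.
move=> AL f [Lf Af]; split=> // e e0.
have e2 : 0 < e / 2 by rewrite divr_gt0.
have [p [Lp Ap] pf] := Af _ e2.
have [q Aq qp] := Ap _ e2.
exists q => //; apply: (le_lt_trans (norm2_triangle Lf Lp (AL _ Aq))).
by rewrite (splitr e); exact: ltrD.
Qed.

Lemma closureL2_sub (A : set (C -> C)) f : A f -> L2_circle f -> closureL2 A f.
Proof.
move=> Af Lf; split=> // e e0; exists f => //.
rewrite [X in norm2 X](_ : _ = fun=> 0) ?norm2_0//.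
by apply/funext => z /=; rewrite subrr.
Qed.

Lemma closureL2_aeq (A : set (C -> C)) f h : L2_circle h -> aeq f h ->
  closureL2 A f -> (forall p, A p -> L2_circle p) -> closureL2 A h.
Proof.
move=> Lh fh [Lf Af] AL; split=> // e /Af[p Ap pe]; exists p => //.
have Lp := AL _ Ap.
rewrite (norm2_aeq (h := f \- p) (L2B Lh Lp) (L2B Lf Lp))//.
by apply: aeS fh => t /= ->.
Qed.

Lemma closureL2_lin (A : set (C -> C)) : (forall p, A p -> L2_circle p) ->
  (forall (c : C) p q, A p -> A q -> A (fun z => c * p z + q z)) ->
  forall (c : C) f h, closureL2 A f -> closureL2 A h ->
  closureL2 A (fun z => c * f z + h z).
Proof.
move=> AL Alin c f h [Lf Af] [Lh Ah]; split; first exact: L2_lin.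
move=> e e0.
have c1 : 0 < normc c + 1 by rewrite ltr_wpDl// normc_ge0.
have e2 : 0 < e / 2 by rewrite divr_gt0.
have [p Ap pf] := Af _ (divr_gt0 e2 c1).
have [q Aq qh] := Ah _ e2.
exists (fun z => c * p z + q z); first exact: Alin.
have Lp := AL _ Ap; have Lq := AL _ Aq.
rewrite [X in norm2 X](_ : _ = fun z => c * (f z - p z) + (h z - q z)); last first.
  by apply/funext => z /=; ring.
apply: (le_lt_trans (norm2D (L2Z c (L2B Lf Lp)) (L2B Lh Lq))).
rewrite (splitr e) (norm2Z c (L2B Lf Lp)); apply: ler_ltD => //.
move: pf; rewrite ltr_pdivlMr// => /ltW; apply: le_trans.
by rewrite mulrC ler_wpM2l ?norm2_ge0// lerDl.
Qed.

Lemma lin_span_lin (A : set (C -> C)) (c : C) p q : lin_span A p -> lin_span A q ->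
  lin_span A (fun z => c * p z + q z).
Proof.
move=> [m [w [b [Aw ->]]]] [m' [w' [b' [Aw' ->]]]].
exists (m + m')%N, (fun i => match fintype.split i with inl j => w j | inr j => w' j end),
  (fun i => match fintype.split i with inl j => c * b j | inr j => b' j end); split.
  by move=> i; case: (fintype.split i).
apply/funext => z; rewrite big_split_ord mulr_sumr; congr (_ + _).
  apply: eq_bigr => i _; have -> : fintype.split (lshift m' i) = inl i by exact: (unsplitK (inl i)).
  by rewrite mulrA.
by apply: eq_bigr => i _; have -> : fintype.split (rshift m i) = inr i by exact: (unsplitK (inr i)).
Qed.

Lemma lin_span_sum (A : set (C -> C)) d (w : 'I_d -> C -> C) (c : 'I_d -> C) :
  (forall i, lin_span A (w i)) -> lin_span A (fun z => \sum_(i < d) c i * w i z).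
Proof.
move=> Aw.
have : forall s : seq 'I_d, lin_span A (fun z => \sum_(i <- s) c i * w i z).
  elim=> [|i s ih].
    exists 0%N, (fun _ => fun=> 0), (fun=> 0); split; first by case.
    by apply/funext => z; rewrite big_nil big_ord0.
  under [X in lin_span A X]eq_fun do rewrite big_cons.
  exact: lin_span_lin.
by move=> /(_ (index_enum _)).
Qed.

Lemma lin_span_sub (A : set (C -> C)) f : A f -> lin_span A f.
Proof.
move=> Af; exists 1%N, (fun=> f), (fun=> 1); split=> //.
by apply/funext => z; rewrite big_ord1 mul1r.
Qed.

Lemma lin_span_L2 (A : set (C -> C)) : (forall p, A p -> L2_circle p) ->
  forall p, lin_span A p -> L2_circle p.
Proof.
by move=> AL p [m [w [c [Aw ->]]]]; apply: L2_sum => i; apply/L2Z/AL.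
Qed.

Lemma lin_span_inner (A : set (C -> C)) k : L2_circle k ->
  (forall p, A p -> L2_circle p) -> (forall p, A p -> inner_L2 p k = 0) ->
  forall p, lin_span A p -> inner_L2 p k = 0.
Proof.
move=> Lk AL Ak p [m [w [c [Aw ->]]]].
rewrite inner_suml//; last by move=> i; apply/L2Z/AL.
by apply: big1 => i _; rewrite innerZl ?Ak ?mulr0//; exact: AL.
Qed.

End PreHilbert.

(** * Completeness of L^2 and orthogonal projection *)

Section RieszFischer.
Variable R : realType.
Local Notation C := R[i].
Local Notation "z ^*" := (Num.conj z) : complex_scope.
Local Notation mu := (arc_measure R).
Local Notation TR := (measurableTypeR R).

Lemma norm2_1 : norm2 (fun=> 1 : C) = 1.
Proof.
rewrite /norm2 inner_self cRe_real.
under eq_Rintegral do rewrite ComplexField.Normc.normc1 expr1n.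
by rewrite Rintegral_cst//= probability_setT mul1r sqrtr1.
Qed.

Lemma measurable_normc (f : C -> C) : cmeas f ->
  measurable_fun setT (fun t : TR => normc (f (expi t))).
Proof.
move=> mf.
rewrite [X in measurable_fun _ X](_ : _ = fun t : TR => Num.sqrt (normc (f (expi t)) ^+ 2)); last first.
  by apply/funext => t; rewrite sqrtr_sqr ger0_norm// normc_ge0.
apply: (@measurableT_comp _ _ _ _ _ _ (@Num.sqrt R)) => //.
  exact: (continuous_measurable_fun (@sqrt_continuous R)).
exact: measurable_sqr_normc.
Qed.

Lemma integral_sqr_normc (f : C -> C) : L2_circle f ->
  (\int[mu]_t (normc (f (expi t)) ^+ 2)%:E = (norm2 f ^+ 2)%:E)%E.
Proof.
move=> /L2P[_ /integrable_fin_num fm]; rewrite -[LHS]fineK ?fm//; congr EFin.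
by have := inner_self f; rewrite inner_norm2 => -[].
Qed.

Lemma L1_le_norm2 (f : C -> C) : L2_circle f ->
  (\int[mu]_t (normc (f (expi t)))%:E <= (norm2 f)%:E)%E.
Proof.
move=> Lf; pose a z := (normc (f z))%:C.
have ma : cmeas a.
  by split; [exact: (measurable_normc (L2_meas Lf))|exact: measurable_cst].
have aa t : normc (a (expi t)) = normc (f (expi t)).
  by rewrite normc_real ger0_norm// normc_ge0.
have La : L2_circle a.
  move/L2P : Lf => [mf sf]; apply/L2P; split => //.
  by apply: eq_integrable sf => // t _; rewrite /comp aa.
have L1 := L2_cst (1 : C).
have na : norm2 a = norm2 f.
  by rewrite /norm2 !inner_self !cRe_real; under eq_Rintegral do rewrite aa.
have := cauchy_schwarz La L1; rewrite norm2_1 mulr1 na -lee_fin; apply: le_trans.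
have [i1 _] := inner_integrable La L1.
apply: le_trans (_ : (Re (inner_L2 a (fun=> 1)))%:E <= _)%E; last first.
  by rewrite lee_fin (le_trans (ler_norm _))// Re_le_normc.
rewrite /inner_L2 /cintegral /= /Rintegral fineK; last exact: integrable_fin_num.
apply: ge0_le_integral => //.
- by move=> t _; rewrite lee_fin normc_ge0.
- by apply/measurable_EFinP; exact: (measurable_normc (L2_meas Lf)).
- by case/integrableP : i1.
- by move=> t _ /=; rewrite lee_fin mul0r subr0 mulr1.
Qed.

Lemma cvgn_abs_telescope (v g : nat -> R) :
  (forall k, `|v k.+1 - v k| <= g k) ->
  (\big[+%E/0%E]_(0 <= k <oo) (g k)%:E < +oo)%E -> cvgn v.
Proof.
move=> vg gfin.
have g0 k : 0 <= g k by exact: le_trans (normr_ge0 _) (vg k).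
have cg : cvgn (series g).
  apply: nondecreasing_is_cvgn.
    by apply/nondecreasing_seqP => n; rewrite /series /= big_nat_recr//= lerDl.
  exists (fine (\big[+%E/0%E]_(0 <= k <oo) (g k)%:E)) => _ [n _ <-].
  rewrite -lee_fin fineK; last first.
    by rewrite ge0_fin_numE// nneseries_ge0// => k _ _; rewrite lee_fin.
  rewrite /series /= -sumEFin.
  by apply: nneseries_lim_ge => k _ _; rewrite lee_fin.
have ct : cvgn (series (telescope v)).
  apply: normed_cvg; apply: series_le_cvg cg => //= k; exact: vg.
have -> : v = fun n => v 0%N + series (telescope v) n.
  by apply/funext => n; exact: eq_sum_telescope.
by apply: is_cvgD => //; exact: is_cvg_cst.
Qed.

(** A subsequence whose consecutive distances are below [2^-k] has an absolutely
    convergent telescoping series at almost every point, because its integral is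
    finite. Upper limits define a measurable candidate everywhere, and Fatou's
    lemma bounds its distance to the tail of the sequence. *)
Lemma riesz_fischer (s : nat -> C -> C) : (forall n, L2_circle (s n)) ->
  (forall e : R, 0 < e -> exists N, forall m n, (N <= m)%N -> (N <= n)%N ->
     norm2 (fun z => s m z - s n z) < e) ->
  exists2 f, L2_circle f & forall e : R, 0 < e -> exists N, forall n, (N <= n)%N ->
    norm2 (fun z => f z - s n z) <= e.
Proof.
move=> Ls cs.
have half0 k : 0 < (1 / (2 ^ k.+1)%:R : R) by rewrite divr_gt0// ltr0n expn_gt0.
have /choice[N HN] : forall k, exists N, forall m n, (N <= m)%N -> (N <= n)%N ->
     norm2 (fun z => s m z - s n z) < 1 / (2 ^ k.+1)%:R.
  by move=> k; exact: cs.
(* a monotone index that dominates both [k] and [N k] *)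
pose phi k := (k + \sum_(i < k.+1) N i)%N.
have phiN k : (N k <= phi k)%N by rewrite /phi big_ord_recr/= addnA leq_addl.
have phiS k : (phi k <= phi k.+1)%N.
  by rewrite /phi [in leqRHS]big_ord_recr/= leq_add// leq_addr.
have phige k : (k <= phi k)%N by exact: leq_addr.
pose u k := s (phi k); pose g k (t : TR) := normc (u k.+1 (expi t) - u k (expi t)).
have Lu k : L2_circle (u k) by exact: Ls.
have Ld k : L2_circle (fun z => u k.+1 z - u k z) by exact: L2B.
have mg k : measurable_fun setT (fun t => (g k t)%:E).
  by apply/measurable_EFinP; exact: (measurable_normc (L2_meas (Ld k))).
have g0 k t : (0 <= (g k t)%:E)%E by rewrite lee_fin normc_ge0.
have isum : mu.-integrable setT (fun t => \big[+%E/0%E]_(0 <= k <oo) (g k t)%:E)%E.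
  apply/integrableP; split; first exact: ge0_emeasurable_sum.
  under eq_integral do rewrite gee0_abs ?nneseries_ge0//.
  rewrite integral_nneseries//.
  apply: (@le_lt_trans _ _ (\big[+%E/0%E]_(0 <= k <oo) (1 / (2 ^ k.+1)%:R)%:E)%E).
    apply: lee_nneseries => [k _ _|k _]; first exact: integral_ge0.
    apply: le_trans (L1_le_norm2 (Ld k)) _; rewrite lee_fin ltW// HN//.
    exact: leq_trans (phiN k) (phiS k).
  by apply: (@le_lt_trans _ _ 1%:E); [exact: epsilon_trick0|exact: ltry].
have good : {ae mu, forall t, (\big[+%E/0%E]_(0 <= k <oo) (g k t)%:E < +oo)%E}.
  apply: aeS (integrable_ae measurableT isum) => t /(_ I).
  by rewrite ge0_fin_numE// nneseries_ge0.
(* [fine] returns [0] where the upper limit is infinite, which happens on a null set only *)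
pose f z : C := fine (limn_esup (fun k => (Re (u k z))%:E)) +i*
                fine (limn_esup (fun k => (Im (u k z))%:E)).
have mf : cmeas f.
  split; apply: (measurableT_comp (fine_measurable measurableT));
    apply: measurable_fun_limn_esup => k; apply/measurable_EFinP.
    by have [] := L2_meas (Lu k).
  by have [] := L2_meas (Lu k).
have fine_esup (v : nat -> R) : cvgn v -> v @ \oo --> fine (limn_esup (fun k => (v k)%:E)).
  move=> cv; have H : (fun k => (v k)%:E) @ \oo --> (limn v)%:E.
    by apply: cvg_EFin; [exact: nearW|exact: cv].
  by have [_ ->] := cvg_limn_einf_sup H.
have cvf : {ae mu, forall t, (fun k => Re (u k (expi t))) @ \oo --> Re (f (expi t)) /\
    (fun k => Im (u k (expi t))) @ \oo --> Im (f (expi t))}.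
  apply: aeS good => t gt; split; apply: fine_esup;
    apply: cvgn_abs_telescope gt => k; rewrite /g.
    by rewrite -cReN -cReD Re_le_normc.
  by rewrite -cImN -cImD Im_le_normc.
have main (e : R) n : 0 < e -> (exists M, forall m, (M <= m)%N ->
    norm2 (fun z => s m z - s n z) < e) ->
    (\int[mu]_t (normc (f (expi t) - s n (expi t)) ^+ 2)%:E <= (e ^+ 2)%:E)%E.
  move=> e0 [M HM].
  have Lus m : L2_circle (fun z => u m z - s n z) by exact: L2B.
  have ml m : measurable_fun setT (fun t : TR => (normc (u m (expi t) - s n (expi t)) ^+ 2)%:E).
    by apply/measurable_EFinP; exact: (measurable_sqr_normc (L2_meas (Lus m))).
  apply: (@le_trans _ _ (\int[mu]_t limn_einf (fun m =>
     (normc (u m (expi t) - s n (expi t)) ^+ 2)%:E))%E).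
    rewrite le_eqVlt; apply/orP; left; apply/eqP; apply: ae_eq_integral => //.
    - apply/measurable_EFinP; apply: (@measurable_sqr_normc _ (fun z => f z - s n z)).
      apply: (@cmeasD _ f (fun z => - s n z)) => //.
      by have := L2_meas (L2Z (-1) (Ls n)); under [X in cmeas X -> _]eq_fun do rewrite mulN1r.
    - by apply: measurableT_comp => //; apply: measurable_fun_limn_esup => m; exact: measurableT_comp.
    apply: aeS cvf => t [cRe cIm] _; apply/esym.
    suff H : (normc (u m (expi t) - s n (expi t)) ^+ 2)%:E @[m --> \oo] -->
        (normc (f (expi t) - s n (expi t)) ^+ 2)%:E.
      by have [-> _] := cvg_limn_einf_sup H.
    apply: cvg_EFin; first exact: nearW.
    rewrite sqr_normcE [X in X @ _ --> _](_ : _ = fun m => normc (u m (expi t) - s n (expi t)) ^+ 2)//; under eq_fun do rewrite sqr_normcE.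
    apply: cvgD; rewrite expr2; under eq_fun do rewrite expr2;
      rewrite !(cReD,cReN,cImD,cImN); under eq_fun do rewrite !(cReD,cReN,cImD,cImN);
      by apply: cvgM; apply: cvgB => //; exact: cvg_cst.
  apply: le_trans (fatou _ _ _ _) _ => //.
    by move=> m t _; rewrite lee_fin sqr_ge0.
  rewrite limn_einf_lim; apply: lime_le; first exact: is_cvg_einfs.
  apply: nearW => k; have Mphi : (M <= phi (maxn k M))%N.
    exact: leq_trans (leq_maxr k M) (phige _).
  apply: (@le_trans _ _ (\int[mu]_t (normc (u (maxn k M) (expi t) - s n (expi t)) ^+ 2)%:E)%E).
    by apply: ereal_inf_lbound; exists (maxn k M) => //=; exact: leq_maxl.
  have Lm := Lus (maxn k M).
  rewrite (integral_sqr_normc Lm) lee_fin ler_pXn2r// ?nnegrE ?norm2_ge0// ?ltW//.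
  exact: HM.
have Lf : L2_circle f.
  have [M HM] := cs 1 ltr01.
  have I1 := main 1 M ltr01 (ex_intro _ M (fun m Mm => HM _ _ Mm (leqnn M))).
  have : L2_circle (fun z => f z - s M z).
    have mfs : cmeas (fun z => f z - s M z).
      apply: (@cmeasD _ f (fun z => - s M z)) => //.
      by have := L2_meas (L2Z (-1) (Ls M)); under [X in cmeas X -> _]eq_fun do rewrite mulN1r.
    apply/L2P; split => //; apply/integrableP; split.
      by apply/measurable_EFinP; exact: (measurable_sqr_normc mfs).
    apply: le_lt_trans (ltry (1 ^+ 2)); apply: le_trans I1.
    rewrite le_eqVlt; apply/orP; left; apply/eqP; apply: eq_integral => t _.
    by rewrite gee0_abs// lee_fin sqr_ge0.
  move=> /L2D/(_ (Ls M)); congr L2_circle.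
  by apply/funext => z; rewrite subrK.
exists f => // e e0; have [M HM] := cs _ e0; exists M => n Mn.
have := main e n e0 (ex_intro _ M (fun m Mm => HM _ _ Mm Mn)).
by rewrite (integral_sqr_normc (L2B Lf (Ls n))) lee_fin ler_pXn2r// ?nnegrE ?norm2_ge0// ?ltW.
Qed.

Lemma parallelogram (f p q : C -> C) : L2_circle f -> L2_circle p -> L2_circle q ->
  norm2 (fun z => p z - q z) ^+ 2 =
  2 * norm2 (fun z => f z - p z) ^+ 2 + 2 * norm2 (fun z => f z - q z) ^+ 2 -
  4 * norm2 (fun z => f z - (1 / 2 * p z + 1 / 2 * q z)) ^+ 2.
Proof.
move=> Lf Lp Lq; set a := fun z => f z - p z; set b := fun z => f z - q z.
have La : L2_circle a by exact: L2B.
have Lb : L2_circle b by exact: L2B.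
have -> : (fun z => p z - q z) = (fun z => b z - 1 * a z).
  by apply/funext => z; rewrite /a /b; ring.
have -> : (fun z => f z - (1 / 2 * p z + 1 / 2 * q z)) =
  (fun z => 1 / 2 * (b z - (- 1) * a z)).
  by apply/funext => z; rewrite /a /b; field.
have LL := L2B Lb (L2Z (-1) La).
have E1 := sqr_norm2B 1 Lb La; have E2 := sqr_norm2B (-1) Lb La.
rewrite -sqr_norm2 in E1; rewrite -sqr_norm2 in E2.
rewrite (norm2Z _ LL) exprMn E1 E2.
have -> : normc (1 / 2 : C) ^+ 2 = 1 / 4 :> R.
  rewrite (_ : 1 / 2 = (1 / 2)%:C) ?normc_real; last first.
    by rewrite rmorphM/= fmorphV rmorphD rmorph1.
  by rewrite ger0_norm ?divr_ge0//; field.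
have e1 : (1 : C)^* = 1 by apply: complexP; rewrite !cpartE /=; ring.
have e2 : (-1 : C)^* = -1 by apply: complexP; rewrite !cpartE /=; ring.
rewrite e1 e2 mulN1r mul1r cReN (@normcN R) ComplexField.Normc.normc1 expr1n.
by field.
Qed.

(** A minimising sequence for the distance to [A] is Cauchy by the parallelogram
    law, and its limit is the projection: if [f - p] were not orthogonal to some
    [a] in [A], moving towards [a] would decrease the distance. *)
Lemma projection_exists (A : set (C -> C)) f :
  (forall p, A p -> L2_circle p) -> A (fun=> 0) ->
  (forall (c : C) p q, A p -> A q -> A (fun z => c * p z + q z)) ->
  L2_circle f ->
  exists2 p, closureL2 A p & forall m, A m -> inner_L2 (fun z => f z - p z) m = 0.
Proof.
move=> AL A0 Alin Lf.
pose D := [set x : R | exists2 p, A p & x = norm2 (fun z => f z - p z) ^+ 2].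
have infD : has_inf D.
  split; first by exists (norm2 (fun z => f z - 0) ^+ 2); exists (fun=> 0).
  by exists 0 => _ [p _ ->]; exact: sqr_ge0.
pose d := inf D.
have dle p : A p -> d <= norm2 (fun z => f z - p z) ^+ 2.
  by move=> Ap; apply: ge_inf; [exact: infD.2|exists p].
have /choice[s Hs] : forall n : nat, exists p, A p /\
    norm2 (fun z => f z - p z) ^+ 2 < d + n.+1%:R^-1.
  move=> n; have n0 : 0 < n.+1%:R^-1 :> R by rewrite invr_gt0 ltr0n.
  have [_ [p Ap ->] pd] := inf_adherent n0 infD.
  by exists p.
have As n : A (s n) by have [] := Hs n.
have Ls n : L2_circle (s n) by exact: AL.
have cauchy m n : norm2 (fun z => s m z - s n z) ^+ 2 <=
    2 * m.+1%:R^-1 + 2 * n.+1%:R^-1.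
  rewrite (parallelogram Lf)//.
  have := dle (fun z => 1 / 2 * s m z + 1 / 2 * s n z).
  have -> : (fun z => 1 / 2 * s m z + 1 / 2 * s n z) =
    (fun z => 1 / 2 * s m z + (1 / 2 * s n z + 0)) by apply/funext => z; rewrite addr0.
  have /[swap] /[apply] : A (fun z => 1 / 2 * s m z + (1 / 2 * s n z + 0)).
    by apply: (Alin) => //; exact: Alin.
  have [_] := Hs m; have [_] := Hs n.
  set x := m.+1%:R^-1; set y := n.+1%:R^-1; lra.
have smallN (e : R) : 0 < e -> exists N, forall n, (N <= n)%N -> n.+1%:R^-1 < e.
  move=> e0; have [N _ HN] := near_infty_natSinv_lt (PosNum e0).
  by exists N => n Nn; exact: HN.
have [q Lq Hq] : exists2 q, L2_circle q & forall e : R, 0 < e -> exists N, forall n, (N <= n)%N ->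
    norm2 (fun z => q z - s n z) <= e.
  apply: riesz_fischer => // e e0.
  have e4 : 0 < e ^+ 2 / 4 by rewrite divr_gt0// exprn_gt0.
  have [N HN] := smallN _ e4; exists N => m n Nm Nn.
  rewrite -(ltr_pXn2r (n := 2))// ?nnegrE ?norm2_ge0 ?ltW//.
  apply: le_lt_trans (cauchy m n) _.
  by have := HN _ Nm; have := HN _ Nn; set x := m.+1%:R^-1; set y := n.+1%:R^-1; lra.
exists q.
  split=> // e e0; have e2 : 0 < e / 2 by rewrite divr_gt0.
  have [N HN] := Hq _ e2.
  exists (s N) => //; apply: le_lt_trans (HN N (leqnn _)) _.
  by rewrite ltr_pdivrMr// ltr_pMr// ltr1n.
move=> a Aa; have La := AL _ Aa; set H := norm2 a ^+ 2.
have H0 : 0 <= H by exact: sqr_ge0.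
have small n : normc (inner_L2 (fun z => f z - s n z) a) ^+ 2 <= n.+1%:R^-1 * (H + 1).
  set b := inner_L2 _ a; have Lfs := L2B Lf (Ls n).
  have t0 : (H + 1) != 0 by rewrite gt_eqF// ltr_wpDl.
  have := dle (fun z => ((H + 1)^-1)%:C * b * a z + s n z) (Alin _ _ _ Aa (As n)).
  have -> : (fun z => f z - (((H + 1)^-1)%:C * b * a z + s n z)) =
    (fun z => f z - s n z - ((H + 1)^-1)%:C * b * a z).
    by apply/funext => z; rewrite opprD addrA addrAC.
  rewrite sqr_norm2 sqr_norm2B// -/b -/H.
  have -> : Re ((((H + 1)^-1)%:C * b)^* * b) = (H + 1)^-1 * normc b ^+ 2.
    transitivity (Re (((H + 1)^-1)%:C^* * (b * b^*))).
      by congr Re; rewrite rmorphM/=; ring.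
    by rewrite mul_conjc !cpartE /= mulr0 subr0.
  rewrite ComplexField.Normc.normcM normc_real exprMn real_normK ?num_real//.
  have [_] := Hs n; set x := n.+1%:R^-1; set B := normc b ^+ 2.
  have B0 : 0 <= B by exact: sqr_ge0.
  set F := norm2 _ ^+ 2 => h1 h2.
  have : (H + 1)^-1 * B * (2 - H / (H + 1)) < x.
    rewrite [X in X < _](_ : _ = 2 * ((H + 1)^-1 * B) - (H + 1)^-1 ^+ 2 * B * H); first by lra.
    by field.
  have : 1 <= 2 - H / (H + 1).
    by rewrite lerBrDl -lerBrDr ler_pdivrMr ?ltr_wpDl// mulrBl !mul1r; lra.
  move=> h3 h4; rewrite -ler_pdivrMr ?ltr_wpDl//; apply: ltW; apply: le_lt_trans h4.
  by rewrite mulrC ler_peMr// mulr_ge0// invr_ge0 addr_ge0.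
apply: ComplexField.Normc.eq0_normc; apply/eqP.
rewrite eq_le normc_ge0 andbT; apply/ler_addgt0Pr => e e0; rewrite add0r.
have e2 : 0 < e / 2 by rewrite divr_gt0.
have a1 : 0 < norm2 a + 1 by rewrite ltr_wpDl ?norm2_ge0.
have [N1 HN1] := Hq _ (divr_gt0 e2 a1).
have H1 : 0 < H + 1 by rewrite ltr_wpDl.
have [N2 HN2] := smallN _ (divr_gt0 (exprn_gt0 2 e2) H1).
pose n := maxn N1 N2.
rewrite (_ : inner_L2 _ a = inner_L2 (fun z => f z - s n z) a - inner_L2 (fun z => q z - s n z) a); last first.
  by rewrite !innerBl//; ring.
apply: le_trans (@le_normcD R _ _) _; rewrite (@normcN R) (splitr e) lerD//.
  rewrite -(ler_pXn2r (n := 2))// ?nnegrE ?normc_ge0 ?(ltW e2)//.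
  apply: le_trans (small n) _; rewrite -ler_pdivlMr//; apply/ltW/HN2.
  exact: leq_maxr.
apply: le_trans (cauchy_schwarz (L2B Lq (Ls n)) La) _.
have := HN1 n (leq_maxl _ _); rewrite ler_pdivlMr//; apply: le_trans.
by rewrite ler_wpM2l ?norm2_ge0// lerDl.
Qed.

End RieszFischer.

(** * Complex integrals over segments *)

Section Segments.
Variable R : realType.
Local Notation C := R[i].
Local Notation "z ^*" := (Num.conj z) : complex_scope.
Local Notation leb := (@lebesgue_measure R).
Local Notation TR := (measurableTypeR R).
Implicit Types (F G : TR -> C) (a b c : R).

Definition cI a b F : C := cint leb `[a, b]%classic F.

Definition ccont a b F :=
  {within `[a, b], continuous (fun t : R => Re (F t))} /\
  {within `[a, b], continuous (fun t : R => Im (F t))}.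

Lemma ccont_integrable a b F : ccont a b F -> cintegrable leb `[a, b]%classic F.
Proof.
move=> [F1 F2]; split.
  by apply: continuous_compact_integrable => //; exact: segment_compact.
by apply: continuous_compact_integrable => //; exact: segment_compact.
Qed.

Lemma ccontM a b F G : ccont a b F -> ccont a b G -> ccont a b (fun t => F t * G t).
Proof.
move=> [F1 F2] [G1 G2]; split.
  under [X in continuous X]eq_fun do rewrite cReM.
  by move=> x; apply: cvgB; apply: cvgM; [exact: F1|exact: G1|exact: F2|exact: G2].
under [X in continuous X]eq_fun do rewrite cImM.
by move=> x; apply: cvgD; apply: cvgM; [exact: F1|exact: G2|exact: F2|exact: G1].
Qed.

Lemma ccontD a b F G : ccont a b F -> ccont a b G -> ccont a b (fun t => F t + G t).
Proof.
move=> [F1 F2] [G1 G2]; split.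
  under [X in continuous X]eq_fun do rewrite cReD.
  by move=> x; apply: cvgD; [exact: F1|exact: G1].
under [X in continuous X]eq_fun do rewrite cImD.
by move=> x; apply: cvgD; [exact: F2|exact: G2].
Qed.

Lemma ccont_cst a b (k : C) : ccont a b (fun=> k).
Proof. by split=> x; exact: cvg_cst. Qed.

(** Continuity within the segment is reduced to distances in the complex plane,
    the form in which derivatives and continuity are used below. *)
Lemma ccontP a b F :
  (forall x, x \in `[a, b] -> forall e : R, 0 < e -> exists2 d : R, 0 < d &
    forall y, `|x - y| < d -> normc (F x - F y) < e) -> ccont a b F.
Proof.
move=> H.
have key (G : C -> R) : (forall z, `|G z| <= normc z) ->
    (forall x y, G (x - y) = G x - G y) -> {within `[a, b], continuous (fun t : R => G (F t))}.
  move=> Gn GB; apply/subspace_continuousP => x xab; apply/cvgrPdist_lt => e e0.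
  have [d d0 Hd] := H x xab e e0.
  rewrite near_withinE; apply: filterS (nbhsx_ballx x d d0) => y xy _.
  by rewrite -GB (le_lt_trans (Gn _))// Hd.
split; apply: key.
- exact: Re_le_normc.
- by move=> x y; rewrite cReD cReN.
- exact: Im_le_normc.
- by move=> x y; rewrite cImD cImN.
Qed.

Lemma cI_split a b c F : a <= c -> c <= b -> ccont a b F ->
  cI a b F = cI a c F + cI c b F.
Proof.
move=> ac cb /ccont_integrable[F1 F2].
have sub : (`]c, b]%classic : set TR) `<=` `[a, b]%classic.
  by apply: subset_itvr; rewrite bnd_simp.
have aux (f : R -> R) : leb.-integrable `[a, b] (EFin \o f) ->
    \int[leb]_(t in `[a, b]) f t = \int[leb]_(t in `[a, c]) f t + \int[leb]_(t in `[c, b]) f t.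
  move=> intf; rewrite -[X in _ = _ + X]Rintegral_itv_obnd_cbnd; last first.
    by apply: integrableS intf.
  rewrite -(@Rintegral_itvB _ f (BLeft a) (BRight b) c) ?bnd_simp//.
  by rewrite addrC subrK.
by apply: complexP; rewrite cpartE /=; exact: aux.
Qed.

Lemma cI_bound a b F (M : R) : a <= b -> ccont a b F ->
  (forall t, t \in `[a, b] -> normc (F t) <= M) -> normc (cI a b F) <= 2 * (M * (b - a)).
Proof.
move=> ab cF FM; apply: cint_bound => //; first exact: ccont_integrable.
have := @lebesgue_measure_itv R `[a, b]; rewrite /= lte_fin => ->.
by case: ltgtP ab => // ->; rewrite subrr.
Qed.

Lemma FTC_R (F f : R -> R) a b : a <= b -> (forall x : R, is_derive x 1 F (f x)) ->
  continuous f -> \int[leb]_(t in `[a, b]) f t = F b - F a.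
Proof.
rewrite le_eqVlt => /predU1P[->|ab] dF cf.
  by rewrite set_itv1 Rintegral_set1 subrr.
have cF : continuous F.
  by move=> x; apply/differentiable_continuous/derivable1_diffP; have [] := dF x.
rewrite /Rintegral (@continuous_FTC2 _ f F)//.
- exact: continuous_subspaceT.
- split; first by move=> x _; have [] := dF x.
    by apply: cvg_at_right_filter; exact: cF.
  by apply: cvg_at_left_filter; exact: cF.
- by move=> x _; rewrite derive1E; have [_ ->] := dF x.
Qed.

Lemma cI_expi a b (k : R) : a <= b -> k != 0 ->
  cI a b (fun t => expi (k * t)) = (expi (k * b) - expi (k * a)) / (k%:C * 'i%C).
Proof.
move=> ab k0.
have -> : (k%:C * 'i%C)^-1 = 0 +i* (- k^-1) :> C.
  apply: (mulfI (x := k%:C * 'i%C)).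
    by rewrite mulf_neq0 ?fmorph_eq0// eq_complex /= oner_eq0 andbF.
  rewrite divff; last by rewrite mulf_neq0 ?fmorph_eq0// eq_complex /= oner_eq0 andbF.
  by apply: complexP; rewrite !cpartE /=; field.
have dm (x : R) : is_derive x 1 ( *%R k) k.
  by apply: is_derive_eq; rewrite ?scaler1.
apply: complexP; rewrite !cpartE /=.
  transitivity (sin (k * b) / k - sin (k * a) / k); last by field.
  apply: (@FTC_R (fun t => sin (k * t) / k) (fun t => cos (k * t)) a b ab).
    by move=> x; apply: is_derive_eq; rewrite /GRing.scale/=; field.
  by move=> x; apply: continuous_comp; [exact: mulrl_continuous|exact: continuous_cos].
transitivity (- cos (k * b) / k - (- cos (k * a) / k)); last by field.
apply: (@FTC_R (fun t => - cos (k * t) / k) (fun t => sin (k * t)) a b ab).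
  by move=> x; apply: is_derive_eq; rewrite /GRing.scale/=; field.
by move=> x; apply: continuous_comp; [exact: mulrl_continuous|exact: continuous_sin].
Qed.

Lemma cI_cst a b (k : C) : a <= b -> cI a b (fun=> k) = k * (b - a)%:C.
Proof.
move=> ab; apply: complexP; rewrite !cpartE /= Rintegral_cst//= lebesgue_measure_itv/= lte_fin.
  by case: ltgtP ab => //= [_|->] _; rewrite ?subrr; ring.
by case: ltgtP ab => //= [_|->] _; rewrite ?subrr; ring.
Qed.

Lemma cI_id a b : a <= b -> cI a b (fun t => t%:C) = ((b ^+ 2 - a ^+ 2) / 2)%:C.
Proof.
move=> ab; apply: complexP => /=; last by rewrite /Rintegral integral0.
transitivity (b ^+ 2 / 2 - a ^+ 2 / 2); last by field.
apply: (@FTC_R (fun t => t ^+ 2 / 2) id a b ab) => x.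
  by apply: is_derive_eq; rewrite /GRing.scale/=; field.
exact: cvg_id.
Qed.

Lemma sin_lip (x y : R) : `|sin x - sin y| <= `|x - y|.
Proof.
wlog xy : x y / y <= x.
  move=> H; have [yx|/ltW xy] := leP y x; first exact: H.
  by rewrite distrC [leRHS]distrC; exact: H.
have [c _ ->] := @MVT_segment R sin cos y x xy (fun z _ => is_derive_sin z)
  (continuous_subspaceT (@continuous_sin R)).
by rewrite normrM ler_piMl// cos_max.
Qed.

Lemma cos_lip (x y : R) : `|cos x - cos y| <= `|x - y|.
Proof.
wlog xy : x y / y <= x.
  move=> H; have [yx|/ltW xy] := leP y x; first exact: H.
  by rewrite distrC [leRHS]distrC; exact: H.
have [c _ ->] := @MVT_segment R cos (fun z => - sin z) y x xy (fun z _ => is_derive_cos z)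
  (continuous_subspaceT (@continuous_cos R)).
by rewrite normrM normrN ler_piMl// sin_max.
Qed.

Lemma expi_lip (x y : R) : normc (expi x - expi y) <= 2 * `|x - y|.
Proof.
apply: le_trans (normc_leD _) _; rewrite !cpartE /= mulr2n mulrDl mul1r.
by apply: lerD; [exact: cos_lip|exact: sin_lip].
Qed.

End Segments.

(** * Goursat on polar rectangles *)

Section Goursat.
Variable R : realType.
Local Notation C := R[i].
Implicit Types (Q : C -> C).

(** The heart of Goursat's argument, stated for any additive rectangle function:
    quartering keeps at least a quarter of the modulus in one part, so if
    [eta a b c d] were nonzero, nested rectangles around their common point would
    contradict the [o(area)] hypothesis at that point. *)
Lemma bisection (eta : R -> R -> R -> R -> C) (a b c d : R) : a <= b -> c <= d ->
  (forall x0 x1 x2 y0 y1, a <= x0 -> x0 <= x1 -> x1 <= x2 -> x2 <= b ->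
     c <= y0 -> y0 <= y1 -> y1 <= d ->
     eta x0 x2 y0 y1 = eta x0 x1 y0 y1 + eta x1 x2 y0 y1) ->
  (forall x0 x1 y0 y1 y2, a <= x0 -> x0 <= x1 -> x1 <= b ->
     c <= y0 -> y0 <= y1 -> y1 <= y2 -> y2 <= d ->
     eta x0 x1 y0 y2 = eta x0 x1 y0 y1 + eta x0 x1 y1 y2) ->
  (forall p q, a <= p <= b -> c <= q <= d -> forall e : R, 0 < e ->
     exists2 r : R, 0 < r & forall x y h, 0 < h < r ->
       a <= x <= p -> p <= x + (b - a) * h <= b ->
       c <= y <= q -> q <= y + (d - c) * h <= d ->
       normc (eta x (x + (b - a) * h) y (y + (d - c) * h)) <= e * h ^+ 2) ->
  eta a b c d = 0.
Proof.
move=> ab cd addx addy loc.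
pose h n : R := (2 ^+ n)^-1.
have h0 n : 0 < h n by rewrite invr_gt0 exprn_gt0.
have hS n : h n = h n.+1 + h n.+1 by rewrite /h exprS invfM; field.
pose N n (xy : R * R) := normc (eta xy.1 (xy.1 + (b - a) * h n) xy.2 (xy.2 + (d - c) * h n)).
pose V n (xy : R * R) := [/\ a <= xy.1, xy.1 + (b - a) * h n <= b, c <= xy.2 &
  xy.2 + (d - c) * h n <= d].
have bah n : 0 <= (b - a) * h n by rewrite mulr_ge0 ?subr_ge0// ltW.
have dch n : 0 <= (d - c) * h n by rewrite mulr_ge0 ?subr_ge0// ltW.
pose nested n (xy xy' : R * R) := [/\ xy.1 <= xy'.1,
   xy'.1 + (b - a) * h n.+1 <= xy.1 + (b - a) * h n,
   xy.2 <= xy'.2 & xy'.2 + (d - c) * h n.+1 <= xy.2 + (d - c) * h n].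
have step (k : nat * (R * R)) : exists xy' : R * R, V k.1 k.2 ->
    [/\ V k.1.+1 xy', nested k.1 k.2 xy' & N k.1 k.2 <= 4 * N k.1.+1 xy'].
  case: k => n [x y] /=.
  have [Vxy|nV] := pselect (V n (x, y)); last by exists (0, 0).
  move: (Vxy) => [/= ax xb cy yd].
  pose x' := x + (b - a) * h n.+1; pose y' := y + (d - c) * h n.+1.
  have xS : x + (b - a) * h n = x' + (b - a) * h n.+1 by rewrite /x' (hS n); ring.
  have yS : y + (d - c) * h n = y' + (d - c) * h n.+1 by rewrite /y' (hS n); ring.
  have := bah n.+1; have := dch n.+1 => dc' ba'.
  have xx' : x <= x' by rewrite lerDl.
  have yy' : y <= y' by rewrite lerDl.
  have x'b : x' <= x + (b - a) * h n by rewrite xS lerDl.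
  have y'd : y' <= y + (d - c) * h n by rewrite yS lerDl.
  have E : N n (x, y) <= N n.+1 (x, y) + N n.+1 (x', y) + N n.+1 (x, y') + N n.+1 (x', y').
    rewrite /N /= -xS -yS -/x' -/y'.
    rewrite (addx x x' _ y _)//; [|by lra..].
    rewrite (addy x x' y y' _)//; [|by lra..].
    rewrite (addy x' _ y y' _)//; [|by lra..].
    set e1 := eta _ _ _ _; set e2 := eta _ _ _ _; set e3 := eta _ _ _ _; set e4 := eta _ _ _ _.
    have := @le_normcD R (e1 + e2) (e3 + e4); have := @le_normcD R e1 e2.
    by have := @le_normcD R e3 e4; lra.
  have [|n1] := lerP (N n (x, y)) (4 * N n.+1 (x, y)).
    by exists (x, y) => _; split => //; split => //=; rewrite -/x' -/y'; lra.
  have [|n2] := lerP (N n (x, y)) (4 * N n.+1 (x', y)).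
    by exists (x', y) => _; split => //; split => //=; rewrite -?xS -/x' -/y'; lra.
  have [|n3] := lerP (N n (x, y)) (4 * N n.+1 (x, y')).
    by exists (x, y') => _; split => //; split => //=; rewrite -?yS -/x' -/y'; lra.
  exists (x', y') => _; split; first by split => //=; rewrite -?xS -?yS; lra.
    by split => //=; rewrite -?xS -?yS; lra.
  lra.
have /choice[f Hf] := step.
pose s := fix s n : R * R := if n is n'.+1 then f (n', s n') else (a, c).
have Vs n : V n (s n).
  elim: n => [|n ih]; first by rewrite /V /h /= expr0 invr1 !mulr1; split; lra.
  by have [] := Hf (n, s n) ih.
have Ns n : nested n (s n) (s n.+1) by have [] := Hf (n, s n) (Vs n).
have N4 n : N n (s n) <= 4 * N n.+1 (s n.+1) by have [] := Hf (n, s n) (Vs n).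
have bound n : N 0%N (s 0%N) * h n ^+ 2 <= N n (s n).
  elim: n => [|n ih]; first by rewrite /h expr0 invr1 expr1n mulr1.
  have := N4 n; have := hS n; set u := h n.+1 => hn.
  move: ih; rewrite hn => ih h1.
  suff : 4 * (N 0%N (s 0%N) * u ^+ 2) <= 4 * N n.+1 (s n.+1) by rewrite ler_pM2l.
  apply: le_trans h1; apply: le_trans ih; rewrite le_eqVlt; apply/orP; left; apply/eqP; ring.
have pt (l len : R) (w : nat -> R) : (forall n, w n <= w n.+1) ->
   (forall n, w n.+1 + len * h n.+1 <= w n + len * h n) -> 0 <= len ->
   exists p, forall n, w n <= p <= w n + len * h n.
  move=> wS uS len0.
  have wm m k : w m <= w (k + m)%N by elim: k => // k ih; exact: le_trans ih (wS _).
  have um m k : w (k + m)%N + len * h (k + m)%N <= w m + len * h m.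
    by elim: k => // k ih; exact: le_trans (uS _) ih.
  have lh n : 0 <= len * h n by rewrite mulr_ge0// ltW.
  have wu m n : w m <= w n + len * h n.
    have [mn|/ltnW nm] := leqP m n.
      by rewrite -(subnK mn) (le_trans (wm m (n - m)%N))// lerDl.
    by rewrite -(subnK nm); apply: le_trans (um n (m - n)%N); rewrite lerDl.
  exists (sup (range w)) => n; apply/andP; split.
    by apply: ub_le_sup; [exists (w 0%N + len * h 0%N) => _ [m _ <-]|exists n].
  by apply: ge_sup; [exists (w 0%N), 0%N|move=> _ [m _ <-]].
have [p Hp] : exists p, forall n, (s n).1 <= p <= (s n).1 + (b - a) * h n.
  by apply: (pt 0) => [n|n|]; [have [] := Ns n|have [] := Ns n|rewrite subr_ge0].
have [q Hq] : exists p, forall n, (s n).2 <= p <= (s n).2 + (d - c) * h n.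
  by apply: (pt 0) => [n|n|]; [have [] := Ns n|have [] := Ns n|rewrite subr_ge0].
have Hp0 : a <= p <= b by have := Hp 0%N; rewrite /h /= expr0 invr1 mulr1 addrC subrK.
have Hq0 : c <= q <= d by have := Hq 0%N; rewrite /h /= expr0 invr1 mulr1 addrC subrK.
apply: ComplexField.Normc.eq0_normc; apply/eqP; rewrite eq_le normc_ge0 andbT leNgt; apply/negP => pos.
have pos2 : 0 < normc (eta a b c d) / 2 by rewrite divr_gt0.
have [r r0 Hr] := loc p q Hp0 Hq0 _ pos2.
have [n hn] : exists n, h n < r.
  have [n _ Hn] := near_infty_natSinv_expn_lt (PosNum r0).
  by exists n; have := Hn n (leqnn _); rewrite /= div1r.
have [v1 v2 v3 v4] := Vs n.
have /andP[p1 p2] := Hp n; have /andP[q1 q2] := Hq n.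
have := Hr (s n).1 (s n).2 (h n); rewrite h0 hn v1 v2 v3 v4 p1 p2 q1 q2 => /(_ erefl erefl erefl erefl erefl).
move=> /(le_trans (bound n)); rewrite ler_pM2r ?exprn_gt0//.
rewrite /N /s /h /= expr0 invr1 !mulr1 [a + _]addrC subrK [c + _]addrC subrK.
lra.
Qed.

Definition pol (r t : R) : C := r%:C * expi t.

(** Differentiability at [w] with the derivative left existential and all
    quantifiers explicit, as Goursat's estimate consumes it. *)
Definition cder Q (w : C) := exists A : C, forall e : R, 0 < e -> exists2 d : R, 0 < d &
  forall z, normc (z - w) < d -> normc (Q z - Q w - A * (z - w)) <= e * normc (z - w).

Definition ccontAt Q (w : C) := forall e : R, 0 < e -> exists2 d : R, 0 < d &
  forall z, normc (z - w) < d -> normc (Q z - Q w) < e.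

Lemma normc_pol r t : normc (pol r t) = `|r|.
Proof. by rewrite ComplexField.Normc.normcM normc_real normc_expi mulr1. Qed.

Lemma normc_i : normc ('i%C : C) = 1.
Proof. by rewrite /= expr0n/= expr1n add0r sqrtr1. Qed.

Lemma pol_dist r s t u : normc (pol r t - pol s u) <= `|r - s| + `|s| * (2 * `|t - u|).
Proof.
have -> : pol r t - pol s u = (r - s)%:C * expi t + s%:C * (expi t - expi u).
  by rewrite /pol rmorphB/=; ring.
apply: le_trans (@le_normcD R _ _) _.
rewrite !ComplexField.Normc.normcM !normc_real normc_expi mulr1 lerD2l.
by rewrite ler_wpM2l// expi_lip.
Qed.

Lemma cder_cont Q w : cder Q w -> ccontAt Q w.
Proof.
move=> [A HA] e e0; have [d d0 Hd] := HA 1 ltr01.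
have A1 : 0 < 1 + normc A by rewrite ltr_pwDl// normc_ge0.
exists (Num.min d (e / (1 + normc A))); first by rewrite lt_min d0 divr_gt0.
move=> z; rewrite lt_min ltr_pdivlMr// => /andP[/Hd zd ze].
have -> : Q z - Q w = (Q z - Q w - A * (z - w)) + A * (z - w) by rewrite subrK.
apply: le_lt_trans (@le_normcD R _ _) _.
rewrite ComplexField.Normc.normcM; move: zd ze; lra.
Qed.

Lemma ccont_comp Q (g : R -> C) (L a b : R) :
  (forall x y, normc (g x - g y) <= L * `|x - y|) ->
  (forall x, x \in `[a, b] -> ccontAt Q (g x)) -> ccont a b (fun t => Q (g t)).
Proof.
move=> gL Qg; apply: ccontP => x xab e e0; have [d d0 Hd] := Qg x xab e e0.
have L1 : 0 < `|L| + 1 by rewrite ltr_wpDl.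
exists (d / (`|L| + 1)); first exact: divr_gt0.
move=> y xy; rewrite normcB; apply: Hd.
apply: le_lt_trans (gL y x) _; move: xy; rewrite distrC ltr_pdivlMr//.
apply: le_lt_trans; rewrite mulrC ler_wpM2l// (le_trans (ler_norm _))// lerDl//.
Qed.

Lemma ccontAt_id w : ccontAt id w.
Proof. by move=> e e0; exists e. Qed.

Lemma pol_lip_t r x y : normc (pol r x - pol r y) <= 2 * `|r| * `|x - y|.
Proof.
by apply: le_trans (pol_dist _ _ _ _) _; rewrite subrr normr0 add0r mulrCA mulrA.
Qed.

Lemma pol_lip_r t x y : normc (pol x t - pol y t) <= 1 * `|x - y|.
Proof.
by apply: le_trans (pol_dist _ _ _ _) _; rewrite subrr normr0 !mulr0 addr0 mul1r.
Qed.

Lemma ccont_pol r a b : ccont a b (pol r).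
Proof. by apply: (ccont_comp (Q := id) (pol_lip_t r)) => x _; exact: ccontAt_id. Qed.

Lemma ccont_arc Q r a b : (forall t, ccontAt Q (pol r t)) ->
  ccont a b (fun t => Q (pol r t) * ('i%C * pol r t)).
Proof.
move=> cQ; apply: ccontM; first exact: (ccont_comp (pol_lip_t r)).
by apply: ccontM; [exact: ccont_cst|exact: ccont_pol].
Qed.

Definition contOn Q (a b : R) := forall r t, a <= r <= b -> ccontAt Q (pol r t).

Lemma ccont_rad Q a b x y t : contOn Q a b -> a <= x -> y <= b ->
  ccont x y (fun r => Q (pol r t) * expi t).
Proof.
move=> cQ ax yb; apply: ccontM; last exact: ccont_cst.
apply: (ccont_comp (pol_lip_r t)) => r; rewrite in_itv/= => /andP[xr ry].
by apply: cQ; rewrite (le_trans ax xr) (le_trans ry yb).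
Qed.

Definition arcI Q (r t0 t1 : R) := cI t0 t1 (fun t => Q (pol r t) * ('i%C * pol r t)).
Definition radI Q (t r0 r1 : R) := cI r0 r1 (fun r => Q (pol r t) * expi t).

(** The integral of [Q(w) dw] along the boundary of the polar rectangle
    [r0 <= r <= r1], [t0 <= t <= t1]. Polar coordinates turn concentric circles into
    opposite sides, which spares any deformation of contours. *)
Definition polarI Q (r0 r1 t0 t1 : R) :=
  arcI Q r1 t0 t1 - arcI Q r0 t0 t1 - radI Q t1 r0 r1 + radI Q t0 r0 r1.

Lemma polarI_D Q1 Q2 a b x y t0 t1 : contOn Q1 a b -> contOn Q2 a b ->
  a <= x -> x <= y -> y <= b ->
  polarI (fun w => Q1 w + Q2 w) x y t0 t1 = polarI Q1 x y t0 t1 + polarI Q2 x y t0 t1.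
Proof.
move=> c1 c2 ax xy yb; rewrite /polarI.
have A r : a <= r <= b -> arcI (fun w => Q1 w + Q2 w) r t0 t1 = arcI Q1 r t0 t1 + arcI Q2 r t0 t1.
  move=> rab; rewrite /arcI /cI -cintD//.
  - by apply: eq_cint => t _; rewrite mulrDl.
  - by apply/ccont_integrable/ccont_arc => t; exact: c1.
  - by apply/ccont_integrable/ccont_arc => t; exact: c2.
have B t : radI (fun w => Q1 w + Q2 w) t x y = radI Q1 t x y + radI Q2 t x y.
  rewrite /radI /cI -cintD//.
  - by apply: eq_cint => r _; rewrite mulrDl.
  - exact/ccont_integrable/(ccont_rad _ c1).
  - exact/ccont_integrable/(ccont_rad _ c2).
rewrite !A ?B ?ax ?yb ?(le_trans xy yb) ?(le_trans ax xy)//; ring.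
Qed.

Lemma polE r t : pol r t * pol r t = (r ^+ 2)%:C * expi (2 * t).
Proof.
rewrite /pol expr2 rmorphM/= mulr2n mulrDl mul1r expiD; ring.
Qed.

Lemma polarI_affine (al be : C) a b t0 t1 : a <= b -> t0 <= t1 ->
  polarI (fun w => al + be * w) a b t0 t1 = 0.
Proof.
move=> ab t01; rewrite /polarI.
have A r : arcI (fun w => al + be * w) r t0 t1 =
    al * (pol r t1 - pol r t0) + be / 2 * (pol r t1 * pol r t1 - pol r t0 * pol r t0).
  rewrite /arcI.
  have -> : (fun t => (al + be * pol r t) * ('i%C * pol r t)) =
    (fun t => (al * 'i%C * r%:C) * expi (1 * t) + (be * 'i%C * (r ^+ 2)%:C) * expi (2 * t)).
    apply/funext => t.
    have -> : (al + be * pol r t) * ('i%C * pol r t) = al * 'i%C * pol r t + be * 'i%C * (pol r t * pol r t) by ring.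
    by rewrite polE /pol mul1r !mulrA.
  have ce (k : R) (z : C) : cintegrable lebesgue_measure `[t0, t1]%classic (fun t => expi (k * t)).
    apply: ccont_integrable; apply: (ccont_comp (Q := id) (L := 2 * `|k|)).
      move=> x y; apply: le_trans (expi_lip _ _) _.
      by rewrite -mulrBr normrM mulrA.
    by move=> x _; exact: ccontAt_id.
  rewrite /cI cintD//; last 2 first.
  - by apply: cintegrableZ => //; exact: ce.
  - by apply: cintegrableZ => //; exact: ce.
  rewrite !cintZ//; last 2 first.
  - exact: ce.
  - exact: ce.
  rewrite -!/(cI _ _ _) !cI_expi// !polE /pol !mul1r.
  have i0 : ('i%C : C) != 0 by rewrite eq_complex /= oner_eq0 andbF.
  rewrite (_ : (2 : R)%:C = 2 :> C); last by rewrite rmorphD rmorph1.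
  by field.
have B t : radI (fun w => al + be * w) t a b =
    al * (pol b t - pol a t) + be / 2 * (pol b t * pol b t - pol a t * pol a t).
  rewrite /radI.
  have -> : (fun r => (al + be * pol r t) * expi t) =
    (fun r => al * expi t + be * (expi t * expi t) * r%:C).
    by apply/funext => r; rewrite /pol; ring.
  have cr : ccont a b (fun r : R => r%:C).
    split=> /=; last by move=> x; exact: cvg_cst.
    by apply: continuous_subspaceT => x; exact: cvg_id.
  rewrite /cI cintD//; last 2 first.
  - exact/ccont_integrable/ccont_cst.
  - by apply: cintegrableZ => //; exact: ccont_integrable.
  rewrite [X in _ + X]cintZ//; last exact: ccont_integrable.
  rewrite -!/(cI _ _ _) cI_id// cI_cst// /pol.
  rewrite rmorphM/= fmorphV !rmorphB/= !rmorphXn/= rmorphD rmorph1/=.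
  by field.
rewrite !A !B; ring.
Qed.

(** Bisection applied to the boundary integral. Near a point [Q] is affine up to
    [o(distance)]; the affine part has a primitive, hence integral zero, and the
    rest contributes [o(length^2)]. *)
Lemma goursat Q (a b t0 t1 : R) : 0 <= a -> a <= b -> t0 <= t1 ->
  (forall r t, a <= r <= b -> cder Q (pol r t)) -> polarI Q a b t0 t1 = 0.
Proof.
move=> a0 ab t01 dQ.
have cQ : contOn Q a b by move=> r t rab; exact/cder_cont/dQ.
apply: bisection => //.
- move=> x0 x1 x2 y0 y1 ax x01 x12 xb cy y01 yd; rewrite /polarI /radI.
  rewrite !(@cI_split _ x0 x2 x1)//; first by ring.
    by apply: (ccont_rad _ cQ).
  by apply: (ccont_rad _ cQ).
- move=> x0 x1 y0 y1 y2 ax x01 xb cy y01 y12 yd; rewrite /polarI /arcI.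
  rewrite !(@cI_split _ y0 y2 y1)//; first by ring.
    by apply: ccont_arc => t; apply: cQ; rewrite ax (le_trans x01 xb).
  by apply: ccont_arc => t; apply: cQ; rewrite (le_trans ax x01) xb.
move=> p q pab qt e e0.
have [A HA] := dQ p q pab.
pose K := (b - a) + 2 * b * (t1 - t0).
have b0 : 0 <= b by exact: le_trans a0 ab.
have K0 : 0 <= K by rewrite addr_ge0 ?mulr_ge0 ?subr_ge0.
have K4 : 0 < 4 * K ^+ 2 + 1 by rewrite ltr_wpDl// mulr_ge0// sqr_ge0.
have [d d0 Hd] := HA (e / (4 * K ^+ 2 + 1)) (divr_gt0 e0 K4).
have K1 : 0 < K + 1 by rewrite ltr_wpDl.
exists (d / (K + 1)); first exact: divr_gt0.
move=> x y h /andP[h0]; rewrite ltr_pdivlMr// => hd /andP[ax xp] /andP[px xb] /andP[cy yq] /andP[qy yd].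
pose be := A; pose al := Q (pol p q) - A * pol p q.
(* the error of the affine approximation of [Q] at [pol p q] *)
pose rho w := Q w - (al + be * w).
have caff : contOn (fun w => al + be * w) a b.
  move=> r t _ e' e'0; have b1 : 0 < normc be + 1 by rewrite ltr_wpDl// normc_ge0.
  exists (e' / (normc be + 1)); first exact: divr_gt0.
  move=> z; rewrite ltr_pdivlMr// => ze.
  have -> : al + be * z - (al + be * pol r t) = be * (z - pol r t) by ring.
  rewrite ComplexField.Normc.normcM; apply: le_lt_trans ze.
  by rewrite mulrC ler_wpM2l ?normc_ge0// lerDl.
have crho : contOn rho a b.
  move=> r t rab e' e'0; have e2 : 0 < e' / 2 by rewrite divr_gt0.
  have [d1 d10 H1] := cQ r t rab _ e2; have [d2 d20 H2] := caff r t rab _ e2.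
  exists (Num.min d1 d2); first by rewrite lt_min d10.
  move=> z; rewrite lt_min => /andP[/H1 z1 /H2 z2].
  have -> : rho z - rho (pol r t) = (Q z - Q (pol r t)) -
     ((al + be * z) - (al + be * pol r t)) by rewrite /rho; ring.
  apply: le_lt_trans (@le_normcD R _ _) _; rewrite (@normcN R); move: z1 z2; lra.
have -> : Q = (fun w => (al + be * w) + rho w) by apply/funext => w; rewrite /rho; ring.
have x1 : x <= x + (b - a) * h by rewrite lerDl mulr_ge0 ?subr_ge0// ltW.
have y1 : y <= y + (t1 - t0) * h by rewrite lerDl mulr_ge0 ?subr_ge0// ltW.
rewrite (polarI_D _ _ caff crho)// polarI_affine// add0r.
set e1 := e / _ in Hd; have e10 : 0 < e1 by exact: divr_gt0.
have small r t : x <= r <= x + (b - a) * h -> y <= t <= y + (t1 - t0) * h ->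
    normc (rho (pol r t)) <= e1 * (K * h).
  move=> /andP[r1 r2] /andP[t1' t2].
  have dist : normc (pol r t - pol p q) <= K * h.
    apply: le_trans (pol_dist _ _ _ _) _.
    have -> : K * h = (b - a) * h + b * (2 * ((t1 - t0) * h)) by rewrite /K; ring.
    have rp : `|r - p| <= (b - a) * h by rewrite ler_norml; lra.
    have tq : `|t - q| <= (t1 - t0) * h by rewrite ler_norml; lra.
    have /andP[ap pb] := pab.
    apply: lerD => //; rewrite ger0_norm; last exact: le_trans ap.
    by apply: ler_pM; [exact: le_trans ap|exact: mulr_ge0|exact: pb|rewrite ler_pM2l].
  have -> : rho (pol r t) = Q (pol r t) - Q (pol p q) - A * (pol r t - pol p q).
    by rewrite /rho /al /be; ring.
  apply: le_trans (Hd _ _) _; first by apply: le_lt_trans dist _; move: hd; lra.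
  by rewrite ler_wpM2l// ltW.
have arcb r : x <= r <= x + (b - a) * h ->
    normc (arcI rho r y (y + (t1 - t0) * h)) <= 2 * (e1 * (K * h) * b * ((t1 - t0) * h)).
  move=> rx; have rab : a <= r <= b by case/andP: rx => r1 r2; rewrite (le_trans ax r1) (le_trans r2 xb).
  have [ar rb] := andP rab.
  apply: le_trans (cI_bound (M := e1 * (K * h) * b) y1 _ _) _.
  - by apply: ccont_arc => t; exact: crho.
  - move=> t; rewrite in_itv/= => tt.
    rewrite ComplexField.Normc.normcM [normc ('i%C * _)]ComplexField.Normc.normcM.
    rewrite normc_pol normc_i mul1r.
    apply: ler_pM; rewrite ?normc_ge0//; first exact: small.
    by rewrite ger0_norm// (le_trans a0).
  by rewrite addrAC subrr add0r.
have radb t : y <= t <= y + (t1 - t0) * h ->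
    normc (radI rho t x (x + (b - a) * h)) <= 2 * (e1 * (K * h) * ((b - a) * h)).
  move=> ty.
  apply: le_trans (cI_bound (M := e1 * (K * h)) x1 _ _) _.
  - exact: (ccont_rad _ crho).
  - move=> r; rewrite in_itv/= => rr.
    by rewrite ComplexField.Normc.normcM normc_expi mulr1; exact: small.
  by rewrite addrAC subrr add0r.
have B1 := arcb x ltac:(by rewrite lexx).
have B2 := arcb (x + (b - a) * h) ltac:(by rewrite x1 lexx).
have B3 := radb y ltac:(by rewrite lexx).
have B4 := radb (y + (t1 - t0) * h) ltac:(by rewrite y1 lexx).
rewrite /polarI.
apply: (@le_trans _ _ (2 * (2 * (e1 * (K * h) * b * ((t1 - t0) * h))) + 2 * (2 * (e1 * (K * h) * ((b - a) * h))))).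
  move: B1 B2 B3 B4; set z1 := arcI _ _ _ _; set z2 := arcI _ _ _ _.
  set z3 := radI _ _ _ _; set z4 := radI _ _ _ _.
  have := @le_normcD R (z2 - z1 - z4) z3; have := @le_normcD R (z2 - z1) (- z4).
  have := @le_normcD R z2 (- z1); rewrite !(@normcN R); lra.
have -> : 2 * (2 * (e1 * (K * h) * b * ((t1 - t0) * h))) + 2 * (2 * (e1 * (K * h) * ((b - a) * h)))
  = 4 * e1 * K * h ^+ 2 * (b * (t1 - t0) + (b - a)) by ring.
apply: (@le_trans _ _ (4 * e1 * K * h ^+ 2 * K)).
  have P : 0 <= 4 * e1 * K * h ^+ 2.
    by rewrite mulr_ge0 ?sqr_ge0// mulr_ge0// mulr_ge0// ltW.
  have bt : 0 <= b * (t1 - t0) by rewrite mulr_ge0// subr_ge0.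
  by apply: ler_wpM2l => //; rewrite /K; move: bt; lra.
have -> : 4 * e1 * K * h ^+ 2 * K = (4 * K ^+ 2 * e1) * h ^+ 2 by ring.
rewrite ler_wpM2r ?sqr_ge0// /e1 mulrCA ler_piMr ?ltW//.
by rewrite ltr_pdivrMr// mul1r ltrDl.
Qed.

(** On a full turn the two radial sides coincide and cancel. *)
Lemma arcI_const Q (a b : R) : 0 <= a -> a <= b ->
  (forall r t, a <= r <= b -> cder Q (pol r t)) ->
  arcI Q b (- pi) pi = arcI Q a (- pi) pi.
Proof.
move=> a0 ab dQ.
have pp : - pi <= pi :> R by rewrite ltW// ltNpi_pi.
have := goursat a0 ab pp dQ; rewrite /polarI.
have -> : radI Q pi a b = radI Q (- pi) a b.
  rewrite /radI; congr cI; apply/funext => r.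
  have -> : expi pi = expi (- pi) :> C by rewrite /expi cosN sinN sinpi oppr0.
  by rewrite /pol /expi cosN sinN sinpi oppr0.
by rewrite subrK => /eqP; rewrite subr_eq0 => /eqP.
Qed.

End Goursat.

(** * Polynomial approximation of holomorphic functions *)

Section Cauchy.
Variable R : realType.
Local Notation C := R[i].
Local Notation leb := (@lebesgue_measure R).
Implicit Types (Q Phi : C -> C).

Lemma derivable_cder Phi w : derivable (Phi : C^o -> C^o) w 1 -> cder Phi w.
Proof.
move=> /cvg_ex[/= A /cvgrPdist_le HA]; exists A => e e0.
have /HA : 0 < e%:C by rewrite ltcR.
rewrite near_withinE => /nbhs_ballP[d /= d0 Hd].
have dE : d = (Re d)%:C.
  by move: d0; rewrite ltcE => /andP[/eqP /= di _]; apply: complexP.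
exists (Re d); first by rewrite -ltcR -dE.
move=> z zd; have [->|zw] := eqVneq z w.
  by rewrite !subrr mulr0 subr0 ComplexField.Normc.normc0 mulr0.
have zw0 : z - w != 0 by rewrite subr_eq0.
have := Hd (z - w); rewrite /ball /= sub0r normrN normCE dE ltcR zd => /(_ erefl zw0).
rewrite normCE lecR => H.
have -> : Phi z - Phi w - A * (z - w) =
  - ((A - (z - w)^-1 *: (Phi ((z - w) *: (1 : C^o) + w) - Phi w)) * (z - w)).
  have -> : (z - w) *: (1 : C^o) + w = z by rewrite /GRing.scale /= mulr1 subrK.
  by rewrite /GRing.scale /=; field.
by rewrite (@normcN R) ComplexField.Normc.normcM ler_wpM2r// normc_ge0.
Qed.

Lemma cder_local Q1 Q2 w (d : R) : 0 < d ->
  (forall z, normc (z - w) < d -> Q1 z = Q2 z) -> cder Q1 w -> cder Q2 w.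
Proof.
move=> d0 Q12 [A HA]; exists A => e e0; have [d1 d10 H1] := HA e e0.
exists (Num.min d d1); first by rewrite lt_min d0.
move=> z; rewrite lt_min => /andP[zd zd1].
rewrite -Q12// -Q12 ?H1//.
by rewrite subrr ComplexField.Normc.normc0.
Qed.

(** The value [A] at [a] is meant to be the derivative there, so that the quotient is
    continuous. *)
Definition dquot Phi (a A w : C) := if w == a then A else (Phi w - Phi a) / (w - a).

Lemma dquot_der Phi a A w : derivable (Phi : C^o -> C^o) w 1 -> w != a ->
  cder (dquot Phi a A) w.
Proof.
move=> dPhi wa.
have wa0 : 0 < normc (w - a).
  rewrite lt_neqAle normc_ge0 andbT eq_sym; apply: contra_neq wa => /ComplexField.Normc.eq0_normc.
  exact: subr0_eq.
apply: (@cder_local (fun z => (Phi z - Phi a) / (z - a)) _ w (normc (w - a))) => //.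
  move=> z zw; rewrite /dquot; case: eqVneq zw => // ->.
  by rewrite normcB ltxx.
have [Aw HA] := derivable_cder dPhi.
set D := w - a in wa0; pose Qw := (Phi w - Phi a) / D; pose L := (Aw - Qw) / D.
have D0 : D != 0 by rewrite subr_eq0.
exists L => e e0.
have L1 : 0 < normc L + 1 by rewrite ltr_wpDl ?normc_ge0.
have e1 : 0 < e * normc D / 4 by rewrite !divr_gt0// mulr_gt0.
have [d d0 Hd] := HA _ e1.
exists (Num.min d (Num.min (normc D / 2) (e * normc D / 4 / (normc L + 1)))).
  by rewrite !lt_min d0 !divr_gt0// mulr_gt0.
move=> z; rewrite !lt_min => /and3P[/Hd h1 h2].
rewrite ltr_pdivlMr// => h3.
have Dza : normc D / 2 <= normc (z - a).
  have := @le_normcD R (z - a) (w - z).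
  have -> : z - a + (w - z) = D by rewrite /D; ring.
  by rewrite (normcB w z); move: h2; lra.
have za0 : z - a != 0.
  apply/eqP => z0; move: Dza; rewrite z0 ComplexField.Normc.normc0.
  by move: wa0; lra.
rewrite -/D -/Qw.
have -> : (Phi z - Phi a) / (z - a) - Qw - L * (z - w) =
   (Phi z - Phi w - Aw * (z - w) - L * (z - w) * (z - w)) / (z - a).
  have -> : z - a = D + (z - w) by rewrite /D; ring.
  have zz : D + (z - w) != 0 by rewrite /D; apply: contra_neq za0 => <-; ring.
  have -> : Phi a = Phi w - Qw * D by rewrite /Qw divfK//; ring.
  have alg (p r q E b x : C) : E != 0 -> E + x != 0 -> (p - (r - q * E)) / (E + x) - q -
      (b - q) / E * x = (p - r - b * x - (b - q) / E * x * x) / (E + x).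
    by move=> E0 Ex; field; rewrite ?Ex ?E0.
  exact: alg.
rewrite ComplexField.Normc.normcM ComplexField.Normc.normcV.
rewrite ler_pdivrMr; last by apply: lt_le_trans Dza; rewrite divr_gt0.
apply: le_trans (@le_normcD R _ _) _; rewrite (@normcN R).
rewrite (ComplexField.Normc.normcM (L * _)) (ComplexField.Normc.normcM L).
have nz := normc_ge0 (z - w).
apply: (@le_trans _ _ (e * normc (z - w) * (normc D / 2))); last first.
  by rewrite ler_wpM2l// mulr_ge0// ltW.
have h4 : normc L * normc (z - w) * normc (z - w) <= e * normc D / 4 * normc (z - w).
  rewrite ler_wpM2r//; apply: le_trans (ltW h3).
  by rewrite mulrC ler_wpM2l// lerDl.
by move: h1 h4; set x := normc (z - w); lra.
Qed.

Lemma dquot_cont Phi a A : (forall e : R, 0 < e -> exists2 d : R, 0 < d &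
  forall z, normc (z - a) < d -> normc (Phi z - Phi a - A * (z - a)) <= e * normc (z - a)) ->
  ccontAt (dquot Phi a A) a.
Proof.
move=> HA e e0; have e2 : 0 < e / 2 by rewrite divr_gt0.
have [d d0 Hd] := HA _ e2; exists d => // z /Hd zd.
rewrite /dquot eqxx; case: eqVneq zd => [->|za] zd.
  by rewrite subrr ComplexField.Normc.normc0.
have za0 : z - a != 0 by rewrite subr_eq0.
have na : 0 < normc (z - a).
  rewrite lt_neqAle normc_ge0 andbT eq_sym.
  by apply: contra_neq za0 => /ComplexField.Normc.eq0_normc.
have -> : (Phi z - Phi a) / (z - a) - A = (Phi z - Phi a - A * (z - a)) / (z - a) by field.
rewrite ComplexField.Normc.normcM ComplexField.Normc.normcV ltr_pdivrMr//.
apply: le_lt_trans zd _; rewrite ltr_pM2r//.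
by rewrite ltr_pdivrMr// ltr_pMr// ltr1n.
Qed.

Section Formula.
Variables (Phi : C -> C) (B : R).
Hypothesis dPhi : forall w, normc w < 1 -> derivable (Phi : C^o -> C^o) w 1.
Hypothesis bPhi : forall w, normc w < 1 -> normc (Phi w) <= B.

Let B0 : 0 <= B.
Proof. by apply: le_trans (normc_ge0 _) (bPhi (w := 0) _); rewrite ComplexField.Normc.normc0. Qed.

Lemma arcI_continuous Q (M : R) : (forall w, normc w < 1 -> ccontAt Q w) ->
  (forall w, normc w < 1 -> normc (Q w) <= M) -> forall r0 : R, `|r0| < 1 ->
  forall e : R, 0 < e -> exists2 d : R, 0 < d & forall r, `|r0 - r| < d ->
    normc (arcI Q r0 (- pi) pi - arcI Q r (- pi) pi) < e.
Proof.
move=> cQ bQ.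
have M0 : 0 <= M by apply: le_trans (normc_ge0 _) (bQ 0 _); rewrite ComplexField.Normc.normc0.
pose W (r t : R) := Q (pol r t) * ('i%C * pol r t).
have inI r : `]-1, 1[%classic r -> `|r| < 1 :> R by rewrite /= in_itv/= ltr_norml.
have cW r : `|r| < 1 -> ccont (- pi) pi (W r).
  by move=> r1; apply: ccont_arc => t; apply: cQ; rewrite normc_pol.
have bW r t : `|r| < 1 -> normc (W r t) <= M.
  move=> r1; rewrite /W ComplexField.Normc.normcM.
  rewrite [normc ('i%C * _)]ComplexField.Normc.normcM normc_pol normc_i mul1r -[leRHS]mulr1.
  by apply: ler_pM; [exact: normc_ge0|exact: normr_ge0|rewrite bQ// normc_pol|exact: ltW].
have iM : leb.-integrable `[- pi, pi]%classic (EFin \o (fun=> M)).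
  have [+ _] := @ccont_integrable R (- pi) pi (fun=> M%:C) (ccont_cst _ _ _).
  by [].
have cr (t : R) (r : R) : `|r| < 1 -> forall e : R, 0 < e -> exists2 d : R, 0 < d &
    forall s, `|r - s| < d -> normc (W r t - W s t) < e.
  move=> r1 e e0; have i1 : (normc ('i%C : C)) = 1 by exact: normc_i.
  have e2 : 0 < e / 2 by rewrite divr_gt0.
  have [d d0 Hd] := cQ (pol r t) ltac:(by rewrite normc_pol) _ e2.
  have M1 : 0 < M + 1 by rewrite ltr_wpDl.
  exists (Num.min (1 - `|r|) (Num.min d (e / 2 / (M + 1)))).
    by rewrite !lt_min d0 subr_gt0 r1 !divr_gt0.
  move=> s; rewrite !lt_min => /and3P[s1 sd se].
  have s1' : `|s| < 1.
    by have := ler_normD (s - r) r; rewrite subrK distrC; move: s1; lra.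
  have srd : normc (pol s t - pol r t) <= `|r - s|.
    by apply: le_trans (pol_lip_r t s r) _; rewrite mul1r distrC.
  rewrite normcB /W.
  have -> : Q (pol s t) * ('i%C * pol s t) - Q (pol r t) * ('i%C * pol r t) =
    (Q (pol s t) - Q (pol r t)) * ('i%C * pol r t) + Q (pol s t) * ('i%C * (pol s t - pol r t)) by ring.
  apply: le_lt_trans (@le_normcD R _ _) _; rewrite (splitr e); apply: ltrD.
    rewrite ComplexField.Normc.normcM [normc ('i%C * _)]ComplexField.Normc.normcM normc_pol i1 mul1r.
    apply: le_lt_trans (Hd (pol s t) (le_lt_trans srd sd)).
    by rewrite ler_piMr ?normc_ge0// ltW.
  rewrite ComplexField.Normc.normcM [normc ('i%C * _)]ComplexField.Normc.normcM i1 mul1r.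
  move: se; rewrite ltr_pdivlMr//; apply: le_lt_trans; rewrite mulrC.
  apply: ler_pM; rewrite ?normc_ge0//.
  apply: le_trans (_ : M <= _); last by rewrite lerDl.
  by apply: bQ; rewrite normc_pol.
have contR (G : C -> R) : (forall z, `|G z| <= normc z) -> (forall x y, G (x - y) = G x - G y) ->
    (forall r, `|r| < 1 -> leb.-integrable `[- pi, pi]%classic (EFin \o (fun t => G (W r t)))) ->
    {in (`]-1, 1[%classic : set R), continuous (fun r => \int[leb]_(t in `[- pi, pi]) G (W r t))}.
  move=> Gn GB iG.
  apply: (@continuity_under_integral R _ _ leb (fun r t => G (W r t)) `[- pi, pi]%classic _ (-1) 1 _ _ (fun=> M)) => //.
  - by move=> r /inI; exact: iG.
  - apply: aeW => t _ r /set_mem /inI r1; apply/cvgrPdist_lt => e e0.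
    have [d d0 Hd] := cr t r r1 e e0.
    apply: filterS (nbhsx_ballx r d d0) => s rs.
    by rewrite -GB; apply: le_lt_trans (Gn _) _; exact: Hd.
  - by move=> r /inI r1; apply: aeW => t _; apply: le_trans (Gn _) _; exact: bW.
move=> r0 r01 e e0; have e2 : 0 < e / 2 by rewrite divr_gt0.
have r0I : r0 \in (`]-1, 1[%classic : set R) by rewrite inE /= in_itv/= -ltr_norml.
have /(_ r0 r0I)/cvgrPdist_lt/(_ _ e2) := @contR Re (@Re_le_normc R)
  (fun x y => eq_trans (cReD _ _) (congr1 _ (cReN _))) (fun r r1 => (ccont_integrable (cW r r1)).1).
rewrite -nbhs_ballE => -[d1 /= d10 H1].
have /(_ r0 r0I)/cvgrPdist_lt/(_ _ e2) := @contR Im (@Im_le_normc R)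
  (fun x y => eq_trans (cImD _ _) (congr1 _ (cImN _))) (fun r r1 => (ccont_integrable (cW r r1)).2).
rewrite -nbhs_ballE => -[d2 /= d20 H2].
exists (Num.min d1 d2); first by rewrite lt_min d10.
move=> r; rewrite lt_min => /andP[/H1 h1 /H2 h2].
apply: le_lt_trans (normc_leD (arcI Q r0 (- pi) pi - arcI Q r (- pi) pi)) _; rewrite !cpartE (splitr e).
by apply: ltrD.
Qed.

Lemma dquot_bounded a A : normc a < 1 -> ccontAt (dquot Phi a A) a ->
  exists M : R, forall w, normc w < 1 -> normc (dquot Phi a A w) <= M.
Proof.
move=> a1 /(_ 1 ltr01)[d d0 Hd].
exists (normc A + 1 + 2 * B / d) => w w1.
have Bd : 0 <= 2 * B / d by rewrite divr_ge0 ?mulr_ge0// ltW.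
have [wd|wd] := ltP (normc (w - a)) d.
  have := Hd _ wd; rewrite {2}/dquot eqxx => h.
  have := @le_normcD R (dquot Phi a A w - A) A; rewrite subrK; move: h Bd; lra.
have na : 0 < normc (w - a) by exact: lt_le_trans wd.
have wa : w != a.
  by apply: contraTneq na => ->; rewrite subrr ComplexField.Normc.normc0 ltxx.
rewrite /dquot (negbTE wa) ComplexField.Normc.normcM ComplexField.Normc.normcV.
apply: (@le_trans _ _ (2 * B / d)).
  apply: ler_pM; rewrite ?normc_ge0 ?invr_ge0 ?normc_ge0//.
    apply: le_trans (@le_normcD R _ _) _; rewrite (@normcN R).
    by have := bPhi w1; have := bPhi a1; lra.
  by rewrite lef_pV2 ?posrE.
by have := normc_ge0 A; lra.
Qed.

Lemma arcI0 Q t0 t1 : arcI Q 0 t0 t1 = 0.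
Proof.
rewrite /arcI /cI; have -> : (fun t => Q (pol 0 t) * ('i%C * pol 0 t)) = (fun=> 0 * 0).
  by apply/funext => t; rewrite /pol mul0r !mulr0.
rewrite cintZ ?mul0r//; apply: ccont_integrable; exact: ccont_cst.
Qed.

(** The quotient is differentiable off [a], so its circle integral is constant in
    the radius on each side of [|a|]. It vanishes at radius [0], and boundedness and
    continuity of the quotient carry this across the radius [|a|]. *)
Lemma cauchy_dquot a A r : normc a < r -> r < 1 ->
  (forall e : R, 0 < e -> exists2 d : R, 0 < d &
    forall z, normc (z - a) < d -> normc (Phi z - Phi a - A * (z - a)) <= e * normc (z - a)) ->
  arcI (dquot Phi a A) r (- pi) pi = 0.
Proof.
move=> ar r1 HA; set Q := dquot Phi a A; set rho := normc a in ar.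
have rho0 : 0 <= rho by exact: normc_ge0.
have a1 : normc a < 1 by exact: lt_trans r1.
have cQa : ccontAt Q a by exact: dquot_cont.
have dQ w : normc w < 1 -> w != a -> cder Q w by move=> w1; exact: dquot_der (dPhi w1).
have cQ w : normc w < 1 -> ccontAt Q w.
  by move=> w1; have [->//|wa] := eqVneq w a; exact/cder_cont/dQ.
have [M HM] := dquot_bounded a1 cQa.
have cG := arcI_continuous cQ HM.
have rho1 : `|rho| < 1 by rewrite ger0_norm.
have polna x t : 0 <= x -> x != rho -> pol x t != a.
  by move=> x0; apply: contra_neq => E; rewrite /rho -E normc_pol ger0_norm.
have Grho : arcI Q rho (- pi) pi = 0.
  have [->|rhon0] := eqVneq rho 0; first exact: arcI0.
  have rhop : 0 < rho by rewrite lt_neqAle eq_sym rhon0.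
  apply: ComplexField.Normc.eq0_normc; apply/eqP; rewrite eq_le normc_ge0 andbT.
  apply/ler_addgt0Pr => e e0; rewrite add0r.
  have [d d0 Hd] := cG rho rho1 e e0.
  (* a radius just inside [|a|], where the integral is known to vanish *)
  pose s := Num.max 0 (rho - d / 2).
  have s0 : 0 <= s by rewrite le_max lexx.
  have srho : s < rho by rewrite gt_max rhop /= ltrBlDr ltrDl divr_gt0.
  have sd : `|rho - s| < d.
    rewrite ger0_norm ?subr_ge0 ?(ltW srho)//.
    have : rho - d / 2 <= s by rewrite le_max lexx orbT.
    by move: d0; lra.
  have Gs : arcI Q s (- pi) pi = 0.
    rewrite (@arcI_const R Q 0 s)// ?arcI0// => x t /andP[x0 xs].
    apply: dQ; first by rewrite normc_pol ger0_norm// (le_lt_trans xs)// (lt_trans srho).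
    by apply: polna => //; rewrite lt_eqF// (le_lt_trans xs).
  by have := Hd s sd; rewrite Gs subr0 => /ltW.
apply: ComplexField.Normc.eq0_normc; apply/eqP; rewrite eq_le normc_ge0 andbT.
apply/ler_addgt0Pr => e e0; rewrite add0r.
have [d d0 Hd] := cG rho rho1 e e0.
(* a radius just outside [|a|], not beyond [r] *)
pose s := Num.min r (rho + d / 2).
have rs : rho < s by rewrite lt_min ar /= ltrDl divr_gt0.
have sr : s <= r by rewrite ge_min lexx.
have sd : `|rho - s| < d.
  rewrite distrC ger0_norm ?subr_ge0 ?(ltW rs)//.
  have : s <= rho + d / 2 by rewrite ge_min lexx orbT.
  by move: d0; lra.
have -> : arcI Q r (- pi) pi = arcI Q s (- pi) pi.
  apply: arcI_const => //; first exact: le_trans (ltW rs).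
  move=> x t /andP[sx xr]; have x0 : 0 <= x by exact: le_trans rho0 (le_trans (ltW rs) sx).
  apply: dQ; first by rewrite normc_pol ger0_norm// (le_lt_trans xr).
  by apply: polna => //; rewrite gt_eqF// (lt_le_trans rs).
by have := Hd s sd; rewrite Grho sub0r (@normcN R) => /ltW.
Qed.

Lemma ccontX a b (F : measurableTypeR R -> C) n : ccont a b F ->
  ccont a b (fun t => F t ^+ n).
Proof.
move=> cF; elim: n => [|n ih]; first exact: ccont_cst.
by under [X in ccont _ _ X]eq_fun do rewrite exprS; exact: ccontM.
Qed.

Lemma expi_natmul n (t : R) : expi (n%:R * t) = expi t ^+ n :> C.
Proof.
elim: n => [|n ih]; first by rewrite mul0r expr0 expi0.
by rewrite -natr1 mulrDl mul1r expiD ih exprSr.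
Qed.

Lemma expi_pi : expi pi = expi (- pi) :> C.
Proof. by rewrite /expi cosN sinN sinpi oppr0. Qed.

Lemma cI_circle_expX j : cI (- pi) pi (fun t => expi (- t) ^+ j : C) = (j == 0)%:R * (2 * pi)%:C.
Proof.
have pp : - pi <= pi :> R by rewrite ltW// ltNpi_pi.
case: j => [|j].
  have -> : (fun t => expi (- t) ^+ 0 : C) = (fun=> 1) by apply/funext => t; rewrite expr0.
  by rewrite cI_cst// mul1r eqxx mul1r opprK mulr2n mulrDl mul1r.
rewrite mul0r.
have -> : (fun t => expi (- t) ^+ j.+1 : C) = (fun t => expi ((- j.+1%:R) * t)).
  by apply/funext => t; rewrite -expi_natmul mulrN mulNr.
rewrite cI_expi ?oppr_eq0 ?pnatr_eq0//.
by rewrite !mulNr -!mulrN !expi_natmul opprK expi_pi subrr mul0r.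
Qed.

(** Cauchy's theorem for the difference quotient, with [1 / (w - a)] expanded as a
    geometric series in [a / w] on a circle of radius [r] between [rho] and [1]. The
    remainder is [O((rho / r)^N)] uniformly in [a]. *)
Lemma poly_approx (rho e : R) : 0 <= rho -> rho < 1 -> 0 < e ->
  exists (N : nat) (b : nat -> C), forall a, normc a <= rho ->
    normc (Phi a - \sum_(j < N) b j * a ^+ j) <= e.
Proof.
move=> rho0 rho1 e0; pose r : R := (1 + rho) / 2.
have rrho : rho < r by rewrite /r; lra.
have r1 : r < 1 by rewrite /r; lra.
have r0 : 0 < r by exact: le_lt_trans rrho.
have rr0 : 0 < r - rho by rewrite subr_gt0.
have pp : - pi <= pi :> R by rewrite ltW// ltNpi_pi.
have pi2 : 0 < 2 * pi :> R by rewrite mulr_gt0// pi_gt0.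
pose q := rho / r.
have q0 : 0 <= q by rewrite divr_ge0// ltW.
have q1 : `|q| < 1 by rewrite ger0_norm// /q ltr_pdivrMr// mul1r.
have [N N0 HN] : exists2 N, (0 < N)%N & 4 * B / (r - rho) * q ^+ N < e.
  have /cvgrPdist_lt/(_ _ e0)[N _ HN] := @cvg_geometric _ (4 * B / (r - rho)) _ q1.
  exists N.+1 => //; have := HN N.+1 (leqnSn N).
  by rewrite /geometric /= sub0r normrN => /(le_lt_trans (ler_norm _)).
(* [1 / w] at [w = pol r t] *)
pose iw (t : R) : C := pol r^-1 (- t).
have ciw : ccont (- pi) pi iw.
  apply: (ccont_comp (Q := id) (L := 2 * `|r^-1|)).
    move=> x y; apply: le_trans (pol_lip_t _ _ _) _.
    by rewrite -opprD normrN.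
  by move=> x _; exact: ccontAt_id.
have iwE t : pol r t * iw t = 1.
  rewrite /iw /pol mulrACA -expiD subrr expi0 -rmorphM/= mulfV ?gt_eqF//.
  by rewrite mulr1.
have cPhi w : normc w < 1 -> ccontAt Phi w.
  by move=> w1; exact/cder_cont/derivable_cder/dPhi.
have npol t : normc (pol r t) < 1 by rewrite normc_pol ger0_norm// ltW.
have cP : ccont (- pi) pi (fun t => Phi (pol r t)).
  by apply: (ccont_comp (pol_lip_t r)) => t _; exact: cPhi.
pose gam j := cI (- pi) pi (fun t => Phi (pol r t) * iw t ^+ j).
pose b j := gam j / (2 * pi)%:C.
exists N, b => a arho.
have ar : normc a < r by exact: le_lt_trans rrho.
have a1 : normc a < 1 by exact: lt_trans r1.
have [A HA] := derivable_cder (dPhi a1).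
have := cauchy_dquot ar r1 HA; rewrite /arcI; set Q := dquot Phi a A.
have cQ w : normc w < 1 -> ccontAt Q w.
  move=> w1; have [->|wa] := eqVneq w a; first exact: dquot_cont.
  exact/cder_cont/(dquot_der _ (dPhi w1)).
have pna t : pol r t != a.
  by apply: contraTneq ar => <-; rewrite normc_pol ger0_norm ?ltxx ?ltW.
have cQp : ccont (- pi) pi (fun t => Q (pol r t)).
  by apply: (ccont_comp (pol_lip_t r)) => t _; exact: cQ.
(* the remainder of the geometric series after [N] terms *)
pose Rem t := Q (pol r t) * pol r t * (a * iw t) ^+ N.
have cRem : ccont (- pi) pi Rem.
  apply: ccontM; first by apply: ccontM => //; exact: ccont_pol.
  by apply: ccontX; apply: ccontM => //; exact: ccont_cst.
have -> : (fun t => Q (pol r t) * ('i%C * pol r t)) =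
  (fun t => 'i%C * (\sum_(j < N) a ^+ j * ((Phi (pol r t) - Phi a) * iw t ^+ j) + Rem t)).
  apply/funext => t; rewrite [LHS]mulrCA; congr (_ * _).
  have QE : Phi (pol r t) - Phi a = Q (pol r t) * (pol r t * (1 - a * iw t)).
    rewrite mulrBr mulr1 mulrCA iwE mulr1 /Q /dquot (negbTE (pna t)) divfK//.
    by rewrite subr_eq0.
  have := subrX1 (a * iw t) N; set x := a * iw t; set S := \sum_(i < N) x ^+ i => xN.
  set y := x ^+ N in xN *.
  have -> : \sum_(j < N) a ^+ j * ((Phi (pol r t) - Phi a) * iw t ^+ j) =
     (Phi (pol r t) - Phi a) * S.
    by rewrite mulr_sumr; apply: eq_bigr => j _; rewrite /x (exprMn j a (iw t)) mulrCA.
  rewrite QE /Rem -/x -/y.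
  have -> : Q (pol r t) * (pol r t * (1 - x)) * S + Q (pol r t) * pol r t * y =
     Q (pol r t) * pol r t * (y - (x - 1) * S) by ring.
  by rewrite -xN; ring.
have cF j : ccont (- pi) pi (fun t => (Phi (pol r t) - Phi a) * iw t ^+ j).
  apply: ccontM; first by apply: ccontD => //; exact: ccont_cst.
  exact: ccontX.
have iF j : cintegrable leb `[- pi, pi]%classic (fun t => a ^+ j * ((Phi (pol r t) - Phi a) * iw t ^+ j)).
  by apply: cintegrableZ => //; exact: ccont_integrable.
have [iS ES] := @cint_sum _ _ _ leb `[- pi, pi]%classic ltac:(exact: measurable_itv) _ (index_enum 'I_N)
  (fun (j : 'I_N) t => a ^+ j * ((Phi (pol r t) - Phi a) * iw t ^+ j)) (fun j => iF j).
rewrite /cI cintZ//; last by apply: cintegrableD => //; exact: ccont_integrable.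
rewrite cintD//; last exact: ccont_integrable.
rewrite {}ES => /eqP; rewrite mulf_eq0 => /orP[/eqP[] /eqP|/eqP E]; first by rewrite oner_eq0.
have Ej j : cint leb `[- pi, pi]%classic (fun t => a ^+ j * ((Phi (pol r t) - Phi a) * iw t ^+ j)) =
    a ^+ j * gam j - Phi a * (j == 0)%:R * (2 * pi)%:C.
  rewrite cintZ//; last exact: ccont_integrable.
  have -> : (fun t => (Phi (pol r t) - Phi a) * iw t ^+ j) =
    (fun t => Phi (pol r t) * iw t ^+ j - (Phi a * (r^-1)%:C ^+ j) * expi (- t) ^+ j).
    by apply/funext => t; rewrite mulrBl /iw /pol [in X in _ - X]exprMn mulrA.
  have ce : cintegrable leb `[- pi, pi]%classic (fun t : R => expi (- t) ^+ j).
    apply: ccont_integrable; apply: ccontX.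
    apply: (ccont_comp (Q := id) (L := 2)); last by move=> x _; exact: ccontAt_id.
    by move=> x y; apply: le_trans (expi_lip _ _) _; rewrite -opprD normrN.
  rewrite cintB//; last 2 first.
  - by apply: ccont_integrable; apply: ccontM => //; exact: ccontX.
  - exact: cintegrableZ.
  rewrite cintZ// -!/(cI _ _ _) cI_circle_expX -/(gam j).
  by case: j {iF cF ce} => [|j]; rewrite ?eqxx ?expr0 /=; ring.
move: E; under eq_bigr do rewrite Ej.
rewrite sumrB.
have -> : \sum_(j < N) Phi a * ((j : nat) == 0)%:R * (2 * pi)%:C = Phi a * (2 * pi)%:C.
  rewrite (bigD1 (Ordinal N0))//= mulr1 big1 ?addr0// => j j0.
  by rewrite (_ : (j : nat) == 0 = false) ?mulr0 ?mul0r//; apply: negbTE j0.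
move=> E.
have p0 : (2 * pi)%:C != 0 :> C by rewrite fmorph_eq0 gt_eqF.
have -> : Phi a - \sum_(j < N) b j * a ^+ j = cint leb `[- pi, pi]%classic Rem / (2 * pi)%:C.
  have -> : \sum_(j < N) b j * a ^+ j = (\sum_(j < N) a ^+ j * gam j) / (2 * pi)%:C.
    by rewrite mulr_suml; apply: eq_bigr => j _; rewrite /b; ring.
  apply: (mulIf p0); rewrite mulrBl !divfK//.
  by move/eqP : E; rewrite addr_eq0 => /eqP E; rewrite -opprB E opprK.
rewrite ComplexField.Normc.normcM ComplexField.Normc.normcV normc_real gtr0_norm//.
rewrite ler_pdivrMr//.
have BR t : normc (Rem t) <= 2 * B / (r - rho) * q ^+ N.
  rewrite /Rem ComplexField.Normc.normcM normcX; apply: ler_pM; rewrite ?normc_ge0 ?exprn_ge0 ?normc_ge0//.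
    rewrite /Q /dquot (negbTE (pna t)) ComplexField.Normc.normcM ComplexField.Normc.normcM ComplexField.Normc.normcV.
    have d1 : r - rho <= normc (pol r t - a).
      have := @le_normcD R (pol r t - a) a; rewrite subrK normc_pol gtr0_norm//; move: arho; lra.
    have d0 : 0 < normc (pol r t - a) by exact: lt_le_trans d1.
    rewrite normc_pol gtr0_norm//.
    have nX : normc (Phi (pol r t) - Phi a) <= 2 * B.
      apply: le_trans (@le_normcD R _ _) _; rewrite (@normcN R).
      by have := bPhi (npol t); have := bPhi a1; lra.
    have nI : (normc (pol r t - a))^-1 <= (r - rho)^-1 by rewrite lef_pV2 ?posrE.
    have i0 : 0 <= (normc (pol r t - a))^-1 by rewrite invr_ge0 normc_ge0.
    apply: le_trans (ler_pM (normc_ge0 _) i0 nX nI).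
    by rewrite ler_piMr ?mulr_ge0 ?normc_ge0// ltW.
  rewrite lerXn2r// ?nnegrE ?normc_ge0//.
  rewrite ComplexField.Normc.normcM /iw normc_pol gtr0_norm ?invr_gt0//.
  by rewrite /q ler_wpM2r// invr_ge0 ltW.
apply: le_trans (cI_bound pp cRem (fun t _ => BR t)) _.
rewrite (_ : pi - - pi = 2 * pi :> R); last by ring.
have -> : 2 * (2 * B / (r - rho) * q ^+ N * (2 * pi)) = 4 * B / (r - rho) * q ^+ N * (2 * pi).
  have -> : 4 = 2 * 2 :> R by ring.
  by rewrite !mulrA.
by rewrite ler_pM2r// ltW.
Qed.

End Formula.
End Cauchy.

(** * Bounded holomorphic functions lie in H^2 *)

Section HardySpace.
Variable R : realType.
Local Notation C := R[i].
Local Notation "z ^*" := (Num.conj z) : complex_scope.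
Local Notation mu := (arc_measure R).
Local Notation TR := (measurableTypeR R).
Local Notation leb := (@lebesgue_measure R).
Implicit Types (f h k p : C -> C).

(** [integral_uniform] handles nonnegative functions; adding the bound [M] reduces
    to that case. *)
Lemma Rintegral_arc (G : TR -> R) (M : R) : measurable_fun setT G ->
  (forall t, `|G t| <= M) ->
  \int[mu]_t G t = (2 * pi)^-1 * \int[leb]_(t in `[- pi, pi]) G t.
Proof.
move=> mG GM.
have iG1 : mu.-integrable setT (EFin \o G).
  apply: (@ae_le_integrable _ _ (fun=> M)) => //; last exact: aeT.
  exact: finite_measure_integrable_cst.
have iM1 : mu.-integrable setT (EFin \o (fun=> M)) by exact: finite_measure_integrable_cst.
have iM2 : leb.-integrable `[- pi, pi]%classic (EFin \o (fun=> M)).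
  have [+ _] := @ccont_integrable R (- pi) pi (fun=> M%:C) (ccont_cst _ _ _).
  by [].
have iG2 : leb.-integrable `[- pi, pi]%classic (EFin \o G).
  apply: le_integrable iM2 => //.
    by apply/measurable_EFinP; exact: measurable_funTS.
  by move=> t _ /=; rewrite lee_fin (le_trans (GM t))// ler_norm.
have mGM : measurable_fun setT (fun t : TR => (G t + M)%:E).
  by apply/measurable_EFinP; apply: measurable_funD.
have GM0 t : (0 <= (G t + M)%:E)%E.
  by rewrite lee_fin; have := GM t; rewrite ler_norml; lra.
have := integral_uniform (ltNpi_pi R) mGM GM0 => /(congr1 fine).
have -> : pi - - pi = 2 * pi :> R by ring.
have pi2 : 2 * pi != 0 :> R by rewrite mulf_neq0// gt_eqF// pi_gt0.
have iGM2 : leb.-integrable `[- pi, pi]%classic (EFin \o (fun t => G t + M)).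
  by apply: eq_integrable (integrableD _ iG2 iM2).
rewrite fineM//; last exact: integrable_fin_num.
rewrite -[fine (integral mu _ _)]/(\int[mu]_t (G t + M)).
rewrite -[fine (integral leb _ _)]/(\int[leb]_(t in `[- pi, pi]) (G t + M)).
rewrite !RintegralD// !Rintegral_cst//= probability_setT/=.
have := @lebesgue_measure_itv R `[- pi, pi]; rewrite /= lte_fin ltNpi_pi => -> /=.
rewrite mulr1 mulrDr (_ : pi - - pi = 2 * pi :> R); last by ring.
by rewrite mulrCA mulVf// mulr1 => /addIr.
Qed.

Lemma cintegral_conjX n : cint mu setT (fun t : TR => expi (- t) ^+ n) = (n == 0)%:R :> C.
Proof.
have mF : cmeasurable setT (fun t : TR => expi (- t) ^+ n : C).
  have := cmeasX n (cmeasJ (@cmeas_id R)); rewrite /cmeas /circ.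
  by under [X in cmeasurable _ X -> _]eq_fun do rewrite -expiN.
have F1 (t : TR) : normc (expi (- t) ^+ n : C) <= 1 by rewrite normcX normc_expi expr1n.
have p0 : (2 * pi)%:C != 0 :> C by rewrite fmorph_eq0 mulf_neq0// gt_eqF// pi_gt0.
have := @cI_circle_expX R n; rewrite /cI => E.
apply: (mulIf p0); rewrite -E; apply: complexP; rewrite !cpartE /=.
  rewrite (Rintegral_arc (M := 1) mF.1) => [|t]; last exact: le_trans (Re_le_normc _) (F1 t).
  by rewrite mulr0 subr0 mulrC mulrA mulfV ?mul1r// mulf_neq0// gt_eqF// pi_gt0.
rewrite (Rintegral_arc (M := 1) mF.2) => [|t]; last exact: le_trans (Im_le_normc _) (F1 t).
by rewrite mulr0 add0r mulrC mulrA mulfV ?mul1r// mulf_neq0// gt_eqF// pi_gt0.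
Qed.

Definition mono n : C -> C := fun z => z ^+ n.
Definition conjmono n : C -> C := fun z => z^* ^+ n.

Lemma unimodular_mono n : unimodular (mono n).
Proof. exact/unimodularX/unimodular_id. Qed.

Lemma unimodular_conjmono n : unimodular (conjmono n).
Proof. by apply: unimodularX; exact/unimodularJ/unimodular_id. Qed.

Lemma L2_mono n : L2_circle (mono n). Proof. exact/unimodular_L2/unimodular_mono. Qed.
Lemma L2_conjmono n : L2_circle (conjmono n).
Proof. exact/unimodular_L2/unimodular_conjmono. Qed.

Lemma inner_conjmono_mono m n : inner_L2 (conjmono m) (mono n) = (m + n == 0)%N%:R.
Proof.
rewrite -cintegral_conjX /inner_L2 /cintegral -/(cint mu setT _).
by apply: eq_cint => t _; rewrite /conjmono /mono rmorphXn/= -exprD expiN.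
Qed.

Lemma inner_mono_conjmono m n : inner_L2 (mono m) (conjmono n) = (m + n == 0)%N%:R.
Proof.
rewrite (innerC (L2_conjmono n) (L2_mono m)) inner_conjmono_mono rmorph_nat.
by rewrite addnC.
Qed.

Lemma norm2_le f (M : R) : 0 <= M -> L2_circle f ->
  {ae mu, forall t, normc (f (expi t)) <= M} -> norm2 f <= M.
Proof.
move=> M0 Lf fM; rewrite -(ler_pXn2r (n := 2))// ?nnegrE ?norm2_ge0//.
rewrite -lee_fin -integral_sqr_normc//.
apply: (@le_trans _ _ (\int[mu]_t (M ^+ 2)%:E)%E).
  apply: ae_ge0_le_integral => //.
  - by move=> t _; rewrite lee_fin sqr_ge0.
  - by apply/measurable_EFinP; exact: (measurable_sqr_normc (L2_meas Lf)).
  - by move=> t _; rewrite lee_fin sqr_ge0.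
  by apply: aeS fM => t fM _; rewrite lee_fin lerXn2r// nnegrE normc_ge0.
by rewrite integral_cst//= probability_setT mule1.
Qed.

(** The dilates [z |-> Phi (r z)] are uniform limits of polynomials on the circle by
    [poly_approx], and tend to [f] in [L^2] as [r] tends to [1] by dominated
    convergence. *)
Lemma Hinfty_H2 f : Hinfty f -> H2 f.
Proof.
move=> [[/andP[+ _] /andP[+ _]] [Phi [hPhi [B0 bPhi] rPhi]]].
rewrite !inE => mf1 mf2.
have mf : cmeas f by split.
pose B := `|Re B0|.
have nlt (w : C) : (`|w| < 1) = (normc w < 1) by rewrite normCE -ltcR.
have bP w : normc w < 1 -> normc (Phi w) <= B.
  rewrite -nlt => /bPhi; rewrite normCE => H; apply: le_trans (ler_norm _).
  by move: H; rewrite lecE => /andP[].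
have dP w : normc w < 1 -> derivable (Phi : C^o -> C^o) w 1 by rewrite -nlt; exact: hPhi.
(* [n + 2] keeps the radii positive and below [1] *)
pose r n : R := 1 - n.+2%:R^-1.
have rn0 n : 0 <= r n by rewrite subr_ge0 invf_le1// ler1n.
have rn1 n : r n < 1 by rewrite ltrBlDr ltrDl invr_gt0.
pose F n : C -> C := fun z => Phi ((r n)%:C * z).
have nr n t : normc ((r n)%:C * expi t) < 1.
  by rewrite ComplexField.Normc.normcM normc_real normc_expi mulr1 ger0_norm.
have mF n : cmeas (F n).
  have cP t : ccontAt Phi (pol (r n) t) by exact/cder_cont/derivable_cder/dP/nr.
  have cR (x : R) : forall e : R, 0 < e -> exists2 d : R, 0 < d &
      forall y, `|x - y| < d -> normc (Phi (pol (r n) x) - Phi (pol (r n) y)) < e.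
    move=> e e0; have [d d0 Hd] := cP x e e0.
    have r2 : 0 < 2 * `|r n| + 1 by rewrite ltr_wpDl// mulr_ge0.
    exists (d / (2 * `|r n| + 1)); first exact: divr_gt0.
    move=> y; rewrite ltr_pdivlMr// => xy; rewrite normcB; apply: Hd.
    apply: le_lt_trans (pol_lip_t _ _ _) _; apply: le_lt_trans xy.
    by rewrite (distrC y x) mulrC ler_wpM2l// lerDl.
  split; apply: continuous_measurable_fun => x; apply/cvgrPdist_lt => e e0;
    have [d d0 Hd] := cR x e e0; apply: filterS (nbhsx_ballx x d d0) => y /Hd xy.
    by rewrite /comp /circ -cReN -cReD (le_lt_trans (Re_le_normc _)).
  by rewrite /comp /circ -cImN -cImD (le_lt_trans (Im_le_normc _)).
have LF n : L2_circle (F n).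
  by apply: (L2_bounded (B := B)) => //; apply: aeT => t; exact/bP/nr.
have cF : {ae mu, forall t, forall e : R, 0 < e -> exists N, forall n, (N <= n)%N ->
    normc (F n (expi t) - f (expi t)) < e}.
  apply: aeS rPhi => t /cvgrPdist_lt rt e e0.
  have e0C : 0 < e%:C by rewrite ltcR.
  have := rt _ e0C; rewrite near_withinE => /nbhs_ballP[d /= d0 Hd].
  have [N _ HN] := near_infty_natSinv_lt (PosNum d0).
  exists N => n Nn; have := Hd (r n).
  rewrite /ball /= /r opprB addrCA subrr addr0 ger0_norm ?invr_ge0//.
  have nd : n.+2%:R^-1 < d.
    apply: le_lt_trans (HN n Nn); rewrite /= lef_pV2 ?posrE ?ltr0n// ler_nat.
    exact: leqnSn.
  move=> /(_ nd (rn1 n)); rewrite normCE ltcR normcB.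
  by [].
have fB : {ae mu, forall t, normc (f (expi t)) <= B}.
  apply: aeS cF => t ct; apply/ler_addgt0Pr => e e0; have [N HN] := ct e e0.
  have := HN N (leqnn _); have := bP _ (nr N t); rewrite -/(F N (expi t)) => h1 h2.
  have := @le_normcD R (F N (expi t)) (f (expi t) - F N (expi t)).
  rewrite addrCA subrr addr0 (normcB (f _)); move: h1 h2; lra.
have Lf : L2_circle f by exact: L2_bounded fB.
have LFf n : L2_circle (fun z => F n z - f z) by exact: L2B.
have I0 : (fun n => \int[mu]_t (normc (F n (expi t) - f (expi t)) ^+ 2)%:E)%E @ \oo --> 0%E.
  have := @dominated_convergence _ _ _ mu setT measurableT
    (fun n t => (normc (F n (expi t) - f (expi t)) ^+ 2)%:E) (cst 0%E) (cst ((2 * B) ^+ 2)%:E).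
  case.
  - by move=> n; apply/measurable_EFinP; exact: (measurable_sqr_normc (L2_meas (LFf n))).
  - exact: measurable_cst.
  - apply: aeS cF => t ct _.
    have c0 : (fun n => normc (F n (expi t) - f (expi t))) @ \oo --> (0 : R).
      apply/cvgrPdist_lt => e e0; have [N HN] := ct e e0.
      exists N => // n Nn /=; rewrite sub0r normrN ger0_norm ?normc_ge0//.
      exact: HN.
    apply: cvg_EFin; first exact: nearW.
    set v := (fun n => normc (F n (expi t) - f (expi t))) in c0.
    rewrite (_ : fine \o _ = fun n => v n * v n) -?[X in _ --> X](mulr0 (0 : R)).
      exact: cvgM.
    by apply/funext => n; rewrite /= expr2.
  - exact: finite_measure_integrable_cst.
  - apply: aeS fB => t fB n _ /=; rewrite lee_fin ger0_norm ?sqr_ge0//.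
    apply: lerXn2r; rewrite ?nnegrE ?normc_ge0//.
      by rewrite mulr_ge0// /B normr_ge0.
    apply: le_trans (@le_normcD R _ _) _; rewrite (@normcN R).
    by have := bP _ (nr n t); rewrite -/(F n (expi t)); move: fB; lra.
  by move=> _ _; rewrite integral_cst// mul0e.
have ce (e : R) : 0 < e -> exists n, norm2 (fun z => F n z - f z) < e.
  move=> e0; have e2 : 0 < e ^+ 2 by rewrite exprn_gt0.
  have I1 : (fun n => norm2 (fun z => F n z - f z) ^+ 2) @ \oo --> (0 : R).
    suff -> : (fun n => norm2 (fun z => F n z - f z) ^+ 2) =
      fine \o (fun n => \int[mu]_t (normc (F n (expi t) - f (expi t)) ^+ 2)%:E)%E.
      exact: fine_cvg.
    by apply/funext => n; rewrite /comp (integral_sqr_normc (LFf n)).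
  have [N _ HN] := (cvgrPdist_lt _ _).1 I1 _ e2.
  exists N; have := HN N (leqnn _); rewrite /= sub0r normrN ger0_norm ?sqr_ge0//.
  by rewrite ltr_pXn2r// ?nnegrE ?norm2_ge0// ltW.
split=> // e e0; have e2 : 0 < e / 2 by rewrite divr_gt0.
have [n Hn] := ce _ e2.
have e4 : 0 < e / 2 / 2 by rewrite divr_gt0.
have [N [b Hb]] := poly_approx dP bP (rn0 n) (rn1 n) e4.
pose p z := \sum_(j < N) (b j * (r n)%:C ^+ j) * mono j z.
exists p.
  exists N, (fun j => mono j), (fun j => b j * (r n)%:C ^+ j); split => //.
  by move=> j; exists j.
have Lp : L2_circle p by apply: L2_sum => j; exact/L2Z/L2_mono.
apply: le_lt_trans (norm2_triangle Lf (LF n) Lp) _.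
rewrite (splitr e) (norm2B Lf (LF n)); apply: ltrD => //.
apply: (@le_lt_trans _ _ (e / 2 / 2)); last by rewrite ltr_pdivrMr// ltr_pMr// ltr1n.
apply: norm2_le; [exact: ltW|exact: L2B|].
apply: aeT => t; rewrite /F /p.
have -> : \sum_(j < N) b j * (r n)%:C ^+ j * mono j (expi t) =
  \sum_(j < N) b j * ((r n)%:C * expi t) ^+ j.
  by apply: eq_bigr => j _; rewrite /mono exprMn mulrA.
apply: Hb; rewrite ComplexField.Normc.normcM normc_real normc_expi mulr1 ger0_norm//.
Qed.

End HardySpace.

(** * Operators on H^2 *)

Section HardyProjection.
Variable R : realType.
Local Notation C := R[i].
Local Notation "z ^*" := (Num.conj z) : complex_scope.
Local Notation mu := (arc_measure R).
Implicit Types (f h k p m a theta : C -> C).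

Definition monos : set (C -> C) := [set f | exists n : nat, f = mono n].

Lemma H2E : @H2 R = closureL2 (lin_span monos). Proof. by []. Qed.

Lemma monos_L2 p : lin_span monos p -> L2_circle p.
Proof. by apply: lin_span_L2 => _ [n ->]; exact: L2_mono. Qed.

Lemma H2_L2 f : H2 f -> L2_circle f. Proof. by case. Qed.

Lemma H2_lin (c : C) f h : H2 f -> H2 h -> H2 (fun z => c * f z + h z).
Proof.
by apply: closureL2_lin; [exact: monos_L2|move=> c' p q; exact: lin_span_lin].
Qed.

Lemma H2_mono n : H2 (@mono R n).
Proof.
rewrite H2E; apply: closureL2_sub; last exact: L2_mono.
by apply: lin_span_sub; exists n.
Qed.

Lemma H2_cst (c : C) : H2 (fun=> c).
Proof.
have := H2_lin (c - 1) (H2_mono 0) (H2_mono 0); congr H2; apply/funext => z.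
by rewrite /mono expr0 mulr1 subrK.
Qed.

Lemma H2Z (c : C) f : H2 f -> H2 (fun z => c * f z).
Proof.
move=> /(H2_lin c)/(_ (H2_cst 0)); congr H2.
by apply/funext => z; rewrite addr0.
Qed.

Lemma H2D f h : H2 f -> H2 h -> H2 (fun z => f z + h z).
Proof.
move=> Hf Hh; have := H2_lin 1 Hf Hh; congr H2.
by apply/funext => z; rewrite mul1r.
Qed.

Lemma H2B f h : H2 f -> H2 h -> H2 (fun z => f z - h z).
Proof.
move=> Hf Hh; have := H2_lin (-1) Hh Hf; congr H2.
by apply/funext => z; rewrite mulN1r addrC.
Qed.

Lemma H2_sum I (s : seq I) (F : I -> C -> C) : (forall i, H2 (F i)) ->
  H2 (fun z => \sum_(i <- s) F i z).
Proof.
move=> HF; elim: s => [|i s ih].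
  by under [X in H2 X]eq_fun do rewrite big_nil; exact: H2_cst.
by under [X in H2 X]eq_fun do rewrite big_cons; exact: H2D.
Qed.

Lemma H2_aeq f h : L2_circle h -> aeq f h -> H2 f -> H2 h.
Proof. by move=> Lh fh Hf; apply: (closureL2_aeq Lh fh Hf); exact: monos_L2. Qed.

Lemma closureL2_subset (A A' : set (C -> C)) : A `<=` A' -> closureL2 A `<=` closureL2 A'.
Proof. by move=> AA' f [Lf Af]; split=> // e /Af[p Ap pe]; exists p => //; exact: AA'. Qed.

Lemma H2_closed (A : set (C -> C)) : A `<=` @H2 R -> closureL2 A `<=` @H2 R.
Proof.
move=> AH f /(closureL2_subset AH); apply: closureL2_idem; exact: monos_L2.
Qed.

Lemma H2_orth f k : L2_circle k -> (forall n, inner_L2 (mono n) k = 0) -> H2 f ->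
  inner_L2 f k = 0.
Proof.
move=> Lk nk; apply: closure_orth => //; first exact: monos_L2.
by apply: lin_span_inner => // _ [n ->]; [exact: L2_mono|exact: nk].
Qed.

Lemma H2_eq0 f : H2 f -> (forall m, H2 m -> inner_L2 f m = 0) -> aeq f (fun=> 0).
Proof. by move=> Hf fm; apply: inner_eq0 (H2_L2 Hf) (fm _ Hf). Qed.

(** The image of a polynomial is in [H^2] by linearity, and boundedness carries this
    to limits. Inner multipliers and the backward shift are treated this way. *)
Lemma H2_map (T : (C -> C) -> C -> C) (K : R) :
  (forall f, L2_circle f -> L2_circle (T f)) ->
  (forall (c : C) f h, L2_circle f -> L2_circle h ->
    T (fun z => c * f z + h z) = (fun z => c * T f z + T h z)) ->
  (forall f, L2_circle f -> norm2 (T f) <= K * norm2 f) ->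
  (forall n, H2 (T (mono n))) -> forall f, H2 f -> H2 (T f).
Proof.
move=> TL Tlin TK Tm.
have T0 : T (fun=> 0) = fun=> 0.
  have := Tlin 1 _ _ (L2_cst 0) (L2_cst 0).
  rewrite (_ : (fun z : C => 1 * 0 + 0) = fun=> 0); last by apply/funext => z; rewrite mulr0 addr0.
  move=> E; apply/funext => z; have := congr1 (fun F => F z) E.
  rewrite mul1r => /eqP; rewrite -{1}[T _ z]addr0 (inj_eq (addrI _)) eq_sym.
  by move/eqP.
have Tspan p : lin_span monos p -> H2 (T p).
  move=> [m [w [c [Aw ->]]]].
  have Lw i : L2_circle (w i) by have [n ->] := Aw i; exact: L2_mono.
  suff : forall s : seq 'I_m, H2 (T (fun z => \sum_(i <- s) c i * w i z)) by move/(_ (index_enum _)).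
  elim=> [|i s ih].
    rewrite (_ : (fun z => _) = fun=> 0) ?T0; last by apply/funext => z; rewrite big_nil.
    exact: H2_cst.
  rewrite (_ : (fun z => _) = fun z => c i * w i z + \sum_(j <- s) c j * w j z); last first.
    by apply/funext => z; rewrite big_cons.
  rewrite Tlin//; last by apply: L2_sum => j; exact: L2Z.
  by apply: H2_lin => //; have [n ->] := Aw i.
move=> f [Lf Af]; apply: (@H2_closed (@H2 R)) => //; split; first exact: TL.
move=> e e0; have K1 : 0 < `|K| + 1 by rewrite ltr_wpDl.
have [p Ap pe] := Af _ (divr_gt0 e0 K1); exists (T p); first exact: Tspan.
have Lp := monos_L2 Ap.
have -> : T f \- T p = T (fun z => f z - p z).
  have := Tlin (-1) p f Lp Lf.
  rewrite (_ : (fun z => -1 * p z + f z) = fun z => f z - p z); last first.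
    by apply/funext => z; rewrite mulN1r addrC.
  by move=> ->; apply/funext => z; rewrite mulN1r addrC.
apply: le_lt_trans (TK _ (L2B Lf Lp)) _; move: pe; rewrite ltr_pdivlMr//.
apply: le_lt_trans; rewrite mulrC ler_wpM2l ?norm2_ge0//.
by rewrite (le_trans (ler_norm _))// lerDl.
Qed.

Lemma H2_mul a f : unimodular a -> (forall n, H2 (fun z => a z * mono n z)) ->
  H2 f -> H2 (fun z => a z * f z).
Proof.
move=> ua am; apply: (@H2_map (fun f z => a z * f z) 1) => //.
- by move=> h; exact: L2_unimodular.
- by move=> c h k _ _; apply/funext => z; ring.
- by move=> h Lh; rewrite mul1r norm2_unimodular.
Qed.

Lemma H2_shift f : H2 f -> H2 (fun z => z * f z).
Proof.
apply: (@H2_mul id); first exact: unimodular_id.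
by move=> n; have := H2_mono n.+1; congr H2; apply/funext => z; rewrite /mono exprS.
Qed.

Lemma H2_shiftn n f : H2 f -> H2 (fun z => mono n z * f z).
Proof.
elim: n => [|n ih] Hf.
  by move: Hf; congr H2; apply/funext => z; rewrite /mono expr0 mul1r.
have := H2_shift (ih Hf); congr H2; apply/funext => z.
by rewrite /mono exprS mulrA.
Qed.

Lemma H2_mul_inner theta f : unimodular theta -> H2 theta -> H2 f ->
  H2 (fun z => theta z * f z).
Proof.
move=> ut Ht; apply: H2_mul => // n; have := H2_shiftn n Ht; congr H2.
by apply/funext => z; rewrite mulrC.
Qed.

Lemma ortho_projP (M : set (C -> C)) f :
  (exists p, M p /\ forall m, M m -> inner_L2 (f \- p) m = 0) ->
  M (ortho_proj M f) /\ forall m, M m -> inner_L2 (f \- ortho_proj M f) m = 0.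
Proof.
move=> [p Pp].
exact: (@xgetPex _ (fun=> 0) [set p | M p /\ forall m, M m -> inner_L2 (f \- p) m = 0]
  (ex_intro _ p Pp)).
Qed.

Lemma H2_projP f : L2_circle f ->
  H2 (ortho_proj (@H2 R) f) /\
  forall m, H2 m -> inner_L2 (ortho_proj (@H2 R) f) m = inner_L2 f m.
Proof.
move=> Lf; have [p Hp pm] : exists2 p, H2 p & forall m, lin_span monos m ->
    inner_L2 (fun z => f z - p z) m = 0.
  apply: projection_exists Lf; first exact: monos_L2.
    by exists 0%N, (fun _ => fun=> 0), (fun=> 0); split; [case|apply/funext => z; rewrite big_ord0].
  by move=> c p q; exact: lin_span_lin.
have [|HP Pm] := @ortho_projP (@H2 R) f.
  exists p; split => // m Hm; have Lfp := L2B Lf (H2_L2 Hp).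
  rewrite (innerC (H2_L2 Hm) Lfp) (H2_orth Lfp _ Hm) ?rmorph0// => n.
  rewrite (innerC Lfp (L2_mono R n)) pm ?rmorph0//.
  by apply: lin_span_sub; exists n.
split=> // m Hm; have /eqP := Pm m Hm.
by rewrite innerBl ?subr_eq0 => [/eqP//|//||]; exact: H2_L2.
Qed.

Lemma H2_proj_id f h : L2_circle f -> aeq f h -> H2 h ->
  aeq (ortho_proj (@H2 R) f) h.
Proof.
move=> Lf fh Hh; have [Hp Pp] := H2_projP Lf.
suff d0 : aeq (fun z => ortho_proj (@H2 R) f z - h z) (fun=> 0).
  by apply: aeS d0 => t /eqP; rewrite subr_eq0 => /eqP.
have Lh := H2_L2 Hh; have Lp := H2_L2 Hp.
apply: H2_eq0 => [|m Hm]; first exact: H2B.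
have Lm := H2_L2 Hm; rewrite innerBl// Pp//.
by rewrite (inner_aeq Lf Lh Lm Lm fh (aeq_refl m)) subrr.
Qed.

Lemma L2_eqc f h : (forall t : R, f (expi t) = h (expi t)) -> L2_circle f -> L2_circle h.
Proof.
move=> fh Lf; have mh : cmeas h.
  have := L2_meas Lf; rewrite /cmeas (_ : circ f = circ h)//.
  by apply/funext => t; exact: fh.
by apply: (L2_aeq mh _ Lf); apply: aeT => t; exact: fh.
Qed.

Lemma L2J f : L2_circle f -> L2_circle (fun z => (f z)^*).
Proof.
move=> /L2P[mf sf]; apply/L2P; split; first exact: cmeasJ.
apply: eq_integrable sf => // t _; rewrite /comp; congr (_ ^+ 2)%:E.
by case: (f _) => x y /=; rewrite sqrrN.
Qed.

Lemma flipK f : flipJ (flipJ f) = f.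
Proof. by apply/funext => z; rewrite /flipJ conjcK. Qed.

Lemma flip_mono n : flipJ (@mono R n) = conjmono n. Proof. by []. Qed.

(** [J(z f)] has only negative frequencies. *)
Lemma inner_flip_H2 f h : H2 f -> H2 h ->
  inner_L2 (flipJ (fun z => z * f z)) h = 0.
Proof.
move=> Hf Hh; have Lf := H2_L2 Hf; have Lh := H2_L2 Hh.
have Lzf := H2_L2 (H2_shift Hf); have LJ := L2_flip Lh.
rewrite -[h in LHS]flipK (inner_flip Lzf LJ).
have -> : inner_L2 (fun z => z * f z) (flipJ h) = inner_L2 f (fun z => z^* * flipJ h z).
  exact: inner_mulJ.
have ucj : unimodular (fun z : C => z^*) by exact/unimodularJ/unimodular_id.
apply: H2_orth Hf; first exact: L2_unimodular.
move=> n; rewrite -inner_mulJ.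
rewrite -inner_flip//; last first.
  by apply: (L2_unimodular (f := id)); [exact: unimodular_id|exact: L2_mono].
rewrite flipK (_ : flipJ _ = conjmono n.+1); last first.
  by apply/funext => z; rewrite /flipJ /mono /conjmono exprS.
rewrite (innerC Lh (L2_conjmono R _)) (H2_orth (L2_conjmono R _) _ Hh) ?rmorph0// => j.
by rewrite inner_mono_conjmono addnS.
Qed.

Lemma disk_value0 f : disk_value f 0 = inner_L2 f (fun=> 1).
Proof.
rewrite /disk_value /inner_L2 /cintegral -!/(cint mu setT _); apply: eq_cint => t _.
by rewrite mul0r subr0 invr1 rmorph1.
Qed.

Lemma inner_1_1 : inner_L2 (fun=> 1 : C) (fun=> 1) = 1.
Proof. by rewrite inner_norm2 norm2_1 expr1n. Qed.

Lemma inner_shift_1 f : H2 f -> inner_L2 (fun z => z * f z) (fun=> 1) = 0.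
Proof.
move=> Hf; rewrite inner_mulJ; apply: H2_orth Hf.
  by apply: L2_unimodular (L2_cst 1); exact/unimodularJ/unimodular_id.
move=> n; transitivity (inner_L2 (mono n) (conjmono 1) : C).
  by congr inner_L2; apply/funext => z; rewrite /conjmono expr1 mulr1.
by rewrite inner_mono_conjmono addn1.
Qed.

Lemma backward_shiftE f : forall t : R,
  backward_shift f (expi t) = (expi t)^* * (f (expi t) - inner_L2 f (fun=> 1)).
Proof. by move=> t; rewrite /backward_shift disk_value0 expiJE mulrC. Qed.

Lemma H2_backward_shift f : H2 f -> H2 (backward_shift f).
Proof.
move=> Hf; pose T f : C -> C := fun z => z^* * (f z - inner_L2 f (fun=> 1)).
have ucj : unimodular (fun z : C => z^*) by exact/unimodularJ/unimodular_id.
have L1 := L2_cst (1 : C).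
have LT h : L2_circle h -> L2_circle (T h).
  by move=> Lh; apply: L2_unimodular => //; apply: L2B => //; exact: L2_cst.
have HT : H2 (T f).
  apply: (@H2_map T 2) Hf => //.
  - by move=> c h k Lh Lk; apply/funext => z; rewrite /T inner_linl//; ring.
  - move=> h Lh; rewrite /T norm2_unimodular//; last by apply: L2B => //; exact: L2_cst.
    have := norm2D Lh (L2_cst (- inner_L2 h (fun=> 1))).
    move=> /le_trans; apply; rewrite mulr2n mulrDl mul1r lerD2l.
    have := norm2Z (- inner_L2 h (fun=> 1)) L1; rewrite norm2_1 !mulr1 (@normcN R).
    by move=> ->; have := cauchy_schwarz Lh L1; rewrite norm2_1 mulr1.
  move=> [|n].
    apply: (H2_aeq _ _ (H2_cst 0)); first exact: LT (L2_mono R 0).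
    have E0 : @mono R 0 = fun=> 1 by apply/funext => z; rewrite /mono expr0.
    by apply: aeT => t; rewrite /T E0 inner_1_1 subrr mulr0.
  apply: (H2_aeq _ _ (H2_mono n)); first exact: LT (L2_mono R _).
  apply: aeT => t; rewrite /T.
  have -> : inner_L2 (@mono R n.+1) (fun=> 1) = 0.
    transitivity (inner_L2 (fun z : C => z * mono n z) (fun=> 1)).
      by congr (inner_L2 _ _); apply/funext => z; rewrite /mono exprS.
    exact: inner_shift_1 (H2_mono n).
  by rewrite subr0 /mono exprS mulrA [_^* * _]mulrC mul_expiJ mul1r.
apply: H2_aeq HT; last by apply: aeT => t; rewrite backward_shiftE.
by apply: L2_eqc (LT _ (H2_L2 Hf)) => t; rewrite backward_shiftE.
Qed.

(** The backward shift is the adjoint of the shift. *)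
Lemma inner_backward_shift f h : H2 f -> H2 h ->
  inner_L2 (backward_shift f) h = inner_L2 f (fun z => z * h z).
Proof.
move=> Hf Hh; have Lf := H2_L2 Hf; have Lh := H2_L2 Hh.
have ucj : unimodular (fun z : C => z^*) by exact/unimodularJ/unimodular_id.
have Lfa : L2_circle (fun z => f z - inner_L2 f (fun=> 1)) by apply: L2B => //; exact: L2_cst.
have Lzh := H2_L2 (H2_shift Hh).
rewrite (inner_aeq (f' := fun z => z^* * (f z - inner_L2 f (fun=> 1))) (h' := h) _ _ Lh Lh _ (aeq_refl h)).
- rewrite inner_mulJ (_ : (fun z => z^*^* * h z) = fun z => z * h z); last first.
    by apply/funext => z; rewrite conjCK.
  rewrite innerBl//; last exact: L2_cst.
  rewrite (_ : inner_L2 (fun=> inner_L2 f (fun=> 1)) (fun z => z * h z) = 0) ?subr0//.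
  rewrite (innerC Lzh (L2_cst _)).
  have -> : (fun=> inner_L2 f (fun=> 1)) = (fun z => inner_L2 f (fun=> 1) * (fun=> 1 : C) z) :> (C -> C).
    by apply/funext => z; rewrite mulr1.
  by rewrite (innerZr _ (L2_cst 1) Lzh) inner_shift_1// mulr0 conjC0.
- exact/H2_L2/H2_backward_shift.
- exact: L2_unimodular.
by apply: aeT => t; exact: backward_shiftE.
Qed.

(** Frequencies of [f] are nonnegative, and those of [h = conj f] too, so only
    frequency [0] remains. *)
Lemma H2_conj_const f h : H2 f -> H2 h -> aeq (fun z => (f z)^*) h ->
  aeq f (fun=> inner_L2 f (fun=> 1)).
Proof.
move=> Hf Hh fh; have Lf := H2_L2 Hf; have Lh := H2_L2 Hh; set a := inner_L2 f _.
pose d z := f z - a; have Hd : H2 d by apply: H2B => //; exact: H2_cst.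
have Ld := H2_L2 Hd.
suff d0 : inner_L2 d d = 0.
  by apply: aeS (inner_eq0 Ld d0) => t /eqP; rewrite subr_eq0 => /eqP.
apply: (H2_orth Ld _ Hd) => n.
have L1 := L2_cst (1 : C); have Ln := @L2_mono R n.
rewrite /d innerBr//; last exact: L2_cst.
have -> : inner_L2 (mono n) (fun=> a) = a^* * inner_L2 (mono n) (fun=> 1).
  rewrite -innerZr//; congr inner_L2; by apply/funext => z; rewrite mulr1.
have Emono : inner_L2 (@mono R n) (fun=> 1) = (n == 0)%N%:R.
  transitivity (inner_L2 (mono n) (conjmono 0) : C).
    by congr inner_L2; apply/funext => z; rewrite /conjmono expr0.
  by rewrite inner_mono_conjmono addn0.
have Ef : inner_L2 (mono n) f = inner_L2 h (conjmono n).
  rewrite -(inner_aeq (L2J Lf) Lh (L2_conjmono R n) (L2_conjmono R n) fh (aeq_refl _)).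
  rewrite /inner_L2 /cintegral -!/(cint mu setT _); apply: eq_cint => t _.
  by rewrite /conjmono /mono -rmorphXn/= conjCK mulrC.
rewrite Emono; case: n Ln Emono Ef => [|n] Ln Emono Ef /=.
  rewrite mulr1 /a (_ : mono 0 = fun=> 1); last by apply/funext => z; rewrite /mono expr0.
  by rewrite (innerC Lf L1) subrr.
rewrite mulr0 subr0 Ef; apply: (H2_orth (L2_conjmono R _) _ Hh) => j.
by rewrite inner_mono_conjmono addnS.
Qed.

End HardyProjection.

(** * Gram-Schmidt orthogonalisation *)

Section GramSchmidt.
Variable R : realType.
Local Notation C := R[i].
Implicit Types (f h : C -> C).

Definition orthonormal_upto d (e : nat -> C -> C) :=
  forall i j, (i < d)%N -> (j < d)%N -> inner_L2 (e i) (e j) = (i == j)%:R.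

(** The family [G] may be dependent, whence a number [d] of vectors below [N]. The
    output is indexed by all of [nat] to make the induction free of casts; only
    the indices below [d] carry information. *)
Lemma gram_schmidt (A : set (C -> C)) N (G : 'I_N -> C -> C) :
  (forall p, A p -> L2_circle p) -> (forall i, A (G i)) ->
  exists d (e : nat -> C -> C), [/\ (d <= N)%N, forall i, lin_span A (e i),
    orthonormal_upto d e &
    forall i, aeq (G i) (fun z => \sum_(j < d) inner_L2 (G i) (e j) * e j z)].
Proof.
move=> AL; elim: N G => [|N ih] G AG.
  exists 0%N, (fun _ => fun=> 0); split=> //; last by case.
  by move=> _; exists 0%N, (fun _ => fun=> 0), (fun=> 0); split; [case|apply/funext => z; rewrite big_ord0].
have [d [e [dN Ae oe Ge]]] := ih (fun i => G (lift ord_max i)) (fun i => AG _).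
have Le i : L2_circle (e i) by exact: (lin_span_L2 AL).
have LG i : L2_circle (G i) by exact: AL.
pose g := G ord_max; have Lg : L2_circle g by exact: LG.
pose P z := \sum_(j < d) inner_L2 g (e j) * e j z.
have LP : L2_circle P by apply: L2_sum => j; exact: L2Z.
pose r z := g z - P z; have Lr : L2_circle r by exact: L2B.
have re j : (j < d)%N -> inner_L2 r (e j) = 0.
  move=> jd; rewrite innerBl// inner_suml//; last by move=> i; exact: L2Z.
  rewrite (bigD1 (Ordinal jd))//= innerZl// oe// eqxx mulr1 big1 ?addr0 ?subrr// => i ij.
  by rewrite innerZl// oe// (_ : (i : nat) == j = false) ?mulr0//; apply: negbTE ij.
have Gcase (Q : 'I_N.+1 -> Prop) : (forall i, Q (lift ord_max i)) -> Q ord_max -> forall i, Q i.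
  by move=> Q1 Q2 i; case: (unliftP ord_max i) => [j|] ->.
have [r0|r0] := eqVneq (norm2 r) 0.
  exists d, e; split => //; first exact: leqW.
  apply: Gcase => //.
  by apply: aeS (norm2_eq0 Lr r0) => t /eqP; rewrite subr_eq0 => /eqP.
pose e' i := if (i < d)%N then e i else (fun z => ((norm2 r)^-1)%:C * r z).
have Ar : lin_span A r.
  have -> : r = (fun z => (-1) * P z + g z) by apply/funext => z; rewrite mulN1r addrC.
  by apply: lin_span_lin; [exact: lin_span_sum|exact: lin_span_sub (AG ord_max)].
have e'd : e' d = (fun z => ((norm2 r)^-1)%:C * r z) by rewrite /e' ltnn.
have e'l j : (j < d)%N -> e' j = e j by rewrite /e' => ->.
have rr : inner_L2 r r = (norm2 r ^+ 2)%:C by exact: inner_norm2.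
have Jreal (x : R) : Num.conj (x%:C) = x%:C by exact: conjc_real.
exists d.+1, e'; split.
- by [].
- move=> i; rewrite /e'; case: ifP => // _.
  have := lin_span_lin ((norm2 r)^-1)%:C Ar (lin_span_sum (d := 0) (w := fun _ => r) (fun=> 0) (fun _ => Ar)).
  by congr lin_span; apply/funext => z; rewrite big_ord0 addr0.
- have lt_or i : (i < d.+1)%N -> i = d \/ (i < d)%N.
    by rewrite ltnS leq_eqVlt => /orP[/eqP|]; [left|right].
  move=> i j /lt_or[->|id] /lt_or[->|jd].
  + rewrite e'd innerZl//; last exact: L2Z.
    rewrite innerZr// rr Jreal eqxx -!rmorphM/= (_ : _ * _ = 1)//.
    by field.
  + by rewrite e'd e'l// innerZl// re// mulr0 gtn_eqF.
  + rewrite e'd e'l// innerZr// (innerC Lr (Le _)) re// rmorph0 mulr0.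
    by rewrite (_ : i == d = false)//; apply: ltn_eqF.
  + by rewrite !e'l// oe.
apply: Gcase => [i|].
  have Gr : inner_L2 (G (lift ord_max i)) r = 0.
    have LS : L2_circle (fun z => \sum_(j < d) inner_L2 (G (lift ord_max i)) (e j) * e j z).
      by apply: L2_sum => j; exact: L2Z.
    rewrite (inner_aeq (LG _) LS Lr Lr (Ge i) (aeq_refl r)) inner_suml//; last by move=> j; exact: L2Z.
    apply: big1 => j _; rewrite innerZl// (innerC Lr (Le _)) re//.
    by rewrite conjC0 mulr0.
  apply: aeS (Ge i) => t ->; rewrite big_ord_recr /= e'd innerZr// Gr mulr0 mul0r addr0.
  by apply: eq_bigr => j _; rewrite e'l.
rewrite -/g; apply: aeT => t; rewrite big_ord_recr /= e'd innerZr//.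
have -> : inner_L2 g r = (norm2 r ^+ 2)%:C.
  rewrite -rr; have -> : inner_L2 r r = inner_L2 g r - inner_L2 P r by rewrite -innerBl.
  rewrite (_ : inner_L2 P r = 0) ?subr0// inner_suml//; last by move=> j; exact: L2Z.
  by apply: big1 => j _; rewrite innerZl// (innerC Lr (Le _)) re// conjC0 mulr0.
rewrite Jreal (eq_bigr (fun j : 'I_d => inner_L2 g (e j) * e j (expi t))); last first.
  by move=> j _; rewrite e'l.
rewrite -/(P (expi t)) mulrA -!rmorphM/= (_ : _^-1 * _ / _ = 1) ?mul1r; last by field.
by rewrite /r addrC subrK.
Qed.

End GramSchmidt.

(** * The subspace z theta H^2 and its complement *)

Section Inner.
Variable R : realType.
Local Notation C := R[i].
Local Notation "z ^*" := (Num.conj z) : complex_scope.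
Local Notation mu := (arc_measure R).
Implicit Types (f h m y : C -> C).
Variable theta : C -> C.
Hypothesis ut : unimodular theta.
Hypothesis Ht : H2 theta.

Let utJ : unimodular (fun z => (theta z)^*) := unimodularJ ut.

(** An isometry with range [z theta H^2] on [H^2]. *)
Definition shift_mul f : C -> C := fun z => z * (theta z * f z).

Lemma H2_shift_mul f : H2 f -> H2 (shift_mul f).
Proof. by move=> Hf; apply/H2_shift/H2_mul_inner. Qed.

Lemma inner_shift_mul f h : L2_circle f -> L2_circle h ->
  inner_L2 (shift_mul f) (shift_mul h) = inner_L2 f h.
Proof.
move=> Lf Lh; rewrite (inner_unimodular (@unimodular_id R)); first exact: inner_unimodular.
  exact: L2_unimodular.
exact: L2_unimodular.
Qed.

(** The projection onto [z theta H^2] is [M P M^*] where [M] is [shift_mul]. *)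
Lemma shift_mul_proj f : L2_circle f -> exists2 y, H2 y &
  forall h, H2 h -> inner_L2 (fun z => f z - shift_mul y z) (shift_mul h) = 0.
Proof.
move=> Lf; have ucj : unimodular (fun z : C => z^*) by exact/unimodularJ/unimodular_id.
pose k z := (theta z)^* * (z^* * f z).
have Lk : L2_circle k by apply: L2_unimodular => //; exact: L2_unimodular.
have [Hy Py] := H2_projP Lk; exists (ortho_proj (@H2 R) k) => // h Hh.
have Lh := H2_L2 Hh; have Ly := H2_L2 Hy.
have Lzy := H2_L2 (H2_shift_mul Hy); have Lzh := H2_L2 (H2_shift_mul Hh).
rewrite innerBl// inner_shift_mul// Py//; apply/eqP; rewrite subr_eq0; apply/eqP.
transitivity (inner_L2 f (fun z => (z^*)^* * (((theta z)^*)^* * h z))).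
  by congr inner_L2; apply/funext => z; rewrite !conjCK.
by rewrite -inner_mulJ -inner_mulJ.
Qed.

(** The Hankel operator with symbol [conj theta] is the projection of this unitary
    to [H^2]. *)
Definition prehankel f : C -> C := flipJ (fun z => (theta z)^* * f z).

Lemma prehankel_L2 f : L2_circle f -> L2_circle (prehankel f).
Proof. by move=> Lf; apply/L2_flip/L2_unimodular. Qed.

Lemma inner_prehankel f m : L2_circle f -> L2_circle m ->
  inner_L2 (prehankel f) m = inner_L2 f (fun z => theta z * flipJ m z).
Proof.
move=> Lf Lm; rewrite /prehankel -[m in LHS]flipK inner_flip; last exact: L2_flip.
  by rewrite inner_mulJ; congr inner_L2; apply/funext => z; rewrite conjCK.
exact: L2_unimodular.
Qed.

(** Let [r] be the part of [s = J(conj theta m)] orthogonal to [H^2]. All its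
    frequencies vanish: the negative ones are pairings of [m] with [z theta z^n].
    Approximating [m] and [theta] by polynomials reduces [<s, r> = <m, theta J r>] to such
    frequencies, so [<r, r> = <s, r> = 0]. *)
Lemma prehankel_model_H2 m : H2 m -> (forall y, H2 y -> inner_L2 m (shift_mul y) = 0) -> H2 (prehankel m).
Proof.
move=> Hm mo; have Lm := H2_L2 Hm; set s := prehankel m; have Ls : L2_circle s by exact: prehankel_L2.
have [Hp Pp] := H2_projP Ls; set p := ortho_proj _ s in Hp Pp.
have Lp := H2_L2 Hp; pose r z := s z - p z; have Lr : L2_circle r by exact: L2B.
have rH h : H2 h -> inner_L2 r h = 0.
  by move=> Hh; rewrite innerBl ?Pp ?subrr//; exact: H2_L2.
have Lcm n : L2_circle (@conjmono R n) by exact: L2_conjmono.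
have Lmo n : L2_circle (@mono R n) by exact: L2_mono.
have rc n : inner_L2 r (conjmono n.+1) = 0.
  rewrite innerBl// (H2_orth (Lcm _) _ Hp) ?subr0; last first.
    by move=> j; rewrite inner_mono_conjmono addnS.
  rewrite inner_prehankel// -(mo (mono n)); last exact: H2_mono.
  congr inner_L2; apply/funext => z; rewrite /shift_mul -flip_mono flipK /mono exprS.
  by rewrite mulrCA.
have rr : inner_L2 r r = 0.
  have -> : inner_L2 r r = inner_L2 r s.
    transitivity (inner_L2 r s - inner_L2 r p); last by rewrite (rH p Hp) subr0.
    exact: innerBr.
  rewrite (innerC Ls Lr) inner_prehankel//.
  have LJr := L2_flip Lr; have LtJ := L2_unimodular ut LJr.
  rewrite (H2_orth LtJ _ Hm) ?conjC0// => n.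
  have E : inner_L2 (mono n) (fun z => theta z * flipJ r z) =
    (inner_L2 theta (fun z => mono n z * (flipJ r z)^*))^*.
    have Lx : L2_circle (fun z => mono n z * (flipJ r z)^*).
      by apply: L2_unimodular; [exact: unimodular_mono|exact: L2J].
    rewrite -(innerC (H2_L2 Ht) Lx).
    rewrite /inner_L2 /cintegral -!/(cint mu setT _); apply: eq_cint => t _.
    by rewrite rmorphM/= mulrCA mulrC.
  rewrite E (H2_orth _ _ Ht) ?conjC0//.
    by apply: L2_unimodular; [exact: unimodular_mono|exact: L2J].
  move=> j.
  have -> : inner_L2 (mono j) (fun z => mono n z * (flipJ r z)^*) =
     inner_L2 (flipJ r) (fun z => (mono j z)^* * mono n z).
    rewrite /inner_L2 /cintegral -!/(cint mu setT _); apply: eq_cint => t _.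
    by rewrite !rmorphM/= !conjCK mulrA mulrC.
  have Ljn : L2_circle (fun z : C => (mono j z)^* * mono n z).
    by apply: L2_unimodular; [exact/unimodularJ/unimodular_mono|exact: L2_mono].
  rewrite -(inner_flip LJr Ljn) flipK.
  have LF := L2_flip Ljn.
  have expiX (t : R) k : expi t ^+ k * (expi t)^* ^+ k = 1 :> C by rewrite -exprMn mul_expiJ expr1n.
  have [nj|jn] := leqP n j.
    rewrite -(rH _ (H2_mono R (j - n))); apply: inner_aeq => //; first exact: aeq_refl.
    apply: aeT => t; rewrite /flipJ /mono.
    change (((expi t)^* ^+ j)^* * (expi t)^* ^+ n = expi t ^+ (j - n)).
    by rewrite rmorphXn /= conjCK -{1}(subnK nj) exprD -mulrA expiX mulr1.
  rewrite -(rc (n - j.+1)%N); apply: inner_aeq => //; first exact: aeq_refl.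
  apply: aeT => t; rewrite /flipJ /mono /conjmono -subSn// subSS.
  change (((expi t)^* ^+ j)^* * (expi t)^* ^+ n = (expi t)^* ^+ (n - j)).
  by rewrite rmorphXn /= conjCK -{1}(subnKC (ltnW jn)) exprD mulrA expiX mul1r.
apply: (H2_aeq Ls _ Hp); apply: aeq_sym.
by apply: aeS (inner_eq0 Lr rr) => t /eqP; rewrite subr_eq0 => /eqP.
Qed.

(** [J(conj theta z theta y) = J(z y)] on the circle. *)
Lemma inner_prehankel_shift_mul y h : H2 y -> H2 h -> inner_L2 (prehankel (shift_mul y)) h = 0.
Proof.
move=> Hy Hh; rewrite -(inner_flip_H2 Hy Hh); have Lh := H2_L2 Hh.
have Lzy := H2_L2 (H2_shift_mul Hy); have Lsy := H2_L2 (H2_shift Hy).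
apply: inner_aeq => //; [exact: prehankel_L2|exact: L2_flip| |exact: aeq_refl].
apply: aeq_flip; apply: aeS (unimodular_mulJ ut) => t t1.
rewrite /shift_mul; set x := expi t in t1 *.
by rewrite mulrCA; congr (x * _); rewrite mulrA [X in X * _]mulrC t1 mul1r.
Qed.

End Inner.

(** * Finite spans and defects *)

Section Kernel.
Variable R : realType.
Local Notation C := R[i].
Local Notation "z ^*" := (Num.conj z) : complex_scope.
Implicit Types (f h m y : C -> C).

(** The shape that [subspace_of_dim] asks for. *)
Definition span_ae d (e : 'I_d -> C -> C) : set (C -> C) :=
  [set f | H2 f /\ exists c : 'I_d -> C, aeq f (fun z => \sum_(i < d) c i * e i z)].

Section SpanAe.
Variables (d : nat) (e : 'I_d -> C -> C).

Lemma span_ae0 : span_ae e (fun=> 0).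
Proof.
split; first exact: H2_cst.
exists (fun=> 0); apply: aeT => t; rewrite big1// => i _; exact: mul0r.
Qed.

Lemma span_ae_lin (c : C) f h : span_ae e f -> span_ae e h ->
  span_ae e (fun z => c * f z + h z).
Proof.
move=> [Hf [a fa]] [Hh [b hb]]; split; first exact: H2_lin.
exists (fun i => c * a i + b i); apply: aeS2 fa hb => t -> ->.
rewrite mulr_sumr -big_split; apply: eq_bigr => i _ /=.
by rewrite mulrDl mulrA.
Qed.

Lemma span_ae_sum I (s : seq I) (c : I -> C) (F : I -> C -> C) :
  (forall i, span_ae e (F i)) -> span_ae e (fun z => \sum_(i <- s) c i * F i z).
Proof.
move=> HF; elim: s => [|i s ih].
  by under [X in span_ae e X]eq_fun do rewrite big_nil; exact: span_ae0.
by under [X in span_ae e X]eq_fun do rewrite big_cons; exact: span_ae_lin.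
Qed.

Lemma span_ae_aeq f h : H2 h -> aeq h f -> span_ae e f -> span_ae e h.
Proof. by move=> Hh hf [_ [c fc]]; split=> //; exists c; exact: aeq_trans fc. Qed.

Lemma orthonormal_free : (forall i, L2_circle (e i)) -> orthonormal_family e ->
  free_family e.
Proof.
move=> Le oe c c0 i.
have Lce j : L2_circle (fun z => c j * e j z) by exact: L2Z.
have LS : L2_circle (fun z => \sum_(j < d) c j * e j z) by exact: L2_sum.
have L0 := L2_cst (0 : C).
have := inner_aeq LS L0 (Le i) (Le i) c0 (aeq_refl _).
rewrite inner_suml// (bigD1 i)//= innerZl// oe eqxx mulr1 big1 ?addr0; last first.
  by move=> j ji; rewrite innerZl// oe (negbTE ji) mulr0.
by move=> ->; exact: inner0l.
Qed.

Lemma span_ae_dim : (forall i, H2 (e i)) -> orthonormal_family e ->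
  subspace_of_dim d (span_ae e).
Proof.
move=> He oe; exists e; split=> //.
by apply: orthonormal_free oe => i; exact: H2_L2.
Qed.

Lemma span_ae_cspan (A : set (C -> C)) : (forall p, A p -> L2_circle p) ->
  (forall i, lin_span A (e i)) -> span_ae e `<=` cspan A.
Proof.
move=> AL Ae f [Hf [c fc]]; have Lf := H2_L2 Hf.
have As : lin_span A (fun z => \sum_(i < d) c i * e i z) by exact: lin_span_sum.
apply: (closureL2_aeq Lf (aeq_sym fc)); last exact: lin_span_L2.
by apply: closureL2_sub => //; exact: (lin_span_L2 AL).
Qed.

End SpanAe.

Lemma lin_span_span_ae d (e : 'I_d -> C -> C) (A : set (C -> C)) :
  A `<=` span_ae e -> lin_span A `<=` span_ae e.
Proof. by move=> Ae p [m [w [c [Aw ->]]]]; apply: span_ae_sum => i; exact/Ae/Aw. Qed.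

Lemma least_defect (K : set (C -> C)) d F : defect_space K d F ->
  exists2 d', has_defect K d' & (d' <= d)%N.
Proof.
move=> KF; have ex : exists d, `[< exists F, defect_space K d F >].
  by exists d; apply/asboolP; exists F.
case: (ex_minnP ex) => d' /asboolP Kd' mind'; exists d'.
  by split=> // e F' KF'; apply: mind'; apply/asboolP; exists F'.
by apply: mind'; apply/asboolP; exists F.
Qed.

(** * Kernels of finite rank perturbations of Hankel operators *)

Section Perturbation.
Variables (theta g gt : C -> C) (gamma : C).
Hypothesis ut : unimodular theta.
Hypothesis Ht : H2 theta.
Hypotheses (mg : cmeas g) (mgt : cmeas gt).
Hypothesis gamma0 : gamma != 0.
Hypothesis gE : aeq g (fun=> gamma).
Hypothesis gtE : aeq gt (fun=> gamma^-1).
Variables (n : nat) (u v : 'I_n -> C -> C).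
Hypothesis Hu : forall i, H2 (u i).
Hypothesis Hv : forall i, H2 (v i).

Let phi : C -> C := fun z => (theta z)^* * g z.
Local Notation ztheta := (shift_mul theta).
Local Notation Tt := (prehankel theta).

Let utJ : unimodular (fun z => (theta z)^*) := unimodularJ ut.
Let Lu i : L2_circle (u i) := H2_L2 (Hu i).
Let Lv i : L2_circle (v i) := H2_L2 (Hv i).

Lemma phiE f : aeq (phi \* f) (fun z => gamma * ((theta z)^* * f z)).
Proof. by apply: aeS gE => t gt0; rewrite /phi /= gt0; ring. Qed.

Lemma phi_L2 f : L2_circle f -> L2_circle (phi \* f).
Proof.
move=> Lf; apply: (L2_aeq _ (aeq_sym (phiE f))); last exact/L2Z/L2_unimodular.
apply: cmeasM; last exact: L2_meas.
by apply: cmeasM => //; case: utJ.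
Qed.

Lemma hankel_phiP f : L2_circle f -> H2 (hankel phi f) /\
  forall m, H2 m -> inner_L2 (hankel phi f) m = gamma * inner_L2 (Tt f) m.
Proof.
move=> Lf; have Lp := phi_L2 Lf; have LT := prehankel_L2 ut Lf.
have [Hp Pp] := H2_projP (L2_flip Lp); split=> // m Hm.
rewrite [LHS]Pp// -innerZl//; last exact: H2_L2.
apply: inner_aeq; [exact: L2_flip|exact: L2Z|exact: H2_L2|exact: H2_L2| |exact: aeq_refl].
exact: (aeq_flip (phiE f)).
Qed.

Lemma H2_perturbation h : L2_circle h -> H2 (hankel_perturbation phi u v h).
Proof.
move=> Lh; apply: H2D; first by have [] := hankel_phiP Lh.
by apply: H2_sum => i; exact: H2Z.
Qed.

(** The adjoint of the perturbed operator, before projection to [H^2]. With it the kernel becomes the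
    orthogonal complement of a set, which makes closedness immediate. *)
Definition adjR m : C -> C := fun z =>
  gamma^* * (theta z * flipJ m z) + \sum_(i < n) (inner_L2 (v i) m)^* * u i z.

Lemma adjR_L2 m : L2_circle m -> L2_circle (adjR m).
Proof.
move=> Lm; apply: L2D; first by apply/L2Z/L2_unimodular => //; exact: L2_flip.
by apply: L2_sum => i; exact: L2Z.
Qed.

Lemma inner_adjR h m : L2_circle h -> L2_circle m -> inner_L2 h (adjR m) =
  gamma * inner_L2 (Tt h) m + \sum_(i < n) inner_L2 h (u i) * inner_L2 (v i) m.
Proof.
move=> Lh Lm.
have Ltm : L2_circle (fun z => theta z * flipJ m z) by apply: L2_unimodular => //; exact: L2_flip.
have Lui i : L2_circle (fun z => (inner_L2 (v i) m)^* * u i z) by exact: L2Z.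
rewrite innerDr//; [|exact: L2Z|exact: L2_sum].
rewrite innerZr// conjCK -inner_prehankel//; congr (_ + _).
by rewrite inner_sumr//; apply: eq_bigr => i _; rewrite innerZr// conjCK mulrC.
Qed.

Lemma inner_perturbation h m : H2 h -> H2 m ->
  inner_L2 (hankel_perturbation phi u v h) m = inner_L2 h (adjR m).
Proof.
move=> Hh Hm; have Lh := H2_L2 Hh; have Lm := H2_L2 Hm.
have [Hp Pp] := hankel_phiP Lh; have Lp := H2_L2 Hp.
have Lvi i : L2_circle (fun z => inner_L2 h (u i) * v i z) by exact: L2Z.
rewrite inner_adjR// [LHS]innerDl//; last exact: L2_sum.
rewrite Pp// inner_suml//; congr (_ + _).
by apply: eq_bigr => i _; rewrite innerZl.
Qed.

Local Notation K := (op_ker (hankel_perturbation phi u v)).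

Lemma kerP h : K h <-> H2 h /\ forall m, H2 m -> inner_L2 h (adjR m) = 0.
Proof.
split=> [[Hh Rh]|[Hh hm]]; split=> //.
  move=> m Hm; rewrite -inner_perturbation//.
  have Lm := H2_L2 Hm; have LR := H2_L2 (H2_perturbation (H2_L2 Hh)).
  rewrite (inner_aeq LR (L2_cst 0) Lm Lm Rh (aeq_refl m)).
  exact: inner0l.
apply: H2_eq0 => [|m Hm]; first exact/H2_perturbation/H2_L2.
by rewrite inner_perturbation// hm.
Qed.

Lemma ker_closed : closed_subspace K.
Proof.
split=> [h []//||c f h /kerP[Hf fm] /kerP[Hh hm]|h Kh].
- apply/kerP; split=> [|m Hm]; first exact: H2_cst.
  have La := adjR_L2 (H2_L2 Hm).
  exact: inner0l.
- apply/kerP; split=> [|m Hm]; first exact: H2_lin.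
  rewrite inner_linl ?fm ?hm ?mulr0 ?addr0//; [exact: H2_L2|exact: H2_L2|].
  exact/adjR_L2/H2_L2.
apply/kerP; split; first by apply: H2_closed Kh => f [].
move=> m Hm; apply: (closure_orth _ _ _ Kh); first exact/adjR_L2/H2_L2.
  by move=> p [/H2_L2].
by move=> p /kerP[_ /(_ _ Hm)].
Qed.

Let f1 i := hankel (flipJ theta \* flipJ gt) (backward_shift (v i)).

(** Up to null sets the symbol is [gamma^-1] times the flip of [theta]. *)
Lemma hankel_defectP i : H2 (f1 i) /\ forall m, H2 m ->
  inner_L2 (f1 i) m =
  gamma^-1 * inner_L2 (fun z => theta z * flipJ (backward_shift (v i)) z) m.
Proof.
have Hb := H2_backward_shift (Hv i); have Lb := H2_L2 Hb.
set b := backward_shift (v i) in Hb Lb *.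
have Ltb : L2_circle (fun z => theta z * flipJ b z) by apply: L2_unimodular => //; exact: L2_flip.
have E : aeq (fun z => gamma^-1 * (theta z * flipJ b z))
    (flipJ ((flipJ theta \* flipJ gt) \* b)).
  apply: aeS gtE => t gtt.
  change (gamma^-1 * (theta (expi t) * flipJ b (expi t)) =
    theta (conjc (conjc (expi t))) * gt (conjc (conjc (expi t))) * flipJ b (expi t)).
  by rewrite !conjcK gtt; ring.
have LF : L2_circle (flipJ ((flipJ theta \* flipJ gt) \* b)).
  apply: (L2_aeq _ E); last exact: L2Z.
  apply/cmeas_flip/cmeasM; last exact: L2_meas.
  by apply: cmeasM; apply: cmeas_flip => //; case: ut.
have [Hp Pp] := H2_projP LF; split=> // m Hm; have Lm := H2_L2 Hm.
rewrite [LHS]Pp// -innerZl//; apply: inner_aeq => //; [exact: L2Z|exact: aeq_sym|exact: aeq_refl].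
Qed.

Let q i := ortho_proj (mul_space theta (@H2 R)) (g \* u i).
Let r i : C -> C :=
  fun z => q i z - inner_L2 (fun x => q i x / theta x) (fun=> 1) * theta z.
Let f2 i := toeplitz gt (r i).

Lemma g_L2 f : L2_circle f -> L2_circle (g \* f).
Proof.
move=> Lf; apply: (L2_aeq _ _ (L2Z gamma Lf)); first by apply: cmeasM => //; exact: L2_meas.
by apply: aeS gE => t /= ->.
Qed.

(** The projection onto [theta H^2] is [theta P (conj theta f)]. *)
Lemma mul_spaceP f : L2_circle f -> let p := ortho_proj (mul_space theta (@H2 R)) f in
  mul_space theta (@H2 R) p /\
  forall y, H2 y -> inner_L2 p (fun z => theta z * y z) = inner_L2 f (fun z => theta z * y z).
Proof.
move=> Lf p; pose k z := (theta z)^* * f z; have Lk : L2_circle k by exact: L2_unimodular.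
have Lth y : H2 y -> L2_circle (fun z => theta z * y z).
  by move=> /H2_L2; exact: L2_unimodular.
have [Hk Pk] := H2_projP Lk.
have [|[Lp Mp] Pp] := @ortho_projP R (mul_space theta (@H2 R)) f.
  exists (fun z => theta z * ortho_proj (@H2 R) k z); split.
    by split; [exact: Lth|exists (ortho_proj (@H2 R) k) => //; exact: aeq_refl].
  move=> m [Lm [y Hy my]]; have Ly := H2_L2 Hy.
  have LB : L2_circle (fun z => f z - theta z * ortho_proj (@H2 R) k z) by apply: L2B => //; exact: Lth.
  rewrite (inner_aeq LB LB Lm (Lth y Hy) (aeq_refl _) my) innerBl//; [|exact: Lth|exact: Lth].
  rewrite (inner_unimodular ut (H2_L2 Hk) Ly) Pk// /k inner_mulJ.
  rewrite (_ : (fun z => ((theta z)^*)^* * y z) = fun z => theta z * y z) ?subrr//.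
  by apply/funext => z; rewrite conjCK.
split=> // y Hy; have My : mul_space theta (@H2 R) (fun z => theta z * y z).
  by split; [exact: Lth|exists y => //; exact: aeq_refl].
have := Pp _ My; rewrite innerBl//; last exact: Lth.
by move/eqP; rewrite subr_eq0 => /eqP ->.
Qed.

(** The projection [q i] equals [theta y], and [<q i / theta, 1>] is the value of [y] at the
    origin; subtracting it leaves [z theta] times the backward shift of [y]. Thus [f2 i]
    is the orthogonal projection of [u i] onto [z theta H^2]. *)
Lemma toeplitz_defectP i : exists y, [/\ H2 y, H2 (f2 i),
  aeq (f2 i) (fun z => gamma^-1 * ztheta y z) &
  forall Y, H2 Y -> inner_L2 (f2 i) (ztheta Y) = inner_L2 (u i) (ztheta Y)].
Proof.
have Lgu := g_L2 (Lu i).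
have [[Lq [y Hy qy]] Pq] := mul_spaceP Lgu; rewrite -/(q i) in Lq qy Pq.
have Ly := H2_L2 Hy; have L1 := L2_cst (1 : C).
set b := inner_L2 y (fun=> 1).
have qth : aeq y (fun x => q i x / theta x).
  apply: aeS2 qy (unimodular_mulJ ut) => t -> /= t1.
  have th0 : theta (expi t) != 0.
    by apply: contra_eq_neq t1 => ->; rewrite mul0r eq_sym oner_eq0.
  by rewrite [theta _ * _]mulrC mulfK.
have bE : inner_L2 (fun x => q i x / theta x) (fun=> 1) = b.
  have mq : cmeas (fun x => q i x / theta x).
    by apply: cmeasM; [exact: L2_meas|apply: cmeasV; case: ut].
  by apply: inner_aeq => //; [exact: (L2_aeq mq qth)|exact: aeq_sym|exact: aeq_refl].
pose y' := backward_shift y; have Hy' : H2 y' by exact: H2_backward_shift.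
have rE : aeq (r i) (ztheta y').
  apply: aeS2 qy (unimodular_mulJ ut) => t qyt _.
  rewrite /r bE qyt /shift_mul /y' backward_shiftE -/b /=.
  transitivity (theta (expi t) * ((expi t * (expi t)^*) * (y (expi t) - b))); last by ring.
  by rewrite mul_expiJ mul1r; ring.
have Lr : L2_circle (r i).
  by apply: L2B => //; apply: L2Z; exact: H2_L2.
have grE : aeq (gt \* r i) (fun z => gamma^-1 * ztheta y' z).
  by apply: aeS2 gtE rE => t /= -> ->.
have Hzy' : H2 (ztheta y') by exact: H2_shift_mul.
have Hgz : H2 (fun z => gamma^-1 * ztheta y' z) by exact: H2Z.
have Lgr : L2_circle (gt \* r i).
  apply: (L2_aeq _ (aeq_sym grE)); last exact: H2_L2.
  by apply: cmeasM => //; exact: L2_meas.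
have Hf2 : H2 (f2 i) by have [] := H2_projP Lgr.
have f2E : aeq (f2 i) (fun z => gamma^-1 * ztheta y' z) by exact: H2_proj_id Lgr grE Hgz.
exists y'; split=> // Y HY.
have LzY := H2_L2 (H2_shift_mul ut Ht HY); have Lt := H2_L2 Ht.
have HzY := H2_shift HY.
have zE : ztheta Y = (fun z => theta z * (z * Y z)) by apply/funext => z; rewrite /shift_mul mulrCA.
have f2r : aeq (f2 i) (fun z => gamma^-1 * r i z).
  by apply: aeS2 f2E rE => t -> ->.
have Lgr' : L2_circle (fun z => gamma^-1 * r i z) by exact: L2Z.
rewrite (inner_aeq (H2_L2 Hf2) Lgr' LzY LzY f2r (aeq_refl _)) innerZl//.
have Lbt : L2_circle (fun z => inner_L2 (fun x => q i x / theta x) (fun=> 1) * theta z) by exact: L2Z.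
rewrite /r innerBl// innerZl// {1}zE Pq// -zE.
have -> : inner_L2 theta (ztheta Y) = 0.
  transitivity (inner_L2 (fun z => theta z * (fun=> 1 : C) z) (fun z => theta z * (z * Y z))).
    by rewrite zE; congr inner_L2; apply/funext => z; rewrite mulr1.
  rewrite (inner_unimodular ut L1 (H2_L2 HzY)) (innerC (H2_L2 HzY) L1).
  by rewrite inner_shift_1// conjC0.
have guE : aeq (g \* u i) (fun z => gamma * u i z) by apply: aeS gE => t /= ->.
have Lgui : L2_circle (fun z => gamma * u i z) by exact: L2Z.
rewrite mulr0 subr0 (inner_aeq Lgu Lgui LzY LzY guE (aeq_refl _)) innerZl//.
by rewrite mulrA mulVf// mul1r.
Qed.

(** Write [z h = k + y] with [y] the projection on [z theta H^2]. The part [k] is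
    computed from the equation of [h]: applying [J conj theta] turns the pairing of
    [z h] with the complement of [z theta H^2] into a pairing of [J(conj theta h)] with
    [z H^2], and there the kernel equation replaces it by the [v i]. The part [y] is
    killed by the unperturbed Hankel operator, so it only fails to be in the
    kernel because of [<y, u i> = <y, f2 i>]; its projection on the [f2 i] removes that. *)
Lemma shift_decomposition h d (e : 'I_d -> C -> C) :
  (forall i, span_ae e (f1 i)) -> (forall i, span_ae e (f2 i)) -> K h ->
  exists m f, [/\ K m, span_ae e f & aeq (shift_op h) (m \+ f)].
Proof.
move=> ef1 ef2 /kerP[Hh hK]; have Lh := H2_L2 Hh.
have Hx := H2_shift Hh; set x := fun z => z * h z in Hx; have Lx := H2_L2 Hx.
have [y0 Hy0 Py0] := shift_mul_proj ut Ht Lx.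
have Hy := H2_shift_mul ut Ht Hy0; set y := ztheta y0 in Hy Py0; have Ly := H2_L2 Hy.
pose k z := x z - y z; have Hk : H2 k by exact: H2B.
have Lk := H2_L2 Hk.
(* [y] is corrected by its projection [Q] on the span of the [f2 i]; this span is
   orthogonalised separately because [y - Q] has to stay in [z theta H^2] *)
pose A2 := [set f | exists i, f = f2 i].
have A2L p : A2 p -> L2_circle p.
  by move=> [i ->]; have [y' [_ /H2_L2]] := toeplitz_defectP i.
have [d2 [e2 [_ Ae2 oe2 fe2]]] := gram_schmidt A2L (fun i => ex_intro _ i erefl : A2 (f2 i)).
have Le2 j : L2_circle (e2 j) by exact: (lin_span_L2 A2L).
have ee2 j : span_ae e (e2 j).
  by apply: lin_span_span_ae (Ae2 j) => _ [i ->].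
pose Q z := \sum_(j < d2) inner_L2 y (e2 j) * e2 j z.
have eQ : span_ae e Q by exact: span_ae_sum.
have HQ : H2 Q by case: eQ.
have LQ := H2_L2 HQ.
pose m z := y z - Q z; have Hm : H2 m by exact: H2B.
have Lm := H2_L2 Hm.
have me2 j : (j < d2)%N -> inner_L2 m (e2 j) = 0.
  move=> jd; rewrite innerBl// [X in _ - X]inner_suml//; last by move=> i; exact: L2Z.
  rewrite (bigD1 (Ordinal jd))//= innerZl// oe2// eqxx mulr1 big1 ?addr0 ?subrr// => i ij.
  by rewrite innerZl// oe2// (_ : (i : nat) == j = false) ?mulr0//; apply: negbTE ij.
have mf2 i : inner_L2 m (f2 i) = 0.
  have Lf2 : L2_circle (f2 i) by apply: A2L; exists i.
  have LS : L2_circle (fun z => \sum_(j < d2) inner_L2 (f2 i) (e2 j) * e2 j z).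
    by apply: L2_sum => j; exact: L2Z.
  rewrite (inner_aeq Lm Lm Lf2 LS (aeq_refl m) (fe2 i)) inner_sumr//; last by move=> j; exact: L2Z.
  by apply: big1 => j _; rewrite innerZr// me2// mulr0.
have rangeZ p : lin_span A2 p -> exists2 Y, H2 Y & aeq p (ztheta Y).
  move=> [a [w [c [Aw ->]]]].
  have ex j : exists Y, H2 Y /\ aeq (w j) (ztheta Y).
    have [i ->] := Aw j; have [Y [HY _ fY _]] := toeplitz_defectP i.
    exists (fun z => gamma^-1 * Y z); split; first exact: H2Z.
    by apply: aeS fY => t ->; rewrite /shift_mul; ring.
  have [Y HY] := choice ex.
  exists (fun z => \sum_(j < a) c j * Y j z).
    by apply: H2_sum => j; apply: H2Z; have [] := HY j.
  suff : forall s : seq 'I_a, aeq (fun z => \sum_(j <- s) c j * w j z)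
      (ztheta (fun z => \sum_(j <- s) c j * Y j z)) by move/(_ (index_enum _)).
  elim=> [|j s ih]; first by apply: aeT => t; rewrite /shift_mul !big_nil !mulr0.
  apply: aeS2 ih (HY j).2 => t; rewrite /shift_mul !big_cons => -> ->; ring.
have [m0 Hm0 mm0] : exists2 Y, H2 Y & aeq m (ztheta Y).
  have [Y HY QY] := rangeZ Q (lin_span_sum _ (fun j : 'I_d2 => Ae2 j)).
  exists (fun z => y0 z - Y z); first exact: H2B.
  by apply: aeS QY => t; rewrite /m /y /shift_mul => ->; ring.
have Lzm0 := H2_L2 (H2_shift_mul ut Ht Hm0).
have mu0 i : inner_L2 m (u i) = 0.
  have [Y [_ /H2_L2 Lf2 _ f2u]] := toeplitz_defectP i.
  have := mf2 i; rewrite (inner_aeq Lm Lzm0 Lf2 Lf2 mm0 (aeq_refl _)).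
  rewrite (innerC Lf2 Lzm0) f2u// -(innerC (Lu i) Lzm0) => <-.
  by apply: inner_aeq => //; exact: aeq_refl.
have Km : K m.
  apply/kerP; split=> // m' Hm'; have Lm' := H2_L2 Hm'.
  rewrite inner_adjR// big1 ?addr0 => [|i _]; last by rewrite mu0 mul0r.
  rewrite (inner_aeq (prehankel_L2 ut Lm) (prehankel_L2 ut Lzm0) Lm' Lm' _ (aeq_refl _)).
    by rewrite inner_prehankel_shift_mul// mulr0.
  by apply: aeq_flip; apply: aeS mm0 => t ->.
pose S z := \sum_(i < n) inner_L2 h (u i) * f1 i z.
have Hf1 i : H2 (f1 i) by have [] := hankel_defectP i.
have Lf1 i : L2_circle (f1 i) := H2_L2 (Hf1 i).
have HS : H2 S by apply: H2_sum => i; exact: H2Z.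
have LS := H2_L2 HS.
(* the sum is tested against [m' = z theta m1 + m2] with [m2] orthogonal to
   [z theta H^2] *)
have kS : aeq (fun z => k z + S z) (fun=> 0).
  apply: H2_eq0 => [|m' Hm']; first exact: H2D.
  have Lm' := H2_L2 Hm'.
  have [m1 Hm1 Pm1] := shift_mul_proj ut Ht Lm'.
  have Hz1 := H2_shift_mul ut Ht Hm1; have Lz1 := H2_L2 Hz1.
  pose m2 z := m' z - ztheta m1 z; have Hm2 : H2 m2 by exact: H2B.
  have Lm2 := H2_L2 Hm2.
  have kz Y : H2 Y -> inner_L2 k (ztheta Y) = 0 by exact: Py0.
  have Hs := prehankel_model_H2 ut Ht Hm2 Pm1; set s := Tt m2 in Hs; have Ls := H2_L2 Hs.
  have Hzs := H2_shift Hs; have Lzs := H2_L2 Hzs.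
  have Hb i := H2_backward_shift (Hv i).
  have LJb i : L2_circle (flipJ (backward_shift (v i))) by exact/L2_flip/H2_L2.
  have f1z i : inner_L2 (f1 i) (ztheta m1) = 0.
    have [_ ->//] := hankel_defectP i.
    have -> : ztheta m1 = fun z => theta z * (z * m1 z).
      by apply/funext => z; rewrite /shift_mul mulrCA.
    rewrite (inner_unimodular ut)//; last exact/H2_L2/H2_shift.
    transitivity (gamma^-1 * inner_L2 (flipJ (fun z => z * backward_shift (v i) z)) m1).
      congr (_ * _); rewrite (inner_mulJ (fun z => z^*) (flipJ (backward_shift (v i)))).
      by congr inner_L2; apply/funext => z; rewrite conjCK.
    by rewrite inner_flip_H2// mulr0.
  have f1m i : inner_L2 (f1 i) m2 = gamma^-1 * inner_L2 (v i) (fun z => z * s z).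
    have [_ ->//] := hankel_defectP i; congr (_ * _).
    rewrite inner_mulJ -inner_backward_shift// -[RHS]inner_flip//; [|exact: H2_L2].
    by rewrite /s /prehankel flipK.
  have km : inner_L2 k m2 = - \sum_(i < n) inner_L2 h (u i) * inner_L2 (f1 i) m2.
    have -> : inner_L2 k m2 = inner_L2 x m2.
      by rewrite innerBl// (innerC Lm2 Ly) Pm1// conjC0 subr0.
    have -> : inner_L2 x m2 = inner_L2 (Tt h) (fun z => z * s z).
      rewrite -(inner_unimodular utJ Lx Lm2).
      rewrite -inner_flip; [|exact: L2_unimodular|exact: L2_unimodular].
      transitivity (inner_L2 (fun z => z^* * Tt h z) s).
        by congr inner_L2; apply/funext => z; rewrite /flipJ /x mulrCA.
      by rewrite inner_mulJ; congr inner_L2; apply/funext => z; rewrite conjCK.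
    have := hK _ Hzs; rewrite inner_adjR// => /eqP; rewrite addr_eq0 => /eqP E.
    apply: (mulfI gamma0); rewrite E mulrN mulr_sumr; congr (- _).
    by apply: eq_bigr => i _; rewrite f1m mulrCA mulVKf.
  have -> : m' = (fun z => ztheta m1 z + m2 z).
    by apply/funext => z; rewrite /m2 addrC subrK.
  have LkS : L2_circle (fun z => k z + S z) by exact: L2D.
  rewrite innerDr// innerDl// kz// add0r [X in X + _]inner_suml//; last by move=> i; exact: L2Z.
  rewrite big1 ?add0r => [|i _]; last by rewrite innerZl// f1z mulr0.
  rewrite innerDl// km [X in _ + X]inner_suml//; last by move=> i; exact: L2Z.
  by rewrite addrC; apply/eqP; rewrite subr_eq0; apply/eqP/eq_bigr => i _; rewrite innerZl.
exists m, (fun z => k z + Q z); split=> //.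
  have ek : span_ae e k.
    have : span_ae e (fun z => \sum_(i < n) (- inner_L2 h (u i)) * f1 i z) by exact: span_ae_sum.
    apply: span_ae_aeq => //; apply: aeS kS => t /eqP.
    rewrite addr_eq0 => /eqP ->; rewrite /S -sumrN.
    by apply: eq_bigr => i _; rewrite mulNr.
  have := span_ae_lin 1 ek eQ; congr (span_ae e).
  by apply/funext => z; rewrite mul1r.
apply: aeT => t; rewrite /shift_op /= /m /k /x; ring.
Qed.

End Perturbation.

End Kernel.

(** * The defect of the kernel *)

Theorem theorem3p5 (R : realType) (theta g gt : R[i] -> R[i])
    (n : nat) (u v : 'I_n -> R[i] -> R[i])
    (theta_inner : inner_function theta) (theta_nonconst : nonconstant theta)
    (gG : GHinfty g) (gtP : inverse_in_Hinfty g gt)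
    (uH2 : forall i, H2 (u i)) (vH2 : forall i, H2 (v i))
    (u_on : orthonormal_family u) (v_on : orthonormal_family v) :
  let phi := fun z => (theta z)^* * g z in
  let K := op_ker (hankel_perturbation phi u v) in
  let q := fun i => ortho_proj (mul_space theta (@H2 R)) (g \* u i) in
  let F := cspan [set f | exists i : 'I_n,
    f = hankel (flipJ theta \* flipJ gt) (backward_shift (v i)) \/
    f = toeplitz gt (fun z =>
          q i z - inner_L2 (fun x => q i x / theta x) (fun=> 1) * theta z)] in
  [/\ almost_shift_invariant K,
      exists2 d, has_defect K d & (d <= 2 * n)%N &
      exists d F0, [/\ defect_space K d F0, (d <= 2 * n)%N & F0 `<=` F]].
Proof.
move=> phi K q F.
have Ht : H2 theta by exact: Hinfty_H2 theta_inner.1.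
have ut : unimodular theta.
  split; first exact: L2_meas (H2_L2 Ht).
  by apply: aeS theta_inner.2 => t; rewrite normCE => /(congr1 (@complex.Re _)).
have [Hgt ggt] := gtP; have {}Hgt := Hinfty_H2 Hgt.
have [/Hinfty_H2 Hg _ [c gc]] := gG.
(* [conj g = |g|^2 / g] *)
have gJ : aeq (fun z => Num.conj (g z)) (fun z => c ^+ 2 * gt z).
  apply: aeS2 ggt gc => t /= gg <-.
  by rewrite normCK mulrAC gg mul1r.
have gE := H2_conj_const Hg (H2Z (c ^+ 2) Hgt) gJ.
set gamma := inner_L2 g _ in gE.
have ggt1 : aeq (fun z => gamma * gt z) (fun=> 1) by apply: aeS2 ggt gE => t /= <- ->.
have gamma0 : gamma != 0.
  apply/eqP => g0; have L1 := L2_cst (1 : R[i]); have L0 := L2_cst (0 : R[i]).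
  have E : aeq (fun=> 0 : R[i]) (fun=> 1) by apply: aeS ggt1 => t <-; rewrite g0 mul0r.
  have /eqP := inner_1_1 R; rewrite -(inner_aeq L0 L1 L1 L1 E (aeq_refl _)) inner0l//.
  by rewrite eq_sym oner_eq0.
have gtE : aeq gt (fun=> gamma^-1).
  apply: aeS ggt1 => t gt1; apply: (mulfI gamma0).
  by rewrite gt1 mulfV.
have mg := L2_meas (H2_L2 Hg); have mgt := L2_meas (H2_L2 Hgt).
pose f1 i := hankel (flipJ theta \* flipJ gt) (backward_shift (v i)).
pose f2 i := toeplitz gt (fun z =>
  q i z - inner_L2 (fun x => q i x / theta x) (fun=> 1) * theta z).
have Hf1 i : H2 (f1 i) by have [] := hankel_defectP ut mgt gtE vH2 i.
have Hf2 i : H2 (f2 i).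
  by have [y []] := toeplitz_defectP ut Ht mg mgt gamma0 gE gtE uH2 i.
pose A := [set f | exists i : 'I_n, f = f1 i \/ f = f2 i].
have AL p : A p -> L2_circle p by move=> [i [->|->]]; exact: H2_L2.
pose G (i : 'I_(n + n)) := match fintype.split i with inl j => f1 j | inr j => f2 j end.
have AG i : A (G i).
  by rewrite /G; case: (fintype.split i) => j; exists j; [left|right].
have [d [e [dn Ae oe Ge]]] := gram_schmidt AL AG.
pose w (j : 'I_d) := e j.
have He p : lin_span A p -> H2 p.
  move=> [a [x [b [Ax ->]]]]; apply: H2_sum => i; apply: H2Z.
  by have [j [->|->]] := Ax i.
have ow : orthonormal_family w by move=> i j; rewrite /w oe.
have eG i : span_ae w (G i).
  split; first by have [j [->|->]] := AG i.
  by exists (fun j : 'I_d => inner_L2 (G i) (e j)); exact: Ge.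
have ef1 i : span_ae w (f1 i).
  by have := eG (lshift n i); rewrite /G (unsplitK (inl i)).
have ef2 i : span_ae w (f2 i).
  by have := eG (rshift n i); rewrite /G (unsplitK (inr i)).
have dF : defect_space K d (span_ae w).
  split; first by apply: span_ae_dim => // i; exact: (He _ (Ae i)).
  move=> h Kh.
  exact: (shift_decomposition ut Ht mg mgt gamma0 gE gtE uH2 vH2 ef1 ef2 Kh).
have d2n : (d <= 2 * n)%N by rewrite mul2n -addnn.
split.
- split; last by exists d, (span_ae w).
  exact: (ker_closed ut mg gE uH2 vH2).
- have [d' Kd' d'd] := least_defect dF; exists d' => //; exact: leq_trans d2n.
exists d, (span_ae w); split=> //.
by apply: span_ae_cspan => // i; exact: Ae.
Qed.
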